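(* Fix $t>0$ and an integer $k\ge 1$. Let $f$ be any polynomial with real coefficients in the $k$ real variables $x_1,\dots,x_k$, regarded for $N>k$ as a function on (a neighborhood in $\mathbb R^N$ of) the shifted sphere $\tilde S^{N-1}(\sqrt N)\subset\mathbb R^N$ depending only on the coordinates $x_1,\dots,x_k$ of $\mathbb R^N$ ($f$ is a fixed polynomial in $x_1,\dots,x_k$, not in $\tilde x_1$). Then $$\lim_{N\to\infty}\int_{\tilde S^{N-1}(\sqrt N)} f(x_1,\dots,x_k)\,d\tilde\rho^{\,N-1}_t = \int_{\mathbb R^k} f(x_1,\dots,x_k)\, c_{t,k}\exp\left(-\frac{x_1^2}{2(1-e^{-t}-te^{-t})}-\frac{x_2^2+x_3^2+\dots+x_k^2}{2(1-e^{-t})}\right)dx_1\cdots dx_k,$$ where $$c_{t,k}=(2\pi)^{-k/2}(1-e^{-t}-te^{-t})^{-1/2}(1-e^{-t})^{(1-k)/2}.$$ That is, the limit is the integral of $f$ against the infinite Gaussian (product) measure $u_t^\infty$ on $\mathbb R^\infty$ whose marginal on the first $k$ coordinates is, for each $k$, the Gaussian measure on the right-hand side.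
   Context: For $t>0$ and a natural number $N$ put $m(t,N)=\sqrt N\exp\left\{\frac t2\left(-1+\frac1N\right)\right\}$ and $\tilde x_1=x_1+m(t,N)$. The shifted sphere is $$\tilde S^{N-1}(\sqrt N)=\{(x_1,\dots,x_N)\in\mathbb R^N:\ \tilde x_1^2+x_2^2+\dots+x_N^2=N\},$$ the sphere of radius $\sqrt N$ centered at $(-m(t,N),0,\dots,0)$. Its north pole is $\tilde{\mathbf p}=(\sqrt N-m(t,N),0,\dots,0)$. Heat kernel measure: $\tilde\rho^{\,N-1}_t$ (written $\rho_t^{N-1}(\tilde{\mathbf x})\,d\tilde{\mathbf x}$ in the paper) denotes the heat kernel measure at time $t$ on $\tilde S^{N-1}(\sqrt N)$ based at $\tilde{\mathbf p}$. It is the probability measure on the sphere whose density with respect to the rotation-invariant normalized volume measure is the fundamental solution at time $t$ of the heat equation $\partial_s K=\frac12\Delta K$ with $\Delta$ the Laplace–Beltrami operator of the sphere (with the metric induced from $\mathbb R^N$), started at $\tilde{\mathbf p}$ (i.e. converging to the point mass at $\tilde{\mathbf p}$ as $s\downarrow0$). Here the sphere, i.e. the shift $m(t,N)$, is taken with the same fixed $t$. *)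

(* Defs.v *)
From HB Require Import structures.
From mathcomp Require Import all_boot all_order all_algebra.
From mathcomp Require Import all_classical all_reals all_analysis.
(* Not imported: the notations of mpoly clash with those of analysis. *)
From mathcomp Require mpoly.

Set Implicit Arguments.
Unset Strict Implicit.
Unset Printing Implicit Defensive.

Import Order.TTheory GRing.Theory Num.Theory.
Import numFieldNormedType.Exports.

Local Open Scope classical_set_scope.
Local Open Scope ring_scope.

Notation borel_rV R N := (g_sigma_algebraType (@open 'rV[R]_N)).

(* Coordinates are numbered from 0: [coordinate x 0] is x_1. The value out of
   range is 0. *)
Definition coordinate (R : realType) (N : nat) (x : 'rV[R]_N) (i : nat) : R :=
  if insub i is Some j then x 0 j else 0.

Section sphere.
Variables (R : realType) (N : nat).
Implicit Types (c p x y : 'rV[R]_N) (r : R).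

(* The norm [`|x|] of the library on row vectors is the sup norm. *)
Definition enorm x : R := Num.sqrt (\sum_(i < N) x 0 i ^+ 2).

Definition sphere c r : set 'rV[R]_N :=
  [set x | \sum_(i < N) (x - c) 0 i ^+ 2 = r ^+ 2].

(* Rotation-invariance determines a probability measure on the sphere. *)
Definition normalized_volume c r (sigma : probability (borel_rV R N) R) :=
  sigma (sphere c r) = 1%E /\
  forall Q : 'M[R]_N, Q *m Q^T = 1%:M -> \det Q = 1 ->
  forall A : set (borel_rV R N), measurable A ->
  pushforward sigma (fun x : borel_rV R N => c + (x - c) *m Q : borel_rV R N) A
  = sigma A.

(* The nearest-point projection of R^N \ {c} onto the sphere. Composed with it,
   a function on the sphere is extended to R^N \ {c}, constantly along the
   normals, and has the same regularity as its extension. *)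
Definition retract c r x : 'rV[R]_N := c + (r / enorm (x - c)) *: (x - c).

Definition tangent_proj c r x : 'M[R]_N :=
  1%:M - (r ^- 2) *: ((x - c)^T *m (x - c)).

Definition partial (F : 'rV[R]_N -> R) (i : 'I_N) x : R :=
  'D_(delta_mx 0 i) F x.

Definition sphere_grad c r (u : 'rV[R]_N -> R) x : 'rV[R]_N :=
  (\row_(i < N) partial (u \o retract c r) i x) *m tangent_proj c r x.

(* The divergence is the trace of X |-> nabla X on the tangent space; the
   Levi-Civita connection nabla of the induced metric is the tangential
   projection of the Euclidean derivative. *)
Definition sphere_div c r (X : 'rV[R]_N -> 'rV[R]_N) x : R :=
  \tr (tangent_proj c r x *m 'J (X \o retract c r) x).

Definition laplace_beltrami c r (u : 'rV[R]_N -> R) : 'rV[R]_N -> R :=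
  sphere_div c r (sphere_grad c r u).

(* Class C^1 in time and C^2 in space on ]0, +oo[ x sphere c r; the values of
   K s off the sphere play no role. *)
Definition C12_on_sphere c r (K : R -> 'rV[R]_N -> R) : Prop :=
  let F s := K s \o retract c r in
  forall (s : R) x, 0 < s -> x != c ->
  [/\ {for (s, x), continuous (fun q : R * 'rV[R]_N => F q.1 q.2)},
      derivable (F ^~ x) s 1 /\
      {for (s, x), continuous (fun q : R * 'rV[R]_N => derive1 (F ^~ q.2) q.1)},
      differentiable (F s) x /\
      forall i, {for (s, x), continuous
        (fun q : R * 'rV[R]_N => partial (F q.1) i q.2)}
    & forall i, differentiable (partial (F s) i) x /\
      forall j, {for (s, x), continuous
        (fun q : R * 'rV[R]_N => partial (partial (F q.1) i) j q.2)}].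

Definition fundamental_solution c r (sigma : probability (borel_rV R N) R) p
    (K : R -> 'rV[R]_N -> R) : Prop :=
  [/\ C12_on_sphere c r K,
      forall (s : R) x, 0 < s -> sphere c r x ->
        derive1 (K ^~ x) s = 2^-1 * laplace_beltrami c r (K s) x
    & forall phi : 'rV[R]_N -> R, {within sphere c r, continuous phi} ->
        (fun s : R => \int[sigma]_(x in sphere c r) (phi x * K s x)%:E)%E
          @ 0^'+ --> (phi p)%:E].

(* These conditions determine rho: the rotation-invariant probability measure
   and the fundamental solution are unique. *)
Definition heat_kernel_measure c r p (t : R)
    (rho : probability (borel_rV R N) R) : Prop :=
  exists (sigma : probability (borel_rV R N) R) (K : R -> 'rV[R]_N -> R),
  [/\ normalized_volume c r sigma,
      fundamental_solution c r sigma p K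
    & forall A : set (borel_rV R N), measurable A ->
        rho A = (\int[sigma]_(x in A `&` sphere c r) (K t x)%:E)%E].

End sphere.

Section shifted_sphere.
Variables (R : realType) (t : R) (N : nat).

Definition shift_m : R :=
  Num.sqrt N%:R * expR (t / 2 * (- 1 + N%:R^-1)).

Definition on_first_axis (a : R) : 'rV[R]_N :=
  \row_(j < N) (if j == 0%N :> nat then a else 0).

Definition shifted_center : 'rV[R]_N := on_first_axis (- shift_m).

Definition shifted_sphere : set 'rV[R]_N :=
  sphere shifted_center (Num.sqrt N%:R).

Definition north_pole : 'rV[R]_N := on_first_axis (Num.sqrt N%:R - shift_m).

Definition shifted_heat_kernel_measure (rho : probability (borel_rV R N) R) :=
  heat_kernel_measure shifted_center (Num.sqrt N%:R) north_pole t rho.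

End shifted_sphere.

Arguments shifted_sphere {R} t N _.

Section lebesgue_tuple.
Variable R : realType.

Definition snoc_front k (z : k.-tuple R * measurableTypeR R) : k.+1.-tuple R :=
  [tuple of z.2 :: z.1].

Lemma measurable_snoc_front k : measurable_fun setT (@snoc_front k).
Proof. by apply: measurable_cons. Qed.

Definition lebesgue_step k (mu : {measure set (k.-tuple R) -> \bar R}) :
  {measure set (k.+1.-tuple R) -> \bar R}.
Proof.
refine (pushforward (mu \x @lebesgue_measure R)%E (@snoc_front k)).
exact: measurable_snoc_front.
Defined.

(* k-dimensional Lebesgue measure, on the Borel sets of R^k. *)
Fixpoint lebesgue_tuple k : {measure set (k.-tuple R) -> \bar R} :=
  if k is k'.+1 then lebesgue_step (lebesgue_tuple k') else \d_[tuple].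

End lebesgue_tuple.

Section gaussian.
Variables (R : realType) (t : R) (k : nat).

Definition var_first : R := 1 - expR (- t) - t * expR (- t).
Definition var_other : R := 1 - expR (- t).

Definition gauss_const : R :=
  (2 * pi) `^ (- (k%:R / 2)) * var_first `^ (- 2^-1)
    * var_other `^ ((1 - k%:R) / 2).

Definition gauss_density (x : k.-tuple R) : R :=
  gauss_const *
  expR (- (x`_0 ^+ 2 / (2 * var_first))
        - (\sum_(1 <= i < k) x`_i ^+ 2) / (2 * var_other)).

Definition gauss_marginal (A : set (k.-tuple R)) : \bar R :=
  (\int[lebesgue_tuple R k]_(x in A) (gauss_density x)%:E)%E.

End gaussian.

(* R^oo with the product sigma-algebra. *)
Notation Rinfty R := (g_sigma_algebraType
  [set A : set (nat -> R) | exists (i : nat) (B : set R),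
     measurable B /\ A = [set x : nat -> R | B (x i)]]).

(* Determines u, since the finite-dimensional cylinders generate. *)
Definition infinite_gaussian (R : realType) (t : R)
    (u : probability (Rinfty R) R) : Prop :=
  forall k, (0 < k)%N -> forall A : set (k.-tuple R), measurable A ->
  pushforward u (fun x : Rinfty R => [tuple x i | i < k]) A
  = gauss_marginal t A.

(* Main.v *)
Require Import Defs.
From HB Require Import structures.
From mathcomp Require Import all_boot all_order all_algebra.
From mathcomp Require Import all_classical all_reals all_analysis.
From mathcomp Require mpoly.
From mathcomp Require Import measurable_realfun ring lra.

Set Implicit Arguments.
Unset Strict Implicit.
Unset Printing Implicit Defensive.

Import Order.TTheory GRing.Theory Num.Theory.
Import numFieldNormedType.Exports.

Local Open Scope classical_set_scope.
Local Open Scope ring_scope.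

(** Write r = sqrt N and let c be the center of the sphere, m_s = shift_m s N.  For a multi-index a
on the first k coordinates, consider the moments

  M_a(s) = int (x_1 - c_1 - m_s)^a_1 (x_2 - c_2)^a_2 ... (x_k - c_k)^a_k K_s(x) d sigma(x)

of the heat kernel K_s.  At s = t the shifted coordinate x_1 - c_1 - m_t is x_1 itself, so the
integrals of the theorem are fixed linear combinations of the M_a(t), and it is enough to find
the limit of each moment (integral_poly_moments).

The moments solve an explicit linear system of differential equations.  The rotation fields
L_ij = y_i d_j - y_j d_i, y = x - c, are tangent to the sphere, and for functions extended
constantly along the normals the sum of L_ij^2 over all ordered pairs (i, j) is 2 r^2 times the Laplace-Beltrami operator
(laplace_beltramiE, sum_rot_field_sq, laplace_beltrami_rot).  The volume is invariant under the plane
rotations generated by L_ij, so L_ij g has integral zero (Rintegral_rot_field); with the Leibniz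
rule this makes the Laplacian symmetric (green).  The heat equation then transfers to test
functions (weak_heat), and the Laplacian of a monomial restricted to the sphere is computed by
the Euler identities (rot_laplacian_centered_mono).  The outcome (moment_ode) expresses the derivative of
M_a through M_a and moments of lower degree.  The centering m_s solves the equation of the mean of
x_1 - c_1, which is why the terms of degree |a|-1 carry a factor m_s / N and disappear in the
limit.  The heat kernel concentrates at the pole, where all centered coordinates vanish at s = 0,
so M_a(s) tends to 1 if a = 0 and to 0 otherwise (moment_init).

As N grows the coefficients converge uniformly on ]0, t]: the decay rate of M_a tends to |a|/2,
m_s / N to 0 and m_s^2 / N to exp(-s).  The limiting system is solved by products of one-dimensional
Gaussian moments, with the variance 1 - exp(-s) - s exp(-s) in the first coordinate and 1 - exp(-s) in
the others (is_derive_limit_moment).  Comparing the two triangular systems by induction on the degree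
(linear_comparison, moments_limit) gives M_a(t) --> E[X^a].  Finally these products are the polynomial
moments of the Gaussian density: one variable at a time by integration by parts (integral_gauss_moment), and
over R^k by Fubini (integral_tuple_prod).  The statement on R^oo follows because a
polynomial in the first k coordinates only sees the k-dimensional marginal. *)

(** * Directional derivatives and partial derivatives *)

Section directional.
Variables (R : realType) (N : nat).
Implicit Types (u w : 'rV[R]_N -> R) (x v c : 'rV[R]_N).

Lemma derive_partials u x v : differentiable u x ->
  'D_v u x = \sum_i v 0 i * partial u i x.
Proof.
move=> du; rewrite deriveE// {1}(row_sum_delta v) linear_sum/=.
by apply: eq_bigr => i _; rewrite linearZ/= /partial -deriveE.
Qed.

Lemma derivable_coord x v (i : 'I_N) : is_derive x v (fun y : 'rV[R]_N => y 0 i) (v 0 i).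
Proof.
have dc : differentiable (fun y : 'rV[R]_N => y 0 i) x by exact: differentiable_coord.
apply: DeriveDef; first exact: diff_derivable.
rewrite /derive.
apply: cvg_lim => //.
apply: cvg_near_cst.
near=> h.
rewrite /= (_ : (h *: v + x) 0 i = h * v 0 i + x 0 i); last by rewrite !mxE.
rewrite addrK [LHS]mulrA mulVf ?mul1r//.
near: h. exact: nbhs_dnbhs_neq.
Unshelve. all: by end_near.
Qed.

(** Eta-expanded forms of the differentiation rules: they unify with functions that are given by
    an expression in the variable, which is how they occur below. *)
Lemma is_deriveD_fun (f g : 'rV[R]_N -> R) x v df dg :
  is_derive x v f df -> is_derive x v g dg ->
  is_derive x v (fun y => f y + g y) (df + dg).
Proof. exact: is_deriveD. Qed.

Lemma is_deriveB_fun (f g : 'rV[R]_N -> R) x v df dg :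
  is_derive x v f df -> is_derive x v g dg ->
  is_derive x v (fun y => f y - g y) (df - dg).
Proof. exact: is_deriveB. Qed.

Lemma is_deriveM_fun (f g : 'rV[R]_N -> R) x v df dg :
  is_derive x v f df -> is_derive x v g dg ->
  is_derive x v (fun y => f y * g y) (f x * dg + g x * df).
Proof. exact: is_deriveM. Qed.

Lemma is_derive_sum_fun n (f : 'I_n -> 'rV[R]_N -> R) x v df :
  (forall i, is_derive x v (f i) (df i)) ->
  is_derive x v (fun y => \sum_i f i y) (\sum_i df i).
Proof.
move=> h; have := is_derive_sum h.
by rewrite (_ : \sum_i f i = fun y => \sum_i f i y)//; apply/funext => y; rewrite fct_sumE.
Qed.

(** Reduces a directional derivative to a derivative on the line, where a chain rule with a scalar
    outer function is at hand. *)
Lemma is_derive_line (f : 'rV[R]_N -> R) x v df :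
  is_derive x v f df <-> is_derive (0 : R) 1 (fun h : R => f (h *: v + x)) df.
Proof.
have e : 'D_v f x = 'D_1 (fun h : R => f (h *: v + x)) 0.
  rewrite /derive; set g1 := fun h => h^-1 *: _; set g2 := fun h => h^-1 *: _.
  suff -> : g1 = g2 by [].
  by rewrite funeqE /g1 /g2 => h /=; rewrite addr0 scale0r add0r [_%:A]mulr1.
split=> -[d1 d2].
- by apply: DeriveDef; [apply/(derivable1P _ _ _).1 | rewrite -e].
- by apply: DeriveDef; [apply/(derivable1P f x v).2 | rewrite e].
Qed.

Lemma is_derive_comp1 (f : 'rV[R]_N -> R) (g : R -> R) x v df dg :
  is_derive x v f df -> is_derive (f x) 1 g dg ->
  is_derive x v (fun y => g (f y)) (dg * df).
Proof.
move=> /is_derive_line df1 dg1; apply/is_derive_line.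
have dg2 : is_derive ((fun h : R => f (h *: v + x)) 0) 1 g dg.
  by rewrite /= scale0r add0r.
exact: (is_derive1_comp dg2 df1).
Qed.

Lemma is_derive_coord c x v (i : 'I_N) : is_derive x v (fun y : 'rV[R]_N => (y - c) 0 i) (v 0 i).
Proof.
have -> : (fun y : 'rV[R]_N => (y - c) 0 i) = (fun y => y 0 i - c 0 i).
  by apply/funext => y; rewrite !mxE.
rewrite -[X in is_derive _ _ _ X]subr0; apply: is_deriveB_fun.
exact: derivable_coord.
Qed.

Lemma differentiable_shifted_coord c x (i : 'I_N) : differentiable (fun y : 'rV[R]_N => (y - c) 0 i) x.
Proof.
have -> : (fun y : 'rV[R]_N => (y - c) 0 i) = (fun y => y 0 i - c 0 i).
  by apply/funext => y; rewrite !mxE.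
by apply: differentiableB => //; exact: differentiable_coord.
Qed.

Lemma partialP u i x : differentiable u x ->
  is_derive x (delta_mx 0 i) u (partial u i x).
Proof. by move=> du; apply: derivableP; exact: diff_derivable. Qed.

Lemma partial_eq u i x a : is_derive x (delta_mx 0 i) u a -> partial u i x = a.
Proof. by move=> h; rewrite /partial; apply: derive_val. Qed.

Lemma differentiable_prod (u w : 'rV[R]_N -> R) x :
  differentiable u x -> differentiable w x -> differentiable (fun y => u y * w y) x.
Proof. exact: differentiableM. Qed.

Lemma differentiable_row M (f : 'rV[R]_N -> 'rV[R]_M) x :
  (forall j, differentiable (fun y => f y 0 j) x) -> differentiable f x.
Proof.
move=> df.
have -> : f = \sum_j (fun y => f y 0 j *: delta_mx 0 j).
  by apply/funext => y; rewrite fct_sumE [LHS]row_sum_delta.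
by apply: differentiable_sum => j; exact: differentiableZl.
Qed.

Lemma diff_row M (f : 'rV[R]_N -> 'rV[R]_M) x v j :
  differentiable f x -> ('d f x v) 0 j = 'D_v (fun y => f y 0 j) x.
Proof.
move=> df; rewrite -deriveE// derive_mx ?mxE//; exact: diff_derivable.
Qed.

End directional.

(** * The Laplace-Beltrami operator of a sphere in Euclidean coordinates *)

Section sphere_geometry.
Variables (R : realType) (N : nat) (c : 'rV[R]_N) (r : R).
Hypothesis r_gt0 : 0 < r.
Implicit Types (x v : 'rV[R]_N).

Lemma sumsq_gt0 x : x != 0 -> 0 < \sum_i x 0 i ^+ 2.
Proof.
move=> x0; rewrite lt_def sumr_ge0 ?andbT; last by move=> i _; exact: sqr_ge0.
apply: contra x0 => /eqP/psumr_eq0P h; apply/eqP/rowP => i; rewrite mxE.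
by apply/eqP; rewrite -sqrf_eq0 h// => j _; exact: sqr_ge0.
Qed.

Lemma sphere_neq_center x : sphere c r x -> x != c.
Proof.
rewrite /sphere/= => xS; apply/eqP => xc; move: xS.
rewrite xc subrr big1; last by move=> i _; rewrite mxE expr0n.
by move/esym/eqP; rewrite sqrf_eq0 gt_eqF.
Qed.

Lemma enorm_sphere x : sphere c r x -> enorm (x - c) = r.
Proof. by rewrite /sphere/= /enorm => ->; rewrite sqrtr_sqr gtr0_norm. Qed.

Lemma retract_id x : sphere c r x -> retract c r x = x.
Proof.
move=> xS; rewrite /retract enorm_sphere// divff ?gt_eqF// scale1r.
by rewrite addrC subrK.
Qed.

Lemma retract_center : retract c r c = c.
Proof. by rewrite /retract subrr scaler0 addr0. Qed.

Lemma enorm_gt0 x : x != 0 -> 0 < enorm x.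
Proof. by move=> x0; rewrite sqrtr_gt0 sumsq_gt0. Qed.

Lemma sphere_retract x : x != c -> sphere c r (retract c r x).
Proof.
move=> xc; have xc0 : x - c != 0 by rewrite subr_eq0.
rewrite /sphere/= /retract addrAC subrr add0r.
under eq_bigr do rewrite mxE exprMn.
rewrite -mulr_sumr -[X in _ * X]sqr_sqrtr; last first.
  by apply/ltW; exact: sumsq_gt0.
by rewrite -exprMn divfK// gt_eqF// enorm_gt0.
Qed.

Lemma enormZ (a : R) x : 0 <= a -> enorm (a *: x) = a * enorm x.
Proof.
move=> a0; rewrite /enorm; under eq_bigr do rewrite mxE exprMn.
by rewrite -mulr_sumr sqrtrM ?sqr_ge0// sqrtr_sqr ger0_norm.
Qed.

(** The projection onto the sphere is constant along rays; differentiating this identity once and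
    twice gives the two radial identities below. *)
Lemma retract_ray x (a : R) : 0 < a -> retract c r (a *: (x - c) + c) = retract c r x.
Proof.
move=> a0; rewrite /retract addrK enormZ ?ltW// scalerA invfM mulrA.
by rewrite -[r / a / _]mulrA [a^-1 * _]mulrC mulrA divfK// gt_eqF.
Qed.

Lemma open_neq_center : open [set x : 'rV[R]_N | x != c].
Proof.
rewrite (_ : mkset _ = ~` [set c]).
  apply: closed_openC; apply: accessible_closed_set1.
  exact/hausdorff_accessible/norm_hausdorff.
by apply/seteqP; split => z /= /eqP.
Qed.

Lemma near_neq_center x : x != c -> \forall z \near x, z != c.
Proof.
by move=> xc; exact: (open_nbhs_nbhs (conj open_neq_center xc)).
Qed.

Lemma is_derive_sumsq x v :
  is_derive x v (fun z : 'rV[R]_N => \sum_i (z - c) 0 i ^+ 2)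
    (2 * \sum_i (x - c) 0 i * v 0 i).
Proof.
rewrite (_ : 2 * _ = \sum_i ((x - c) 0 i * v 0 i + (x - c) 0 i * v 0 i)); last first.
  by rewrite mulr_sumr; apply: eq_bigr => i _; rewrite mulrDl mul1r.
apply: is_derive_sum_fun => i.
rewrite (_ : (fun _ => _) = (fun z : 'rV[R]_N => (z - c) 0 i * (z - c) 0 i)).
  by apply: is_deriveM_fun; exact: is_derive_coord.
by apply/funext => z; rewrite expr2.
Qed.

Lemma differentiable_sumsq x :
  differentiable (fun z : 'rV[R]_N => \sum_i (z - c) 0 i ^+ 2) x.
Proof.
rewrite (_ : (fun _ => _) = \sum_i (fun z : 'rV[R]_N => (z - c) 0 i * (z - c) 0 i)).
  apply: differentiable_sum => i.
  by apply: differentiable_prod; exact: differentiable_shifted_coord.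
by apply/funext => z; rewrite fct_sumE; apply: eq_bigr => i _; rewrite expr2.
Qed.

Lemma differentiable_retract x : x != c -> differentiable (retract c r) x.
Proof.
move=> xc; have xc0 : x - c != 0 by rewrite subr_eq0.
apply: differentiable_row => j.
rewrite (_ : (fun _ => _) =
  fun z : 'rV[R]_N => c 0 j + r * (enorm (z - c))^-1 * (z - c) 0 j); last first.
  by apply/funext => z; rewrite !mxE.
apply: differentiableD => //.
apply: differentiable_prod; last exact: differentiable_shifted_coord.
apply: differentiable_prod => //.
apply: differentiableV; last by rewrite gt_eqF// enorm_gt0.
apply: (@differentiable_comp _ _ _ _ (fun z : 'rV[R]_N => \sum_i (z - c) 0 i ^+ 2) Num.sqrt).
  exact: differentiable_sumsq.
apply/derivable1_diffP.
by have [] := is_derive1_sqrt (sumsq_gt0 xc0).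
Qed.

Lemma derive_retract x v j : sphere c r x ->
  'D_v (fun z => retract c r z 0 j) x =
  v 0 j - r ^- 2 * (\sum_i (x - c) 0 i * v 0 i) * (x - c) 0 j.
Proof.
move=> xS; have xc := sphere_neq_center xS.
have xc0 : x - c != 0 by rewrite subr_eq0.
rewrite (_ : (fun _ => _) =
  fun z : 'rV[R]_N => (cst (c 0 j) z) + (cst r z) * (enorm (z - c))^-1 * (z - c) 0 j); last first.
  by apply/funext => z; rewrite !mxE.
set S := \sum_i _.
have e1 : is_derive x v (fun z : 'rV[R]_N => enorm (z - c)) ((2 * r)^-1 * (2 * S)).
  rewrite -{1}(enorm_sphere xS).
  exact: (is_derive_comp1 (is_derive_sumsq x v) (is_derive1_sqrt (sumsq_gt0 xc0))).
have e2 : is_derive x v (fun z : 'rV[R]_N => (enorm (z - c))^-1) (- r ^- 2 * ((2 * r)^-1 * (2 * S))).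
  have [d1 d2] := e1.
  have n0 : enorm (x - c) != 0 by rewrite gt_eqF// enorm_gt0.
  apply: DeriveDef; first exact: derivableV.
  by rewrite deriveV// d2 enorm_sphere.
have e3 := is_deriveM_fun (is_derive_cst r x v) e2.
have e4 := is_deriveD_fun (is_derive_cst (c 0 j) x v) (is_deriveM_fun e3 (is_derive_coord c x v j)).
have [_ ->] := e4; rewrite enorm_sphere//=.
by field; rewrite gt_eqF.
Qed.

Lemma tangent_projE x i j :
  tangent_proj c r x i j = (i == j)%:R - r ^- 2 * ((x - c) 0 i * (x - c) 0 j).
Proof. by rewrite !mxE big_ord1 !mxE. Qed.

Section invariant_extension.
Variable u : 'rV[R]_N -> R.
Let F := u \o retract c r.
Hypothesis dF : forall x, x != c -> differentiable F x.
Hypothesis ddF : forall x i, x != c -> differentiable (partial F i) x.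

Lemma derive_radial x : 'D_(x - c) F x = 0.
Proof.
apply: cvg_lim => //; apply: cvg_near_cst; near=> h.
rewrite /= (_ : h *: (x - c) + x = (h + 1) *: (x - c) + c); last first.
  by rewrite scalerDl scale1r -addrA subrK.
rewrite /F/= retract_ray ?subrr ?scaler0//.
rewrite -ltrBlDr sub0r.
have : `|h| < 1.
  near: h; exact: dnbhs0_lt.
by rewrite ltr_norml => /andP[].
Unshelve. all: by end_near. Qed.

Lemma sum_radial x : x != c -> \sum_i (x - c) 0 i * partial F i x = 0.
Proof. by move=> xc; rewrite -derive_partials ?derive_radial//; exact: dF. Qed.

(** Differentiate the first radial identity in the radial direction: the first order terms are again
    the first radial identity, and only the Hessian along the radius remains. *)
Lemma sum_radial2 x : x != c ->
  \sum_i \sum_j (x - c) 0 i * (x - c) 0 j * partial (partial F i) j x = 0.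
Proof.
move=> xc.
have h : is_derive x (x - c) (fun z : 'rV[R]_N => \sum_i (z - c) 0 i * partial F i z)
   (\sum_i ((x - c) 0 i * 'D_(x - c) (partial F i) x + partial F i x * (x - c) 0 i)).
  apply: is_derive_sum_fun => i; apply: is_deriveM_fun.
    exact: is_derive_coord.
  by apply: derivableP; apply: diff_derivable; exact: ddF.
have h0 : is_derive x (x - c) (fun z : 'rV[R]_N => \sum_i (z - c) 0 i * partial F i z) 0.
  apply: (near_eq_is_derive _ (is_derive_cst 0 x (x - c))).
  near=> z; rewrite sum_radial//; near: z; exact: near_neq_center.
have [_] := h; have [_ ->] := h0; rewrite big_split/=.
rewrite [X in _ = _ + X](_ : _ = 0); last first.
  apply: etrans (sum_radial xc); apply: eq_bigr => i _; exact: mulrC.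
rewrite addr0 => e0; apply: etrans (esym e0); apply: eq_bigr => i _.
rewrite derive_partials; last exact: ddF.
by rewrite mulr_sumr; apply: eq_bigr => j _; rewrite -mulrA.
Unshelve. all: by end_near. Qed.

(** By the first radial identity the Euclidean gradient of the extension is already tangent to the
    sphere, so that the tangential projection does nothing to it. *)
Lemma sphere_grad_retract : sphere_grad c r u \o retract c r =
  (fun x => \row_i partial F i x) \o retract c r.
Proof.
apply/funext => x; rewrite /sphere_grad/= -/F /tangent_proj mulmxBr mulmx1.
have [->|xc] := eqVneq x c.
  by rewrite retract_center subrr trmx0 mul0mx scaler0 mulmx0 subr0.
rewrite -scalemxAr mulmxA [X in X *m _](_ : _ = 0) ?mul0mx ?scaler0 ?subr0//.
apply/matrixP => i j; rewrite !ord1 !mxE.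
apply: etrans (sum_radial (sphere_neq_center (sphere_retract xc))).
by apply: eq_bigr => l _; rewrite !mxE mulrC.
Qed.

(** On the sphere the derivative of the projection is the tangential projection P, hence the
    divergence of the gradient is tr (P P H) with H the Hessian of the extension.  As P is idempotent this
    is tr H minus the radial part of H, and the radial part vanishes. *)
Lemma laplace_beltramiE x : sphere c r x ->
  laplace_beltrami c r u x = \sum_i partial (partial F i) i x.
Proof.
move=> xS; have xc := sphere_neq_center xS.
have dg : differentiable (fun x => \row_i partial F i x : 'rV[R]_N) x.
  apply: differentiable_row => j.
  rewrite (_ : (fun _ => _) = partial F j); first exact: ddF.
  by apply/funext => z; rewrite mxE.
have dr := differentiable_retract xc.
have dgr : differentiable ((fun x => \row_i partial F i x) \o retract c r) x.
  by apply: differentiable_comp => //; rewrite retract_id.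
pose P := tangent_proj c r x.
pose H : 'M[R]_N := \matrix_(l, j) partial (partial F j) l x.
have JE : 'J ((fun x => \row_i partial F i x) \o retract c r) x = P *m H.
  apply/matrixP => i j.
  rewrite /jacobian mxE diff_comp//=; last by rewrite retract_id.
  rewrite retract_id// diff_row//.
  rewrite (_ : (fun _ => _) = partial F j); last by apply/funext => z; rewrite mxE.
  rewrite derive_partials; last exact: ddF.
  rewrite mxE; apply: eq_bigr => l _; rewrite [H _ _]mxE; congr (_ * _).
  rewrite diff_row// derive_retract// tangent_projE (bigD1 i)//= big1; last first.
    by move=> k /negbTE ki; rewrite [delta_mx _ _ _ _]mxE ki andbF mulr0.
  by rewrite ![delta_mx _ _ _ _]mxE !eqxx/= [l == i]eq_sym addr0 mulr1 mulrA.
rewrite /laplace_beltrami /sphere_div sphere_grad_retract JE mulmxA.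
have PP : P *m P = P.
  apply/matrixP => i j; rewrite mxE.
  under eq_bigr do rewrite !tangent_projE.
  rewrite tangent_projE.
  rewrite (_ : \sum_l _ = (i == j)%:R - r ^- 2 * ((x - c) 0 i * (x - c) 0 j) *+ 2
    + \sum_l (r ^- 2) ^+ 2 * (x - c) 0 i * (x - c) 0 j * (x - c) 0 l ^+ 2); last first.
    rewrite (_ : \sum_l _ = \sum_l ((i == l)%:R * ((l == j)%:R - r ^- 2 * ((x - c) 0 l * (x - c) 0 j))
      + (l == j)%:R * (- (r ^- 2 * ((x - c) 0 i * (x - c) 0 l))))
      + \sum_l (r ^- 2) ^+ 2 * (x - c) 0 i * (x - c) 0 j * (x - c) 0 l ^+ 2); last first.
      by rewrite -big_split/=; apply: eq_bigr => l _; ring.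
    rewrite big_split/=; congr (_ + _).
    rewrite (bigD1 i)//= [X in _ + X + _]big1; last first.
      by move=> l /negbTE; rewrite eq_sym => ->; rewrite mul0r.
    rewrite [X in _ + X](bigD1 j)//= [X in _ + (_ + X)]big1; last first.
      by move=> l /negbTE ->; rewrite mul0r.
    by rewrite !eqxx /=; ring.
  rewrite -mulr_sumr (_ : \sum_l _ = r ^+ 2) //.
  by field; rewrite gt_eqF.
rewrite PP /mxtrace.
rewrite (_ : \sum_i (P *m H) i i = \sum_i partial (partial F i) i x -
   r ^- 2 * \sum_i \sum_j (x - c) 0 i * (x - c) 0 j * partial (partial F i) j x).
  by rewrite sum_radial2// mulr0 subr0.
rewrite mulr_sumr -sumrB; apply: eq_bigr => i _; rewrite mxE.
under eq_bigr do rewrite tangent_projE [H _ _]mxE mulrBl.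
rewrite sumrB; congr (_ - _).
  rewrite (bigD1 i)//= eqxx mul1r big1 ?addr0// => j /negbTE.
  by rewrite eq_sym => ->; rewrite mul0r.
by rewrite mulr_sumr; apply: eq_bigr => j _; rewrite [RHS]mulrA.
Qed.

End invariant_extension.
End sphere_geometry.

(** * Rotation fields and plane rotations *)

Section rotation_field.
Variables (R : realType) (N : nat) (c : 'rV[R]_N).
Implicit Types (u w : 'rV[R]_N -> R) (x : 'rV[R]_N).

(** The vector field L_ij of infinitesimal rotations about c in the plane of coordinates i and j, acting
    on functions. *)
Definition rot_field (i j : 'I_N) u x : R :=
  (x - c) 0 i * partial u j x - (x - c) 0 j * partial u i x.

Lemma rot_field_id i u x : rot_field i i u x = 0.
Proof. by rewrite /rot_field subrr. Qed.

Lemma partialM u w i x : differentiable u x -> differentiable w x ->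
  partial (fun z => u z * w z) i x = u x * partial w i x + w x * partial u i x.
Proof.
by move=> du dw; apply: partial_eq; apply: is_deriveM_fun; exact: partialP.
Qed.

Lemma rot_fieldM i j u w x : differentiable u x -> differentiable w x ->
  rot_field i j (fun z => u z * w z) x = u x * rot_field i j w x + w x * rot_field i j u x.
Proof. move=> du dw; rewrite /rot_field !partialM//.
have aux (a b ux wx ui uj wi wj : R) :
  a * (ux * wj + wx * uj) - b * (ux * wi + wx * ui) =
  ux * (a * wj - b * wi) + wx * (a * uj - b * ui) by ring.
exact: aux. Qed.

Lemma differentiable_rot_field i j u x : (forall l, differentiable (partial u l) x) ->
  differentiable (rot_field i j u) x.
Proof.
move=> du; rewrite /rot_field; apply: differentiableB;
  by apply: differentiable_prod => //; exact: differentiable_shifted_coord.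
Qed.

Lemma partial_rot_field i j l u x : (forall l, differentiable (partial u l) x) ->
  partial (rot_field i j u) l x =
  (l == i)%:R * partial u j x + (x - c) 0 i * partial (partial u j) l x
  - ((l == j)%:R * partial u i x + (x - c) 0 j * partial (partial u i) l x).
Proof.
move=> du; apply: partial_eq.
rewrite [X in X + _ - _]mulrC [X in X + _]addrC.
rewrite [X in _ - (X + _)]mulrC [X in _ - X]addrC.
have e k : (l == k)%:R = (delta_mx 0 l : 'rV[R]_N) 0 k by rewrite mxE eqxx [k == l]eq_sym.
rewrite !e; apply: is_deriveB_fun; apply: is_deriveM_fun;
  by [exact: is_derive_coord | exact: partialP].
Qed.

Let sum_symm (a b e f : 'I_N -> 'I_N -> R) (d : 'I_N -> R) :
  \sum_i \sum_j ((a i j + a j i) - (b i j + b j i) - (d i + d j) + (e i j + f i j)) =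
  2 * (\sum_i \sum_j a i j) - 2 * (\sum_i \sum_j b i j) - 2 * N%:R * (\sum_i d i)
  + ((\sum_i \sum_j e i j) + (\sum_i \sum_j f i j)).
Proof.
have sw (g : 'I_N -> 'I_N -> R) : \sum_i \sum_j (g i j + g j i) = 2 * \sum_i \sum_j g i j.
  transitivity (\sum_i ((\sum_j g i j) + (\sum_j g j i))).
    by apply: eq_bigr => i _; rewrite big_split.
  by rewrite big_split/= [X in _ + X]exchange_big/= mulrDl mul1r.
have ed : \sum_i \sum_j (d i + d j) = 2 * N%:R * \sum_i d i.
  rewrite (sw (fun i _ => d i)) -mulrA; congr (_ * _).
  by rewrite mulr_sumr; apply: eq_bigr => i _; rewrite sumr_const card_ord mulr_natl.
rewrite -!sw -ed -!sumrN -!big_split/=; apply: eq_bigr => i _.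
by rewrite -!sumrN -!big_split/=.
Qed.

Let sum_prod (p q : 'I_N -> R) :
  \sum_i \sum_j p i * q j = (\sum_i p i) * (\sum_j q j).
Proof. by rewrite mulr_suml; apply: eq_bigr => i _; rewrite mulr_sumr. Qed.

Let sum_diag (p : 'I_N -> 'I_N -> R) :
  \sum_i \sum_j (i == j)%:R * p i j = \sum_i p i i.
Proof.
apply: eq_bigr => i _; rewrite (bigD1 i)//= eqxx mul1r big1 ?addr0// => j /negbTE.
by rewrite eq_sym => ->; rewrite mul0r.
Qed.

(** The partial derivatives are replaced by arbitrary numbers y, g, h, so that the identity is one about
    finite sums. *)
Let sum_rot_field_sq_abstract (y g : 'I_N -> R) (h : 'I_N -> 'I_N -> R) :
  \sum_i \sum_j
   (y i * ((i == j)%:R * g j + y i * h j j - (1 * g i + y j * h i j)) -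
    y j * (1 * g j + y i * h j i - ((i == j)%:R * g i + y j * h i i))) =
  2 * ((\sum_i y i ^+ 2) * (\sum_i h i i) - (\sum_i \sum_j y i * y j * h i j)
       - (N%:R - 1) * \sum_i y i * g i).
Proof.
pose a i j := y i ^+ 2 * h j j.
pose b i j := y i * y j * h i j.
pose d i := y i * g i.
transitivity (\sum_i \sum_j ((a i j + a j i) - (b i j + b j i) - (d i + d j)
   + ((i == j)%:R * (y i * g j) + (i == j)%:R * (y j * g i)))).
  by apply: eq_bigr => i _; apply: eq_bigr => j _; rewrite /a /b /d; ring.
rewrite sum_symm sum_prod !(sum_diag (fun i j => y i * g j)) (sum_diag (fun i j => y j * g i)).
by rewrite /d /b; ring.
Qed.

(** The polar decomposition of the Laplacian: the sum over i < j of L_ij^2 is |y|^2 times the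
    Euclidean Laplacian, minus the radial second derivative, minus N - 1 times the radial first
    derivative.  Ordered pairs count every plane twice. *)
Lemma sum_rot_field_sq u x : (forall l, differentiable (partial u l) x) ->
  \sum_i \sum_j rot_field i j (rot_field i j u) x =
  2 * ((\sum_i (x - c) 0 i ^+ 2) * (\sum_i partial (partial u i) i x)
    - (\sum_i \sum_j (x - c) 0 i * (x - c) 0 j * partial (partial u i) j x)
    - (N%:R - 1) * \sum_i (x - c) 0 i * partial u i x).
Proof.
move=> du; apply: etrans; last first.
  exact: (sum_rot_field_sq_abstract (fun i => (x - c) 0 i) (fun i => partial u i x)
           (fun i j => partial (partial u i) j x)).
apply: eq_bigr => i _; apply: eq_bigr => j _.
rewrite /rot_field -/(rot_field i j u) !partial_rot_field// !eqxx/=.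
by rewrite (eq_sym j i).
Qed.

End rotation_field.

Section plane_rotation.
Variables (R : realType) (N : nat) (i j : 'I_N).
Hypothesis ij : i != j.

Definition plane_gen : 'M[R]_N := delta_mx i j - delta_mx j i.

Let B := plane_gen *m plane_gen.

Lemma plane_gen_sq : B = - delta_mx i i - delta_mx j j.
Proof.
rewrite /B /plane_gen mulmxBl !mulmxBr !mul_delta_mx_cond !eqxx !(eq_sym j i) !(negbTE ij).
by rewrite !mulr0n !mulr1n sub0r subr0.
Qed.

Lemma mul_plane_gen_sq : plane_gen *m B = - plane_gen.
Proof.
rewrite plane_gen_sq /plane_gen mulmxBl !mulmxBr !mulmxN !mul_delta_mx_cond !eqxx !(eq_sym j i) !(negbTE ij).
rewrite !mulr0n !mulr1n.
by rewrite oppr0 sub0r addr0 opprK opprB addrC.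
Qed.

Lemma mul_sq_plane_gen : B *m plane_gen = - plane_gen.
Proof. by rewrite -mulmxA mul_plane_gen_sq. Qed.

Lemma mul_sq_sq : B *m B = - B.
Proof. by rewrite {2}/B mulmxA mul_sq_plane_gen mulNmx. Qed.

(** The exponential of a * plane_gen: as the cube of the generator is its opposite (mul_plane_gen_sq),
    the exponential series collapses to these three terms. *)
Definition plane_rot (a : R) : 'M[R]_N := 1%:M + sin a *: plane_gen + (1 - cos a) *: B.

Lemma plane_rot0 : plane_rot 0 = 1%:M.
Proof. by rewrite /plane_rot sin0 cos0 subrr !scale0r !addr0. Qed.

Lemma plane_rotD a b : plane_rot (a + b) = plane_rot a *m plane_rot b.
Proof.
rewrite /plane_rot !mulmxDl !mulmxDr -!scalemxAl -!scalemxAr !mul1mx !mulmx1.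
rewrite -/B mul_plane_gen_sq mul_sq_plane_gen mul_sq_sq sinD cosD.
by apply/matrixP => k l; rewrite !mxE; ring.
Qed.

Lemma trmx_plane_rot a : (plane_rot a)^T = plane_rot (- a).
Proof.
have st : plane_gen^T = - plane_gen by rewrite /plane_gen linearB/= !trmx_delta opprB.
rewrite /plane_rot 2!linearD/= 2!linearZ/= trmx1 trmx_mul st mulNmx mulmxN opprK.
by rewrite sinN cosN scalerN scaleNr.
Qed.

Lemma plane_rot_orthogonal a : plane_rot a *m (plane_rot a)^T = 1%:M.
Proof. by rewrite trmx_plane_rot -plane_rotD subrr plane_rot0. Qed.

(** A rotation is the square of the rotation by half the angle, so its determinant is the square of
    that of an orthogonal matrix. *)
Lemma det_plane_rot a : \det (plane_rot a) = 1.
Proof.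
rewrite (splitr a) plane_rotD det_mulmx -{2}det_tr -det_mulmx plane_rot_orthogonal det1//.
Qed.

Lemma mul_plane_rot_gen a : plane_rot a *m plane_gen = cos a *: plane_gen + sin a *: B.
Proof.
rewrite /plane_rot !mulmxDl -!scalemxAl mul1mx -/B mul_sq_plane_gen.
by apply/matrixP => k l; rewrite !mxE; ring.
Qed.

End plane_rotation.

(** * Integration of continuous functions on a sphere *)

Section sphere_topology.
Variables (R : realType) (N : nat) (c : 'rV[R]_N) (r : R).
Hypothesis r_gt0 : 0 < r.
Local Notation S := (sphere c r).

Lemma continuous_sumsq : continuous (fun z : 'rV[R]_N => \sum_i (z - c) 0 i ^+ 2).
Proof.
by move=> x; apply: differentiable_continuous; exact: differentiable_sumsq.
Qed.

Lemma closed_sphere : closed S.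
Proof.
rewrite (_ : S = (fun z : 'rV[R]_N => \sum_i (z - c) 0 i ^+ 2) @^-1` [set r ^+ 2]) //.
apply: closed_comp => [x _|]; first exact: continuous_sumsq.
exact/accessible_closed_set1/hausdorff_accessible/Rhausdorff.
Qed.

Lemma bounded_sphere : bounded_set S.
Proof.
exists (`|c| + r); split; first exact: num_real.
move=> M /ltW rM x xS; apply: le_trans rM; rewrite -(subrK c x) addrC.
apply: (le_trans (ler_normD _ _)); rewrite lerD2l.
rewrite [leLHS]/Num.Def.normr/= mx_normrE; apply: bigmax_le; first exact: ltW.
move=> [a i] _ /=; rewrite ord1.
rewrite -(ler_pXn2r (n := 2)) ?nnegrE ?(ltW r_gt0)//.
rewrite real_normK ?num_real// -xS (bigD1 i)//= lerDl.
by apply: sumr_ge0 => k _; exact: sqr_ge0.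
Qed.

Lemma compact_sphere : compact S.
Proof. exact: bounded_closed_compact bounded_sphere closed_sphere. Qed.

Lemma measurable_open_rV (A : set (borel_rV R N)) : open (A : set 'rV[R]_N) -> measurable A.
Proof. by move=> oA; exact: sub_sigma_algebra. Qed.

Lemma measurable_sphere : measurable (S : set (borel_rV R N)).
Proof.
rewrite -[X in measurable X]setCK; apply: measurableC; apply: measurable_open_rV.
by apply: closed_openC; exact: closed_sphere.
Qed.

(** Only continuity on D is required: this applies to functions which, like the extension of the
    heat kernel, are not continuous at the center of the sphere. *)
Lemma within_measurable (D : set (borel_rV R N)) (g : borel_rV R N -> R) :
  measurable D -> {within (D : set 'rV[R]_N), continuous (g : 'rV[R]_N -> R)} ->
  measurable_fun D g.
Proof.
move=> mD /continuousP cg; apply: (measurability _ (RGenOpens.measurableE R)).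
move=> _ [_ [a [b ->] <-]].
have /cg/open_subspaceP[V oV VD] : open (`]a, b[%classic : set R) by exact: interval_open.
by rewrite setIC -VD; apply: measurableI => //; exact: measurable_open_rV.
Qed.

Lemma continuous_rV_measurable (g : borel_rV R N -> borel_rV R N) :
  continuous (g : 'rV[R]_N -> 'rV[R]_N) -> measurable_fun setT g.
Proof.
move=> /continuousP cg; apply: (@measurability _ _ (borel_rV R N) (borel_rV R N) setT g (@open 'rV[R]_N)) => //.
by move=> _ [V oV <-]; rewrite setTI; apply: measurable_open_rV; exact: cg.
Qed.

Section on_sphere.
Variables (g : 'rV[R]_N -> R).
Hypothesis cg : forall x, S x -> {for x, continuous g}.

Lemma sphere_within : {within S, continuous g}.
Proof. by apply: continuous_in_subspaceT => x; rewrite inE; exact: cg. Qed.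

Lemma measurable_on_sphere : measurable_fun (S : set (borel_rV R N)) (g : borel_rV R N -> R).
Proof. by apply: within_measurable; [exact: measurable_sphere|exact: sphere_within]. Qed.

Lemma bounded_on_sphere : exists2 M, 0 <= M & forall x, S x -> `|g x| <= M.
Proof.
have /compact_bounded[M [_ hM]] := continuous_compact sphere_within compact_sphere.
exists (`|M| + 1); first by rewrite addr_ge0.
move=> x xS; apply: (hM (`|M| + 1)); last by exists x.
by rewrite ltr_pwDr// ler_norm.
Qed.

Lemma integrable_on_sphere (sigma : probability (borel_rV R N) R) :
  sigma.-integrable (S : set (borel_rV R N)) (EFin \o g).
Proof.
apply: measurable_bounded_integrable.
- exact: measurable_sphere.
- by apply: (le_lt_trans (probability_le1 _ _)); [exact: measurable_sphere|rewrite ltry].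
- exact: measurable_on_sphere.
- have [M M0 hM] := bounded_on_sphere.
  exists M; split; first exact: num_real.
  by move=> m /ltW Mm x /= xS; apply: le_trans Mm; exact: hM.
Qed.

End on_sphere.
End sphere_topology.

(** * Rotation fields have zero mean *)

(** Entrywise rules for a single operation; expanding all matrix operations at once would also unfold
    the products with plane_gen. *)
Lemma mxDE (V : nmodType) m n (A B : 'M[V]_(m, n)) i j : (A + B) i j = A i j + B i j.
Proof. by rewrite mxE. Qed.

Lemma mxZE (K : pzRingType) m n (a : K) (A : 'M[K]_(m, n)) i j : (a *: A) i j = a * A i j.
Proof. by rewrite mxE. Qed.

Lemma mxNE (V : zmodType) m n (A : 'M[V]_(m, n)) i j : (- A) i j = - A i j.
Proof. by rewrite mxE. Qed.

Lemma row_mul_delta (K : pzRingType) m (y : 'rV[K]_m) (k h l : 'I_m) :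
  (y *m delta_mx k h) 0 l = y 0 k * (l == h)%:R.
Proof.
rewrite mxE (bigD1 k)//= big1 ?addr0; last first.
  by move=> q /negbTE qk; rewrite mxE qk mulr0.
by rewrite mxE eqxx.
Qed.

Section rotation_invariance.
Variables (R : realType) (N : nat) (c : 'rV[R]_N) (r : R).
Hypothesis r_gt0 : 0 < r.
Local Notation S := (sphere c r).
Variable sigma : probability (borel_rV R N) R.
Hypothesis sigmaP : normalized_volume c r sigma.

Section one_plane.
Variables (i j : 'I_N).
Hypothesis ij : i != j.

Definition turn (a : R) (x : 'rV[R]_N) : 'rV[R]_N := c + (x - c) *m plane_rot i j a.

Lemma sphere_turn a x : S (turn a x) <-> S x.
Proof.
have sq (y : 'rV[R]_N) : \sum_l y 0 l ^+ 2 = (y *m y^T) 0 0.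
  by rewrite mxE; apply: eq_bigr => l _; rewrite mxE expr2.
rewrite /sphere/= /turn addrAC subrr add0r !sq trmx_mul mulmxA -[X in X *m _]mulmxA.
by rewrite plane_rot_orthogonal// mulmx1.
Qed.

Lemma turn0 x : turn 0 x = x.
Proof. by rewrite /turn plane_rot0 mulmx1 addrC subrK. Qed.

Lemma turnE a x l : turn a x 0 l =
  x 0 l + sin a * ((x - c) *m plane_gen R i j) 0 l
  + (1 - cos a) * ((x - c) *m (plane_gen R i j *m plane_gen R i j)) 0 l.
Proof.
rewrite /turn /plane_rot; move: (plane_gen R i j) => A.
rewrite !mulmxDr mulmx1 -!scalemxAr.
by rewrite !addrA [c + x]addrC addrK !mxDE !mxZE.
Qed.

Lemma is_derive_turn (a : R) x l :
  is_derive a 1 (fun a => turn a x 0 l) (((turn a x - c) *m plane_gen R i j) 0 l).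
Proof.
rewrite (_ : ((turn a x - c) *m plane_gen R i j) 0 l =
  cos a * ((x - c) *m plane_gen R i j) 0 l +
  sin a * ((x - c) *m (plane_gen R i j *m plane_gen R i j)) 0 l); last first.
  rewrite /turn addrAC subrr add0r -mulmxA mul_plane_rot_gen//.
  by move: (plane_gen R i j) => A; rewrite mulmxDr -!scalemxAr mxDE !mxZE.
rewrite (_ : (fun a => _) = (fun a : R => x 0 l + sin a * ((x - c) *m plane_gen R i j) 0 l
  + (1 - cos a) * ((x - c) *m (plane_gen R i j *m plane_gen R i j)) 0 l)); last first.
  by apply/funext => b; rewrite turnE.
set p := ((x - c) *m plane_gen R i j) 0 l.
set q := ((x - c) *m _) 0 l.
apply: is_derive_eq.
rewrite /GRing.scale/=; ring.
Qed.

Lemma derivable_turn (a : R) x : derivable (turn ^~ x) a 1.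
Proof.
apply/derivable_mxP => k l; rewrite ord1.
by have [] := is_derive_turn a x l.
Qed.

Lemma derive_turn (a : R) x : 'D_1 (turn ^~ x) a = (turn a x - c) *m plane_gen R i j.
Proof.
rewrite derive_mx; last exact: derivable_turn.
by apply/rowP => l; rewrite mxE; have [_ ->] := is_derive_turn a x l.
Qed.

Lemma mul_plane_gen (y : 'rV[R]_N) l :
  (y *m plane_gen R i j) 0 l = y 0 i * (l == j)%:R - y 0 j * (l == i)%:R.
Proof.
by rewrite /plane_gen mulmxBr mxDE mxNE !row_mul_delta.
Qed.

(** L_ij is the velocity of the orbits of the rotation. *)
Lemma is_derive_along_turn (g : 'rV[R]_N -> R) (a : R) x : differentiable g (turn a x) ->
  is_derive a 1 (fun a => g (turn a x)) (rot_field c i j g (turn a x)).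
Proof.
move=> dg; have dt : derivable (turn ^~ x) a 1 by exact: derivable_turn.
have dt' : differentiable (turn ^~ x) a by exact/derivable1_diffP.
have dgt : differentiable (g \o (turn ^~ x)) a by exact: differentiable_comp.
apply: DeriveDef; first exact/derivable1_diffP.
rewrite deriveE// diff_comp//= -(deriveE _ dt') derive_turn -(deriveE _ dg).
rewrite derive_partials// /rot_field.
under eq_bigr do rewrite mul_plane_gen mulrBl.
rewrite sumrB; congr (_ - _).
  rewrite (bigD1 j)//= eqxx mulr1 big1 ?addr0// => k /negbTE ->.
  by rewrite mulr0 mul0r.
rewrite (bigD1 i)//= eqxx mulr1 big1 ?addr0// => k /negbTE ->.
by rewrite mulr0 mul0r.
Qed.

Lemma continuous_turn a : continuous (turn a).
Proof.
move=> x; apply: differentiable_continuous; apply: differentiable_row => l.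
rewrite (_ : (fun y => _) = (fun y : 'rV[R]_N => c 0 l + \sum_k (y - c) 0 k * plane_rot i j a k l)).
  apply: differentiableD => //.
  rewrite (_ : (fun y => _) = \sum_k (fun y : 'rV[R]_N => (y - c) 0 k * plane_rot i j a k l)).
    apply: differentiable_sum => k; apply: differentiable_prod => //.
    exact: differentiable_shifted_coord.
  by apply/funext => y; rewrite fct_sumE.
by apply/funext => y; rewrite /turn mxE [((y - c) *m _) 0 l]mxE.
Qed.

Lemma measurable_turn a : measurable_fun setT (turn a : borel_rV R N -> borel_rV R N).
Proof. apply: continuous_rV_measurable; exact: continuous_turn. Qed.

Lemma Rintegral_turn (g : 'rV[R]_N -> R) a : (forall x, S x -> {for x, continuous g}) ->
  \int[sigma]_(x in S) g (turn a x) = \int[sigma]_(x in S) g x.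
Proof.
move=> cg.
rewrite /Rintegral; congr fine.
have mS : measurable (S : set (borel_rV R N)) by exact: measurable_sphere.
pose phi : borel_rV R N -> borel_rV R N := turn a.
have mphi : measurable_fun setT phi := measurable_turn a.
have invar A : measurable A -> pushforward sigma phi A = sigma A.
  by case: sigmaP => _ + mA; apply => //; [exact: plane_rot_orthogonal|exact: det_plane_rot].
have turnS : phi @^-1` (S : set (borel_rV R N)) = S.
  by apply/seteqP; split => x xS; apply/(sphere_turn a x).
pose G : borel_rV R N -> \bar R := (EFin \o g) \_ (S : set (borel_rV R N)).
have mG : measurable_fun setT G.
  by apply/(measurable_restrictT _ mS)/measurable_EFinP; exact: measurable_on_sphere.
have GE x : S x -> G x = (g x)%:E by move=> xS; rewrite /G patchE mem_set.
transitivity (\int[sigma]_(x in phi @^-1` (S : set (borel_rV R N))) (G \o phi) x)%E.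
  rewrite turnS; apply: eq_integral => x; rewrite inE => xS /=.
  by rewrite GE//; exact/sphere_turn.
rewrite -integral_pushforward//; last first.
  rewrite turnS; apply: (@eq_integrable _ _ _ sigma _ mS (EFin \o (g \o turn a))).
    by move=> x; rewrite inE => xS /=; rewrite GE//; exact/sphere_turn.
  apply: integrable_on_sphere => // x xS; apply: continuous_comp.
    exact: continuous_turn.
  by apply: cg; exact/sphere_turn.
transitivity (\int[sigma]_(x in S) G x)%E.
  by apply: eq_measure_integral => A mA _; exact: invar.
by apply: eq_integral => x; rewrite inE => xS; rewrite GE.
Qed.

(** The integral of g over the rotated sphere does not depend on the angle.  Its derivative at angle 0,
    taken under the integral, is the integral of L_ij g. *)
Lemma Rintegral_rot_field (g : 'rV[R]_N -> R) : (forall x, S x -> differentiable g x) ->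
  (forall x, S x -> {for x, continuous (rot_field c i j g)}) ->
  \int[sigma]_(x in S) rot_field c i j g x = 0.
Proof.
move=> dg cLg.
have cg x : S x -> {for x, continuous g}.
  by move=> xS; apply: differentiable_continuous; exact: dg.
have mS : measurable (S : set (borel_rV R N)) by exact: measurable_sphere.
have [M M0 hM] := bounded_on_sphere r_gt0 cLg.
pose f (a : R) (x : borel_rV R N) : R := g (turn a x).
have St a x : S x -> S (turn a x) by move/sphere_turn.
have df (a : R) x : S x -> is_derive a 1 (f ^~ x) (rot_field c i j g (turn a x)).
  by move=> xS; apply: is_derive_along_turn; apply: dg; exact: St.
have dfE (a : R) x : S x -> partial1of2 f a x = rot_field c i j g (turn a x).
  by move=> xS; rewrite partial1of2E; have [_ ->] := df a x xS.
have I0 : `]-1, 1[%classic (0 : R) by rewrite /= in_itv/= ltrN10 ltr01.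
(* Difference quotients in the angle are identically 0 by invariance and tend to the integral of
   L_ij g. *)
have h := @cvg_differentiation_under_integral R _ (borel_rV R N) sigma f S mS 0 (-1) 1 I0 _ _ (fun=> M) _ _ _.
have : (0 : R) @[_ --> (0 : R)^'] --> \int[sigma]_(y in S) partial1of2 f 0 y.
  apply: cvg_trans (h _ _ _ _ _) => //.
  - apply: near_eq_cvg; near=> e.
    by rewrite /f !Rintegral_turn// subrr scaler0.
  - move=> a _; apply: integrable_on_sphere => // x xS; apply: continuous_comp.
      exact: continuous_turn.
    by apply: cg; exact: St.
  - by move=> a x _ xS; have [] := df a x xS.
  - by apply: integrable_on_sphere => // x _; exact: cst_continuous.
  - by move=> a x _ xS; rewrite dfE//; apply: hM; exact: St.
move=> /(cvg_unique _ (cvg_cst _)) e0.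
rewrite [RHS]e0//; apply: eq_Rintegral => x; rewrite inE => xS.
by rewrite dfE// turn0.
Unshelve. all: by end_near. Qed.

End one_plane.
End rotation_invariance.

(** * Symmetry of the Laplacian *)

Section Rintegral_sum.
Context d (T : measurableType d) (R : realType) (mu : {measure set T -> \bar R}).
Variables (D : set T) (mD : measurable D).

Lemma integrable_Rsum (I : Type) (s : seq I) (f : I -> T -> R) :
  (forall i, mu.-integrable D (EFin \o f i)) ->
  mu.-integrable D (EFin \o (fun x => \sum_(i <- s) f i x)).
Proof.
move=> h; rewrite (_ : _ \o _ = (fun x => \sum_(i <- s) (f i x)%:E)%E).
  by apply: integrable_sum => // i _; exact: h.
by apply/funext => x /=; rewrite sumEFin.
Qed.

Lemma Rintegral_sum (I : Type) (s : seq I) (f : I -> T -> R) :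
  (forall i, mu.-integrable D (EFin \o f i)) ->
  \int[mu]_(x in D) (\sum_(i <- s) f i x) = \sum_(i <- s) \int[mu]_(x in D) f i x.
Proof.
move=> h; elim: s => [|a s IH].
  rewrite big_nil; transitivity (\int[mu]_(x in D) (0 : R)).
    by apply: eq_Rintegral => x _; rewrite big_nil.
  by rewrite Rintegral_cst// mul0r.
rewrite big_cons -IH -RintegralD//; last exact: integrable_Rsum.
by apply: eq_Rintegral => x _; rewrite big_cons.
Qed.

End Rintegral_sum.

Lemma near_eq_continuous (T U : topologicalType) (f g : T -> U) x :
  (\forall z \near x, f z = g z) -> {for x, continuous g} -> {for x, continuous f}.
Proof.
move=> fg cg; rewrite /prop_for /continuous_at (nbhs_singleton fg).
by apply: cvg_trans cg; apply: near_eq_cvg; near=> z; apply/esym; near: z.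
Unshelve. all: by end_near. Qed.

Section continuity_fun.
Variables (T : topologicalType) (R : realType) (f g : T -> R) (x : T).
Hypotheses (cf : {for x, continuous f}) (cg : {for x, continuous g}).

Lemma continuousD_fun : {for x, continuous (fun z => f z + g z)}.
Proof. exact: continuousD. Qed.

Lemma continuousB_fun : {for x, continuous (fun z => f z - g z)}.
Proof. exact: continuousB. Qed.

Lemma continuousM_fun : {for x, continuous (fun z => f z * g z)}.
Proof. exact: continuousM. Qed.

End continuity_fun.

Section green.
Variables (R : realType) (N : nat) (c : 'rV[R]_N) (r : R).
Hypothesis r_gt0 : 0 < r.
Local Notation S := (sphere c r).
Variable sigma : probability (borel_rV R N) R.
Hypothesis sigmaP : normalized_volume c r sigma.
Implicit Types u w : 'rV[R]_N -> R.

(** The regularity of functions extended constantly along the normals, which are singular at the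
    center. *)
Definition C2_off_center u := forall x, x != c ->
  [/\ differentiable u x, forall i, differentiable (partial u i) x
    & forall i j, {for x, continuous (partial (partial u i) j)}].

Lemma continuous_rot_field i j u : (forall l x, x != c -> {for x, continuous (partial u l)}) ->
  forall x, x != c -> {for x, continuous (rot_field c i j u)}.
Proof.
have cc l x : {for x, continuous (fun z : 'rV[R]_N => (z - c) 0 l)}.
  by apply: differentiable_continuous; exact: differentiable_shifted_coord.
move=> cu x xc; apply: continuousB_fun; apply: continuousM_fun => //; exact: cu.
Qed.

Lemma continuous_rot_field_sq i j u : C2_off_center u ->
  forall x, x != c -> {for x, continuous (rot_field c i j (rot_field c i j u))}.
Proof.
move=> Cu; apply: continuous_rot_field => l x xc.
have := @partial_rot_field R N c i j l u => /(_ _ _) e.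
apply: near_eq_continuous.
  near=> z; apply: e => k; have zc : z != c by near: z; exact: near_neq_center.
  by have [_ + _] := Cu z zc; apply.
have cc k : {for x, continuous (fun z : 'rV[R]_N => (z - c) 0 k)}.
  by apply: differentiable_continuous; exact: differentiable_shifted_coord.
have [_ d1 c2] := Cu x xc.
have c1 k : {for x, continuous (partial u k)} by apply: differentiable_continuous.
by apply: continuousB_fun; apply: continuousD_fun; apply: continuousM_fun => //; exact: cst_continuous.
Unshelve. all: by end_near. Qed.

Lemma C2_differentiable_rot_field i j u x : C2_off_center u -> x != c ->
  differentiable (rot_field c i j u) x.
Proof. by move=> Cu xc; apply: differentiable_rot_field => l; have [_ + _] := Cu x xc. Qed.

(** Integration by parts without a boundary term: apply Rintegral_rot_field to the product u * L_ij w. *)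
Lemma integral_rot_field_by_parts i j u w : C2_off_center u -> C2_off_center w ->
  \int[sigma]_(x in S) (u x * rot_field c i j (rot_field c i j w) x) =
  - \int[sigma]_(x in S) (rot_field c i j u x * rot_field c i j w x).
Proof.
move=> Cu Cw; have [->|ij] := eqVneq i j.
  rewrite -[RHS]mulN1r -RintegralZl; last 2 first.
  - exact: measurable_sphere.
  - apply: integrable_on_sphere => // x _.
    rewrite (_ : (fun x => _) = cst 0); first exact: cst_continuous.
    by apply/funext => z; rewrite rot_field_id mul0r.
  by apply: eq_Rintegral => x _; rewrite !rot_field_id !mulr0.
have Sc x : S x -> x != c by exact: sphere_neq_center.
have du x : x != c -> differentiable u x by case/Cu.
have dw x : x != c -> differentiable (rot_field c i j w) x by exact: C2_differentiable_rot_field.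
have cu x : x != c -> {for x, continuous u} by move=> xc; apply: differentiable_continuous; exact: du.
have cLw x : x != c -> {for x, continuous (rot_field c i j w)}.
  by move=> xc; apply: differentiable_continuous; exact: dw.
have cLu x : x != c -> {for x, continuous (rot_field c i j u)}.
  by move=> xc; apply: differentiable_continuous; exact: C2_differentiable_rot_field.
have cLLw x : x != c -> {for x, continuous (rot_field c i j (rot_field c i j w))}.
  exact: continuous_rot_field_sq.
have cA x : S x -> {for x, continuous (fun z => u z * rot_field c i j (rot_field c i j w) z)}.
  by move=> /Sc xc; apply: continuousM_fun; [exact: cu|exact: cLLw].
have cB x : S x -> {for x, continuous (fun z => rot_field c i j u z * rot_field c i j w z)}.
  by move=> /Sc xc; apply: continuousM_fun; [exact: cLu|exact: cLw].
apply/eqP; rewrite -subr_eq0 opprK -RintegralD; last 3 first.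
- exact: measurable_sphere.
- exact: integrable_on_sphere.
- exact: integrable_on_sphere.
apply/eqP; rewrite -[RHS](@Rintegral_rot_field R N c r r_gt0 sigma sigmaP i j ij (fun z => u z * rot_field c i j w z)).
- apply: eq_Rintegral => x; rewrite inE => /Sc xc; rewrite rot_fieldM//; last 2 first.
  + exact: du.
  + exact: dw.
  by rewrite [X in _ = _ + X]mulrC.
- by move=> x /Sc xc; apply: differentiable_prod; [exact: du|exact: dw].
- move=> x /Sc xc; apply: near_eq_continuous.
    near=> z; have zc : z != c by near: z; exact: near_neq_center.
    by rewrite rot_fieldM; [reflexivity|exact: du|exact: dw].
  apply: continuousD_fun; apply: continuousM_fun.
  + exact: cu.
  + exact: cLLw.
  + exact: cLw.
  + exact: cLu.
Unshelve. all: by end_near. Qed.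

(** The Laplacian of the sphere as a sum of squares of rotation fields.  For a function that
    is not constant along the normals, such as a polynomial, this differs from the restriction of the
    Euclidean Laplacian; it only depends on the values of the function on the sphere. *)
Definition rot_laplacian u x : R :=
  (2 * r ^+ 2)^-1 * \sum_i \sum_j rot_field c i j (rot_field c i j u) x.

(** Two integrations by parts in each plane. *)
Lemma green u w : C2_off_center u -> C2_off_center w ->
  \int[sigma]_(x in S) (u x * rot_laplacian w x) =
  \int[sigma]_(x in S) (rot_laplacian u x * w x).
Proof.
move=> Cu Cw.
have Sc x : S x -> x != c by exact: sphere_neq_center.
have mS : measurable (S : set (borel_rV R N)) by exact: measurable_sphere.
have ct v x : C2_off_center v -> S x -> {for x, continuous v}.
  by move=> Cv /Sc xc; apply: differentiable_continuous; case: (Cv x xc).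
have iA i j v v' : C2_off_center v -> C2_off_center v' ->
   sigma.-integrable (S : set (borel_rV R N)) (EFin \o (fun x => v x * rot_field c i j (rot_field c i j v') x)).
  move=> Cv Cv'; apply: integrable_on_sphere => // x xS; apply: continuousM_fun.
    exact: ct.
  by apply: continuous_rot_field_sq => //; exact: Sc.
have main v v' : C2_off_center v -> C2_off_center v' ->
  \int[sigma]_(x in S) (v x * rot_laplacian v' x) =
  (2 * r ^+ 2)^-1 * \sum_i \sum_j \int[sigma]_(x in S) (v x * rot_field c i j (rot_field c i j v') x).
  move=> Cv Cv'.
  transitivity (\int[sigma]_(x in S) ((2 * r ^+ 2)^-1 * \sum_i \sum_j (v x * rot_field c i j (rot_field c i j v') x))).
    apply: eq_Rintegral => x _; rewrite /rot_laplacian mulrCA mulr_sumr; congr (_ * _).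
    by apply: eq_bigr => i _; rewrite mulr_sumr.
  have i2 i : sigma.-integrable (S : set (borel_rV R N))
      (EFin \o (fun x => \sum_j (v x * rot_field c i j (rot_field c i j v') x))).
    by apply: integrable_Rsum => // j; exact: iA.
  rewrite RintegralZl//; last by apply: integrable_Rsum.
  rewrite Rintegral_sum//; congr (_ * _); apply: eq_bigr => i _.
  by rewrite Rintegral_sum// => j; exact: iA.
transitivity (\int[sigma]_(x in S) (w x * rot_laplacian u x)); last first.
  by apply: eq_Rintegral => x _; rewrite mulrC.
apply: (etrans (main u w Cu Cw)); apply: (etrans _ (esym (main w u Cw Cu))).
apply: (congr1 ( *%R ((2 * r ^+ 2)^-1))); apply: eq_bigr => i _; apply: eq_bigr => j _.
apply: (etrans (integral_rot_field_by_parts i j Cu Cw)).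
apply: (etrans _ (esym (integral_rot_field_by_parts i j Cw Cu))); apply: (congr1 -%R).
by apply: eq_Rintegral => x _; rewrite mulrC.
Qed.

End green.

(** * The heat equation in weak form *)

Lemma continuous_sum_fun (T : topologicalType) (R : realType) (I : Type) (l : seq I)
    (f : I -> T -> R) (x : T) : (forall i, {for x, continuous (f i)}) ->
  {for x, continuous (fun z => \sum_(i <- l) f i z)}.
Proof.
move=> cf; elim: l => [|a l IH].
  rewrite (_ : (fun z => _) = cst 0); first exact: cst_continuous.
  by apply/funext => z; rewrite big_nil.
rewrite (_ : (fun z => _) = (fun z => f a z + \sum_(i <- l) f i z)).
  exact: continuousD_fun.
by apply/funext => z; rewrite big_cons.
Qed.

Section heat.
Variables (R : realType) (N : nat) (c : 'rV[R]_N) (r : R).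
Hypothesis r_gt0 : 0 < r.
Local Notation S := (sphere c r).
Variable sigma : probability (borel_rV R N) R.
Hypothesis sigmaP : normalized_volume c r sigma.
Variables (p : 'rV[R]_N) (K : R -> 'rV[R]_N -> R).
Hypothesis KP : fundamental_solution c r sigma p K.

Let F s := K s \o retract c r.

Lemma continuous_slice (g : R -> 'rV[R]_N -> R) (s : R) x :
  {for (s, x), continuous (fun q : R * 'rV[R]_N => g q.1 q.2)} ->
  {for x, continuous (g s)}.
Proof.
move=> cg; apply: (@continuous_comp _ _ _ (fun x : 'rV[R]_N => (s, x))
  (fun q : R * 'rV[R]_N => g q.1 q.2)) => //.
have h1 : {for x, continuous (fun _ : 'rV[R]_N => s)} by exact: cst_continuous.
have h2 : {for x, continuous (fun z : 'rV[R]_N => z)} by exact: cvg_id.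
exact: (cvg_pair h1 h2).
Qed.

Lemma C2_slice (s : R) : 0 < s -> C2_off_center c (F s).
Proof.
move=> s0 x xc; case: KP => C12 _ _.
have [_ _ [d _] h] := C12 s x s0 xc; split => //.
- by move=> i; have [] := h i.
- move=> i j; have [_ +] := h i => /(_ j).
  exact: (@continuous_slice (fun s => partial (partial (F s) i) j)).
Qed.

Lemma F_on_sphere s x : S x -> F s x = K s x.
Proof. by move=> xS; rewrite /F/= retract_id. Qed.

(** In the polar decomposition of the Laplacian the radial terms vanish for the extension of u, and
    |y|^2 = r^2. *)
Lemma laplace_beltrami_rot (u : 'rV[R]_N -> R) : C2_off_center c (u \o retract c r) ->
  forall x, S x -> laplace_beltrami c r u x = rot_laplacian c r (u \o retract c r) x.
Proof.
move=> Cu x xS; have xc := sphere_neq_center r_gt0 xS.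
have d1 z : z != c -> differentiable (u \o retract c r) z by case/Cu.
have d2 z i : z != c -> differentiable (partial (u \o retract c r) i) z.
  by move=> zc; have [_ + _] := Cu z zc; apply.
rewrite laplace_beltramiE// /rot_laplacian sum_rot_field_sq; last by move=> l; exact: d2.
rewrite sum_radial// sum_radial2// xS.
set L := \sum_i _; move: L => L; by field; rewrite gt_eqF.
Qed.

Lemma is_derive_heat_kernel (s : R) x : 0 < s -> S x ->
  is_derive s 1 (F ^~ x) (2^-1 * rot_laplacian c r (F s) x).
Proof.
move=> s0 xS; case: KP => C12 eq _.
have [_ [d _] _ _] := C12 s x s0 (sphere_neq_center r_gt0 xS).
apply: DeriveDef => //.
rewrite -(laplace_beltrami_rot (C2_slice s0))// -eq// derive1E.
by congr ('D_1 _ s); apply/funext => a; exact: F_on_sphere.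
Qed.

Lemma continuous_heat_kernel_dt (s : R) x : 0 < s -> S x ->
  {for (s, x), continuous (fun q : R * 'rV[R]_N => 'D_1 (F ^~ q.2) q.1)}.
Proof.
move=> s0 xS; case: KP => C12 eq _.
have [_ [_ h] _ _] := C12 s x s0 (sphere_neq_center r_gt0 xS).
by apply: near_eq_continuous h; near=> q; rewrite derive1E.
Unshelve. all: by end_near. Qed.

Lemma continuous_heat_kernel (s : R) x : 0 < s -> S x ->
  {for (s, x), continuous (fun q : R * 'rV[R]_N => F q.1 q.2)}.
Proof.
move=> s0 xS; case: KP => C12 eq _.
by have [] := C12 s x s0 (sphere_neq_center r_gt0 xS).
Qed.

Section weak.
Variables (phi dphi : R -> 'rV[R]_N -> R).
Hypothesis C2phi : forall s, 0 < s -> C2_off_center c (phi s).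
Hypothesis dphiP : forall (s : R) x, 0 < s -> is_derive s 1 (phi ^~ x) (dphi s x).
Hypothesis cphi : forall (s : R) x, 0 < s ->
  {for (s, x), continuous (fun q : R * 'rV[R]_N => phi q.1 q.2)}.
Hypothesis cdphi : forall (s : R) x, 0 < s ->
  {for (s, x), continuous (fun q : R * 'rV[R]_N => dphi q.1 q.2)}.

Definition moment s := \int[sigma]_(x in S) (phi s x * K s x).

(** Differentiate under the integral, replace the time derivative of K by half its Laplacian and move
    the Laplacian onto the test function.  The test function depends on time because the centering of the
    moments does. *)
Lemma weak_heat (s : R) : 0 < s ->
  is_derive s 1 moment
    (\int[sigma]_(x in S) ((dphi s x + 2^-1 * rot_laplacian c r (phi s) x) * K s x)).
Proof.
move=> s0.
have mS : measurable (S : set (borel_rV R N)) by exact: measurable_sphere.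
have Sc x : S x -> x != c by exact: sphere_neq_center.
pose f (s : R) x := phi s x * F s x.
pose df (s : R) x := phi s x * 'D_1 (F ^~ x) s + F s x * dphi s x.
have fP (a : R) x : 0 < a -> S x -> is_derive a 1 (f ^~ x) (df a x).
  move=> a0 xS; have h1 := dphiP x a0; have h2 := is_derive_heat_kernel a0 xS.
  rewrite /df; have [h3 ->] := h2.
  exact: (is_deriveM h1 h2).
have cdf (a : R) x : 0 < a -> S x -> {for (a, x), continuous (fun q : R * 'rV[R]_N => df q.1 q.2)}.
  move=> a0 xS; apply: continuousD_fun; apply: continuousM_fun.
  - exact: cphi.
  - exact: continuous_heat_kernel_dt.
  - exact: continuous_heat_kernel.
  - exact: cdphi.
(* The time derivative of the integrand is bounded on the compact set [s/2, 2s] x S, which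
   dominates it near s. *)
have [M M0 hM] : exists2 M, 0 <= M & forall (a : R) x, a \in `]s / 2, (2 * s)[ -> S x -> `|df a x| <= M.
  have cw : {within (`[s / 2, (2 * s)] `*` S), continuous (fun q : R * 'rV[R]_N => df q.1 q.2)}.
    apply: continuous_in_subspaceT => -[a x]; rewrite inE => -[/=].
    rewrite in_itv/= => /andP[sa _] xS; apply: cdf => //.
    by apply: lt_le_trans sa; rewrite divr_gt0.
  have cK := compact_setX (@segment_compact R (s / 2) (2 * s)) (@compact_sphere R N c r r_gt0).
  have /compact_bounded[M [_ hM]] := continuous_compact cw cK.
  exists (`|M| + 1); first by rewrite addr_ge0.
  move=> a x ax xS; apply: (hM (`|M| + 1)); last first.
    by exists (a, x) => //; split => //=; exact: subset_itv_oo_cc.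
  by rewrite ltr_pwDr// ler_norm.
have I0 : `](s / 2), (2 * s)[%classic s.
  by rewrite /= in_itv/=; apply/andP; split; lra.
have Ipos a : `](s / 2), (2 * s)[%classic a -> 0 < a.
  by rewrite /= in_itv/= => /andP[+ _]; apply: lt_trans; rewrite divr_gt0.
have momE : moment = (fun a => \int[sigma]_(x in S) f a x).
  apply/funext => a; apply: eq_Rintegral => x; rewrite inE => xS.
  by rewrite /f F_on_sphere.
have intf a : 0 < a -> sigma.-integrable (S : set (borel_rV R N)) (EFin \o f a).
  move=> a0; apply: integrable_on_sphere => // x xS.
  apply: (@continuous_slice f); apply: continuousM_fun.
    exact: cphi.
  exact: continuous_heat_kernel.
have [H1 H2 H3 H4] : [/\ forall a, `](s / 2), (2 * s)[%classic a -> sigma.-integrable (S : set (borel_rV R N)) (EFin \o f a),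
  forall a x, `](s / 2), (2 * s)[%classic a -> S x -> derivable (f ^~ x) a 1,
  sigma.-integrable (S : set (borel_rV R N)) (EFin \o (fun=> M)) &
  forall a x, `](s / 2), (2 * s)[%classic a -> S x -> `|partial1of2 f a x| <= M].
  split.
  - by move=> a /Ipos; exact: intf.
  - by move=> a x /Ipos a0 xS; have [] := fP a x a0 xS.
  - by apply: integrable_on_sphere => // x _; exact: cst_continuous.
  - move=> a x aI xS; rewrite partial1of2E; have [_ ->] := fP a x (Ipos a aI) xS.
    exact: hM.
rewrite momE; apply: DeriveDef.
  exact: (@derivable_under_integral R _ (borel_rV R N) sigma f S mS s (s / 2) (2 * s) I0 H1 H2 (fun=> M)).
rewrite -derive1E (@differentiation_under_integral R _ (borel_rV R N) sigma f S mS s (s / 2) (2 * s) I0 H1 H2 (fun=> M))//.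
have cF : forall x, S x -> {for x, continuous (F s)}.
  by move=> x xS; apply: (@continuous_slice F); exact: continuous_heat_kernel.
have cphis : forall x, S x -> {for x, continuous (phi s)}.
  by move=> x xS; apply: (@continuous_slice phi); exact: cphi.
have clap u x : C2_off_center c u -> S x -> {for x, continuous (rot_laplacian c r u)}.
  move=> Cu /Sc xc; apply: continuousM_fun; first exact: cst_continuous.
  apply: continuous_sum_fun => i; apply: continuous_sum_fun => j.
  exact: continuous_rot_field_sq.
have CF := C2_slice s0.
have Cp := C2phi s0.
have cdp x : {for x, continuous (dphi s)}.
  by apply: (@continuous_slice dphi); exact: cdphi.
have [i1 i2 i3] : [/\ sigma.-integrable (S : set (borel_rV R N)) (EFin \o (fun x => phi s x * rot_laplacian c r (F s) x)),
  sigma.-integrable (S : set (borel_rV R N)) (EFin \o (fun x => rot_laplacian c r (phi s) x * F s x)) &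
  sigma.-integrable (S : set (borel_rV R N)) (EFin \o (fun x => dphi s x * F s x))].
  split; apply: integrable_on_sphere => // x xS; apply: continuousM_fun.
  - exact: cphis.
  - exact: clap.
  - exact: clap.
  - exact: cF.
  - exact: cdp.
  - exact: cF.
transitivity (\int[sigma]_(x in S) (2^-1 * (phi s x * rot_laplacian c r (F s) x) + dphi s x * F s x)).
  apply: eq_Rintegral => x; rewrite inE => xS.
  rewrite partial1of2E; have [_ ->] := fP s x s0 xS; rewrite /df.
  have [_ ->] := is_derive_heat_kernel s0 xS.
  by rewrite mulrCA [F s x * _]mulrC.
transitivity (\int[sigma]_(x in S) (2^-1 * (rot_laplacian c r (phi s) x * F s x) + dphi s x * F s x)); last first.
  apply: eq_Rintegral => x; rewrite inE => xS.
  by rewrite F_on_sphere// mulrA -mulrDl addrC.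
have iZ (g : 'rV[R]_N -> R) : sigma.-integrable (S : set (borel_rV R N)) (EFin \o g) ->
    sigma.-integrable (S : set (borel_rV R N)) (EFin \o (fun x => 2^-1 * g x)).
  move=> ig; exact: (@integrableZl _ _ _ sigma _ mS 2^-1 _ ig).
rewrite (@RintegralD _ _ _ sigma _ (fun x => 2^-1 * (phi s x * rot_laplacian c r (F s) x)) (fun x => dphi s x * F s x) mS (iZ _ i1) i3).
rewrite (@RintegralD _ _ _ sigma _ (fun x => 2^-1 * (rot_laplacian c r (phi s) x * F s x)) (fun x => dphi s x * F s x) mS (iZ _ i2) i3).
rewrite (@RintegralZl _ _ _ sigma _ _ 2^-1 mS i1) (@RintegralZl _ _ _ sigma _ _ 2^-1 mS i2).
by rewrite (green r_gt0 sigmaP Cp CF).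
Qed.

End weak.
End heat.

(** * Monomials and Euler identities *)

Section product_rule.
Variables (R : realType) (V : normedModType R).

Lemma is_derive_prod_seq (I : eqType) (l : seq I) (f : I -> V -> R) (df : I -> R) x v :
  uniq l -> (forall i, is_derive x v (f i) (df i)) ->
  is_derive x v (fun z => \prod_(i <- l) f i z)
    (\sum_(i <- l) df i * \prod_(j <- l | j != i) f j x).
Proof.
move=> + fP; elim: l => [_|a l IH /= /andP[al ul]].
  rewrite big_nil (_ : (fun z => _) = cst 1); first exact: is_derive_cst.
  by apply/funext => z; rewrite big_nil.
rewrite (_ : (fun z => _) = (f a * (fun z => \prod_(i <- l) f i z))); last first.
  by apply/funext => z; rewrite big_cons.
apply: is_derive_eq; first exact: (is_deriveM (fP a) (IH ul)).
rewrite big_cons big_cons eqxx/= addrC /GRing.scale/=; congr (_ + _).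
  rewrite mulrC; congr (_ * _); rewrite [in RHS]big_seq_cond [in LHS]big_seq.
  apply: eq_bigl => j; case: (boolP (j \in l)) => //= jl.
  by apply/esym; apply: contraNneq al => <-.
rewrite mulr_sumr; apply: eq_big_seq => i il.
rewrite big_cons ifT; first by rewrite mulrCA.
by apply: contraNneq al => ->.
Qed.

Lemma is_derive_prod (I : finType) (f : I -> V -> R) (df : I -> R) x v :
  (forall i, is_derive x v (f i) (df i)) ->
  is_derive x v (fun z => \prod_i f i z)
    (\sum_i df i * \prod_(j | j != i) f j x).
Proof. by move=> fP; apply: is_derive_prod_seq => //; exact: index_enum_uniq. Qed.

End product_rule.

Section multiindex.
Variable k : nat.
Implicit Types (a : 'I_k -> nat) (i j : 'I_k).

(** Truncated subtraction makes dec i a = a when a i = 0; the coefficient a i that accompanies the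
    decremented monomial vanishes in that case. *)
Definition dec i a : 'I_k -> nat := fun j => (a j - (j == i))%N.

Definition deg a : nat := \sum_i a i.

Lemma decC i j a : dec i (dec j a) = dec j (dec i a).
Proof. by apply/funext => l; rewrite /dec subnAC. Qed.

Lemma deg_dec i a : (0 < a i)%N -> deg a = (deg (dec i a)).+1.
Proof.
move=> ai; rewrite /deg (bigD1 i)//= [in RHS](bigD1 i)//= /dec eqxx.
rewrite -addSn subn1 prednK//; congr addn; apply: eq_bigr => j /negbTE ->.
by rewrite subn0.
Qed.

Lemma deg_eq0 a : deg a = 0%N -> forall i, a i = 0%N.
Proof.
move=> /eqP; rewrite /deg sum_nat_eq0 => /forallP h i.
by move/implyP: (h i) => /(_ isT) /eqP.
Qed.

End multiindex.

Section monomial.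
Variables (R : realType) (k : nat).
Implicit Types (a : 'I_k -> nat) (z : 'I_k -> R).

Definition mono a z : R := \prod_i z i ^+ a i.

Lemma mono_dec a z i :
  \prod_(j | j != i) z j ^+ a j * ((a i)%:R * z i ^+ (a i).-1) = (a i)%:R * mono (dec i a) z.
Proof.
rewrite /mono [in RHS](bigD1 i)//= /dec eqxx subn1.
rewrite (eq_bigr (fun j => z j ^+ (a j - (j == i)))); first by ring.
by move=> j /negbTE ->; rewrite subn0.
Qed.

Lemma mul_mono_dec a z i : z i * ((a i)%:R * mono (dec i a) z) = (a i)%:R * mono a z.
Proof.
have [->|ai] := posnP (a i); first by rewrite !mul0r mulr0.
rewrite mulrCA; congr (_ * _); rewrite /mono (bigD1 i)//= [RHS](bigD1 i)//= mulrA.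
rewrite /dec eqxx subn1 -exprS prednK//; congr (_ * _).
by apply: eq_bigr => j /negbTE ->; rewrite subn0.
Qed.

Lemma is_derive_mono (V : normedModType R) a (f : 'I_k -> V -> R) df x v :
  (forall i, is_derive x v (f i) (df i)) ->
  is_derive x v (fun y => mono a (f^~ y)) (\sum_i df i * ((a i)%:R * mono (dec i a) (f ^~ x))).
Proof.
move=> fP; rewrite /mono.
have fX i : is_derive x v (fun y => f i y ^+ a i) (((a i)%:R * f i x ^+ (a i).-1) * df i).
  rewrite (_ : (fun y => _) = f i ^+ a i); first exact: (is_deriveX (a i) (fP i)).
  by apply/funext => y; rewrite exprfctE.
apply: is_derive_eq; first exact: (is_derive_prod fX).
apply: eq_bigr => i _; rewrite -mono_dec; ring.
Qed.

Lemma euler1 a z : \sum_i z i * ((a i)%:R * mono (dec i a) z) = (deg a)%:R * mono a z.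
Proof.
rewrite /deg natr_sum mulr_suml; apply: eq_bigr => i _; exact: mul_mono_dec.
Qed.

(** Monomials are homogeneous, so is each of their partial derivatives, of degree one less. *)
Lemma euler_dec a z i : (a i)%:R * (\sum_j z j * ((dec i a j)%:R * mono (dec j (dec i a)) z))
  = ((deg a)%:R - 1) * ((a i)%:R * mono (dec i a) z).
Proof.
rewrite euler1 mulrCA; have [->|ai] := posnP (a i); first by rewrite !mul0r !mulr0.
by rewrite (deg_dec ai) -natr1 addrK.
Qed.

Lemma dec_symm a i j : (a i)%:R * (dec i a j)%:R = (a j)%:R * (dec j a i)%:R :> R.
Proof.
rewrite -!natrM /dec eq_sym; have [->//|_] := eqVneq i j.
by rewrite !subn0 mulnC.
Qed.

(** The Hessian of a monomial evaluated at the vector z + b, expanded bilinearly: the terms containing z are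
    given by the Euler identities, and the pure b term is left. *)
Lemma euler2 a (z b : 'I_k -> R) :
  \sum_i \sum_j (z i + b i) * (z j + b j) * ((a i)%:R * ((dec i a j)%:R * mono (dec j (dec i a)) z)) =
  (deg a)%:R * ((deg a)%:R - 1) * mono a z
  + 2 * ((deg a)%:R - 1) * (\sum_i b i * ((a i)%:R * mono (dec i a) z))
  + \sum_i \sum_j b i * b j * ((a i)%:R * ((dec i a j)%:R * mono (dec j (dec i a)) z)).
Proof.
pose T i j : R := (a i)%:R * ((dec i a j)%:R * mono (dec j (dec i a)) z).
have Tsym i j : T i j = T j i by rewrite /T !mulrA dec_symm decC.
have Tz i : \sum_j z j * T i j = ((deg a)%:R - 1) * ((a i)%:R * mono (dec i a) z).
  rewrite -euler_dec mulr_sumr; apply: eq_bigr => j _; rewrite /T; ring.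
have zz : \sum_i \sum_j z i * z j * T i j = (deg a)%:R * ((deg a)%:R - 1) * mono a z.
  transitivity (\sum_i ((deg a)%:R - 1) * (z i * ((a i)%:R * mono (dec i a) z))).
    apply: eq_bigr => i _; rewrite mulrCA -Tz mulr_sumr.
    by apply: eq_bigr => j _; rewrite [RHS]mulrA.
  by rewrite -mulr_sumr euler1; ring.
have bz : \sum_i \sum_j b i * z j * T i j = ((deg a)%:R - 1) * (\sum_i b i * ((a i)%:R * mono (dec i a) z)).
  rewrite mulr_sumr; apply: eq_bigr => i _; rewrite mulrCA -Tz mulr_sumr.
  by apply: eq_bigr => j _; rewrite [RHS]mulrA.
have zb : \sum_i \sum_j z i * b j * T i j = \sum_i \sum_j b i * z j * T i j.
  rewrite exchange_big/=; apply: eq_bigr => i _; apply: eq_bigr => j _.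
  by rewrite Tsym [z j * _]mulrC.
rewrite -/(T _ _).
transitivity ((\sum_i \sum_j z i * z j * T i j) + (\sum_i \sum_j z i * b j * T i j)
  + (\sum_i \sum_j b i * z j * T i j) + (\sum_i \sum_j b i * b j * T i j)).
  rewrite -!big_split/=; apply: eq_bigr => i _; rewrite -!big_split/=.
  by apply: eq_bigr => j _; rewrite -/(T i j); ring.
rewrite zb bz zz; congr (_ + _); ring.
Qed.

End monomial.

(** * The Laplacian of a monomial *)

Section monomial_on_sphere.
Variables (R : realType) (N k : nat) (c : 'rV[R]_N) (e : 'I_k -> 'I_N).
Hypothesis e_inj : injective e.
Implicit Types (a : 'I_k -> nat) (b : 'I_k -> R) (x v : 'rV[R]_N).

(** A monomial in some of the coordinates relative to c, the chosen coordinates being further translated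
    by b.  The vector b carries the centering of the moments. *)
Definition centered_mono a b x : R := mono a (fun i => (x - c) 0 (e i) - b i).

Lemma is_derive_centered_mono a b x v :
  is_derive x v (centered_mono a b) (\sum_i v 0 (e i) * ((a i)%:R * centered_mono (dec i a) b x)).
Proof.
apply: (@is_derive_mono R k _ a (fun i x => (x - c) 0 (e i) - b i) (fun i => v 0 (e i))) => i.
rewrite -[X in is_derive _ _ _ X]subr0.
by apply: is_deriveB_fun; exact: is_derive_coord.
Qed.

Lemma differentiable_expr (u : 'rV[R]_N -> R) n x :
  differentiable u x -> differentiable (fun z => u z ^+ n) x.
Proof.
move=> du; elim: n => [|n IH].
  rewrite (_ : (fun z => _) = cst 1); first exact: differentiable_cst.
  by apply/funext => z; rewrite expr0.
rewrite (_ : (fun z => _) = (fun z => u z * u z ^+ n)); first exact: differentiable_prod.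
by apply/funext => z; rewrite exprS.
Qed.

Lemma differentiable_centered_mono a b x : differentiable (centered_mono a b) x.
Proof.
rewrite /centered_mono /mono; elim: (index_enum _) => [|i l IH].
  rewrite (_ : (fun z => _) = cst 1); first exact: differentiable_cst.
  by apply/funext => z; rewrite big_nil.
rewrite (_ : (fun z => _) = (fun z => ((z - c) 0 (e i) - b i) ^+ a i *
    \prod_(j <- l) ((z - c) 0 (e j) - b j) ^+ a j)); last first.
  by apply/funext => z; rewrite big_cons.
apply: differentiable_prod => //; apply: differentiable_expr.
by apply: differentiableB => //; exact: differentiable_shifted_coord.
Qed.

Lemma partial_centered_mono a b l :
  partial (centered_mono a b) l = fun x => \sum_i (l == e i)%:R * ((a i)%:R * centered_mono (dec i a) b x).
Proof.
apply/funext => x; apply: partial_eq.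
rewrite [X in is_derive _ _ _ X](_ : _ = \sum_i (delta_mx 0 l : 'rV[R]_N) 0 (e i) * ((a i)%:R * centered_mono (dec i a) b x)).
  exact: is_derive_centered_mono.
by apply: eq_bigr => i _; rewrite mxE eqxx [e i == l]eq_sym.
Qed.

Lemma partial2_centered_mono a b l m :
  partial (partial (centered_mono a b) l) m = fun x =>
  \sum_i \sum_j (l == e i)%:R * (m == e j)%:R *
     ((a i)%:R * ((dec i a j)%:R * centered_mono (dec j (dec i a)) b x)).
Proof.
rewrite partial_centered_mono; apply/funext => x; apply: partial_eq.
apply: is_derive_sum_fun => i.
rewrite (_ : (fun y => _) = (fun y => ((l == e i)%:R * (a i)%:R) * centered_mono (dec i a) b y)); last first.
  by apply/funext => z; rewrite mulrA.
have h := is_deriveM_fun (is_derive_cst ((l == e i)%:R * (a i)%:R : R) x (delta_mx 0 m))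
   (partialP m (differentiable_centered_mono (dec i a) b x)).
apply: (is_derive_eq h).
rewrite mulr0 addr0 /= partial_centered_mono mulr_sumr; apply: eq_bigr => j _; ring.
Qed.

Lemma continuous_centered_mono a b x : {for x, continuous (centered_mono a b)}.
Proof. by apply: differentiable_continuous; exact: differentiable_centered_mono. Qed.

Lemma C2_centered_mono a b : C2_off_center c (centered_mono a b).
Proof.
move=> x _; split.
- exact: differentiable_centered_mono.
- move=> i; rewrite partial_centered_mono.
  rewrite (_ : (fun y => _) = \sum_j (fun y => ((i == e j)%:R * (a j)%:R) * centered_mono (dec j a) b y)).
    apply: differentiable_sum => j; apply: differentiable_prod => //.
    exact: differentiable_centered_mono.
  by apply/funext => z; rewrite fct_sumE; apply: eq_bigr => j _; rewrite mulrA.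
- move=> i j; rewrite partial2_centered_mono.
  apply: continuous_sum_fun => i'; apply: continuous_sum_fun => j'.
  do 3 (apply: continuousM_fun; first exact: cst_continuous).
  exact: continuous_centered_mono.
Qed.

Let sum_pick (f : 'I_k -> R) (g : 'I_N -> R) :
  \sum_l g l * \sum_i (l == e i)%:R * f i = \sum_i g (e i) * f i.
Proof.
under eq_bigr do rewrite mulr_sumr.
rewrite exchange_big/=; apply: eq_bigr => i _.
rewrite (bigD1 (e i))//= eqxx mul1r big1 ?addr0// => l /negbTE ->.
by rewrite mul0r mulr0.
Qed.

Lemma laplacian_centered_mono a b x :
  \sum_l partial (partial (centered_mono a b) l) l x =
  \sum_i (a i)%:R * ((a i)%:R - 1) * centered_mono (dec i (dec i a)) b x.
Proof.
under eq_bigr do rewrite partial2_centered_mono.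
rewrite exchange_big/=; apply: eq_bigr => i _.
rewrite exchange_big/= (bigD1 i)//= [X in _ + X]big1 ?addr0; last first.
  move=> j ji; apply: big1 => l _; have [->|_] := eqVneq l (e i); last by rewrite !mul0r.
  have [/e_inj /eqP|_] := eqVneq (e i) (e j); last by rewrite mulr0 mul0r.
  by rewrite eq_sym (negbTE ji).
rewrite (bigD1 (e i))//= eqxx big1 ?addr0; last by move=> l /negbTE ->; rewrite !mul0r.
rewrite !mul1r mulrA; congr (_ * _); rewrite /dec eqxx.
case: (a i) => [|n]; first by rewrite !mul0r.
by rewrite subn1/= -!natr1 addrK.
Qed.

Variable r : R.
Hypothesis r_gt0 : 0 < r.

(** Polar decomposition of the Laplacian, with the position vector z + b, where the monomial is homogeneous
    in z: the radial derivatives are computed by the Euler identities. *)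
Lemma rot_laplacian_centered_mono a b x : sphere c r x ->
  rot_laplacian c r (centered_mono a b) x =
  \sum_i (a i)%:R * ((a i)%:R - 1) * centered_mono (dec i (dec i a)) b x
  - r ^- 2 * ((deg a)%:R * ((deg a)%:R - 1) * centered_mono a b x
   + 2 * ((deg a)%:R - 1) * (\sum_i b i * ((a i)%:R * centered_mono (dec i a) b x))
   + (\sum_i \sum_j b i * b j * ((a i)%:R * ((dec i a j)%:R * centered_mono (dec j (dec i a)) b x)))
   + (N%:R - 1) * ((deg a)%:R * centered_mono a b x + \sum_i b i * ((a i)%:R * centered_mono (dec i a) b x))).
Proof.
move=> xS; rewrite /rot_laplacian sum_rot_field_sq; last first.
  by move=> l; have [_ + _] := C2_centered_mono a b (sphere_neq_center r_gt0 xS).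
rewrite laplacian_centered_mono xS.
set z : 'I_k -> R := fun i => (x - c) 0 (e i) - b i.
have zb i : (x - c) 0 (e i) = z i + b i by rewrite /z subrK.
have -> : \sum_i (x - c) 0 i * partial (centered_mono a b) i x =
   (deg a)%:R * centered_mono a b x + \sum_i b i * ((a i)%:R * centered_mono (dec i a) b x).
  transitivity (\sum_i (x - c) 0 (e i) * ((a i)%:R * centered_mono (dec i a) b x)).
    rewrite -sum_pick; apply: eq_bigr => l _; by rewrite partial_centered_mono.
  under eq_bigr do rewrite zb mulrDl.
  by rewrite big_split/=; congr (_ + _); rewrite [RHS](_ : _ = (deg a)%:R * mono a z)// -euler1.
have -> : \sum_i \sum_j (x - c) 0 i * (x - c) 0 j * partial (partial (centered_mono a b) i) j x =
   \sum_i \sum_j (z i + b i) * (z j + b j) * ((a i)%:R * ((dec i a j)%:R * mono (dec j (dec i a)) z)).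
  transitivity (\sum_i (x - c) 0 (e i) * \sum_j (x - c) 0 (e j) *
      ((a i)%:R * ((dec i a j)%:R * mono (dec j (dec i a)) z))).
    rewrite -(sum_pick (fun i => \sum_j (x - c) 0 (e j) *
      ((a i)%:R * ((dec i a j)%:R * mono (dec j (dec i a)) z))) (fun l => (x - c) 0 l)).
    apply: eq_bigr => l _.
    transitivity ((x - c) 0 l * \sum_m (x - c) 0 m * partial (partial (centered_mono a b) l) m x).
      by rewrite [RHS]mulr_sumr; apply: eq_bigr => m _; exact/esym/mulrA.
    apply: (congr1 ( *%R _)).
    transitivity (\sum_m (x - c) 0 m * \sum_j (m == e j)%:R * \sum_i (l == e i)%:R *
      ((a i)%:R * ((dec i a j)%:R * mono (dec j (dec i a)) z))).
      apply: eq_bigr => m _; rewrite partial2_centered_mono; congr (_ * _); rewrite exchange_big/=.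
      apply: eq_bigr => j _; rewrite mulr_sumr; apply: eq_bigr => i _.
      by rewrite [RHS]mulrCA [RHS]mulrA.
    rewrite sum_pick; under eq_bigr do rewrite mulr_sumr.
    rewrite exchange_big/=; apply: eq_bigr => i _; rewrite mulr_sumr.
    by apply: eq_bigr => j _; rewrite mulrCA.
  apply: eq_bigr => i _; rewrite mulr_sumr; apply: eq_bigr => j _.
  by rewrite !zb mulrA.
rewrite euler2 -/(centered_mono _ _ _) .
set L := \sum_i _ * centered_mono _ _ _.
set D1 := \sum_i b i * _.
set D2 := \sum_i \sum_j _.
move: (centered_mono a b x) L D1 D2 => A L D1 D2.
by field; rewrite gt_eqF.
Qed.

End monomial_on_sphere.

(** * The differential equations of the moments *)

Lemma continuous_mono (T : topologicalType) (R : realType) k (a : 'I_k -> nat)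
    (f : 'I_k -> T -> R) x :
  (forall i, {for x, continuous (f i)}) -> {for x, continuous (fun z => mono a (f ^~ z))}.
Proof.
move=> cf; rewrite /mono; elim: (index_enum _) => [|i l IH].
  rewrite (_ : (fun z => _) = cst 1); first exact: cst_continuous.
  by apply/funext => z; rewrite big_nil.
rewrite (_ : (fun z => _) = (fun z => f i z ^+ a i * \prod_(j <- l) f j z ^+ a j)); last first.
  by apply/funext => z; rewrite big_cons.
apply: continuousM_fun => //; elim: (a i) => [|n IHn].
  by rewrite (_ : (fun z => _) = cst 1); [exact: cst_continuous|apply/funext => z; rewrite expr0].
rewrite (_ : (fun z => _) = (fun z => f i z * f i z ^+ n)); first exact: continuousM_fun.
by apply/funext => z; rewrite exprS.
Qed.

Lemma is_derive_shift_m (R : realType) N (s : R) :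
  is_derive s 1 (fun s => shift_m s N) (2^-1 * (- 1 + N%:R^-1) * shift_m s N).
Proof.
rewrite /shift_m.
have h : is_derive s 1 (fun s : R => s / 2 * (- 1 + N%:R^-1)) (2^-1 * (- 1 + N%:R^-1)).
  rewrite (_ : (fun s => _) = (fun s : R => (2^-1 * (- 1 + N%:R^-1)) *: s)); last first.
    by apply/funext => z; rewrite /GRing.scale/=; ring.
  by apply: is_derive_eq; rewrite /GRing.scale/= mulr1.
have h2 := is_derive1_comp (is_derive_expR _) h.
have h3 := is_deriveZ (Num.sqrt N%:R) h2.
by apply: (is_derive_eq h3); rewrite /GRing.scale/=; ring.
Qed.

Section shifted_moments.
Variables (R : realType) (t : R) (k' N : nat).
Local Notation k := k'.+1.
Hypothesis kN : (k < N)%N.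
Local Notation c := (shifted_center t N).
Local Notation r := (Num.sqrt N%:R : R).
Local Notation S := (sphere c r).
Variable sigma : probability (borel_rV R N) R.
Variable K : R -> 'rV[R]_N -> R.
Hypothesis sigmaP : normalized_volume c r sigma.
Hypothesis KP : fundamental_solution c r sigma (north_pole t N) K.

Definition emb (i : 'I_k) : 'I_N := widen_ord (ltnW kN) i.

Lemma emb_inj : injective emb.
Proof. by move=> i j /(congr1 val)/= /val_inj. Qed.

Lemma N_gt0 : 0 < N%:R :> R.
Proof. by rewrite ltr0n; apply: leq_trans kN. Qed.

Let r_gt0 : 0 < r.
Proof. by rewrite sqrtr_gt0 N_gt0. Qed.

Let r2 : r ^+ 2 = N%:R.
Proof. by rewrite sqr_sqrtr// ltW// N_gt0. Qed.

Definition mean_shift (s : R) : 'I_k -> R := fun i => if i == ord0 then shift_m s N else 0.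

(** The monomial whose integral is the moment at time s.  The center c of the sphere is that of the fixed
    time t; only the translation of the first coordinate moves with s. *)
Definition shifted_mono (a : 'I_k -> nat) (s : R) : 'rV[R]_N -> R := centered_mono c emb a (mean_shift s).

Definition mono_moment (a : 'I_k -> nat) (s : R) : R := moment c r sigma K (shifted_mono a) s.

(** The time derivative of shifted_mono comes from the centering alone, which satisfies
    (d/ds) m_s = (-1 + 1/N) m_s / 2. *)
Definition shifted_mono_dt (a : 'I_k -> nat) (s : R) x : R :=
  2^-1 * (1 - N%:R^-1) * shift_m s N * ((a ord0)%:R * shifted_mono (dec ord0 a) s x).

Lemma sum_mean_shift s (f : 'I_k -> R) : \sum_i mean_shift s i * f i = shift_m s N * f ord0.
Proof.
rewrite (bigD1 ord0)//= /mean_shift eqxx big1 ?addr0// => i /negbTE ->.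
by rewrite mul0r.
Qed.

Lemma is_derive_shifted_mono a (s : R) x : is_derive s 1 ((shifted_mono a) ^~ x) (shifted_mono_dt a s x).
Proof.
pose D := 2^-1 * (- 1 + N%:R^-1) * shift_m s N.
have h : is_derive s 1 ((shifted_mono a) ^~ x)
   (\sum_i (if i == ord0 then - D else 0) * ((a i)%:R * shifted_mono (dec i a) s x)).
  apply: (@is_derive_mono R k R^o a (fun i s => (x - c) 0 (emb i) - mean_shift s i)) => i.
rewrite /mean_shift; case: (i == ord0).
    rewrite -[X in is_derive _ _ _ X]sub0r.
    exact: (is_deriveB (is_derive_cst ((x - c) 0 (emb i)) s 1) (is_derive_shift_m N s)).
  rewrite -[X in is_derive _ _ _ X]subr0.
  exact: (is_deriveB (is_derive_cst ((x - c) 0 (emb i)) s 1) (is_derive_cst 0 s 1)).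
apply: (is_derive_eq h); rewrite (bigD1 ord0)//= big1 ?addr0; last first.
  by move=> i /negbTE ->; rewrite mul0r.
by rewrite /shifted_mono_dt /D; ring.
Qed.

Lemma continuous_shift_m : continuous (fun s : R => shift_m s N).
Proof.
move=> s; apply: differentiable_continuous; apply/derivable1_diffP.
by have [] := is_derive_shift_m N s.
Qed.

Lemma continuous_fst_comp (f : R -> R) (q : R * 'rV[R]_N) : continuous f ->
  {for q, continuous (fun q : R * 'rV[R]_N => f q.1)}.
Proof.
move=> cf; apply: (@continuous_comp _ _ _ fst f); last exact: cf.
exact: cvg_fst.
Qed.

Lemma continuous_shifted_mono a (s : R) x :
  {for (s, x), continuous (fun q : R * 'rV[R]_N => shifted_mono a q.1 q.2)}.
Proof.
apply: continuous_mono => i; apply: continuousB_fun.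
  apply: (@continuous_comp _ _ _ snd (fun x : 'rV[R]_N => (x - c) 0 (emb i))).
    exact: cvg_snd.
  by apply: differentiable_continuous; exact: differentiable_shifted_coord.
rewrite /mean_shift; case: (i == ord0); last exact: cst_continuous.
exact: (@continuous_fst_comp (fun s => shift_m s N) (s, x) continuous_shift_m).
Qed.

Lemma continuous_shifted_mono_dt a (s : R) x :
  {for (s, x), continuous (fun q : R * 'rV[R]_N => shifted_mono_dt a q.1 q.2)}.
Proof.
apply: continuousM_fun.
  apply: continuousM_fun; first exact: cst_continuous.
  exact: (@continuous_fst_comp (fun s => shift_m s N) (s, x) continuous_shift_m).
apply: continuousM_fun; first exact: cst_continuous.
exact: continuous_shifted_mono.
Qed.

(** The eigenvalue, up to sign, of half the Laplacian on spherical harmonics of degree |a| on the sphere of radius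
    sqrt N. *)
Definition decay_rate (a : 'I_k -> nat) : R := (deg a)%:R * (N%:R + (deg a)%:R - 2) / (2 * N%:R).

Let mS : measurable (S : set (borel_rV R N)).
Proof. exact: measurable_sphere. Qed.

Let integrable_shifted_monoK a s : 0 < s ->
  sigma.-integrable (S : set (borel_rV R N)) (EFin \o (fun x => shifted_mono a s x * K s x)).
Proof.
move=> s0; apply: (@eq_integrable _ _ _ sigma _ mS (EFin \o (fun x => shifted_mono a s x * (K s \o retract c r) x))).
  by move=> x; rewrite inE => xS /=; rewrite retract_id.
apply: integrable_on_sphere => // x xS; apply: continuousM_fun.
  exact: continuous_centered_mono.
apply: (@continuous_slice R N (fun s => K s \o retract c r)).
exact: (continuous_heat_kernel r_gt0 KP s0 xS).
Qed.

(** The weak heat equation applied to the moving monomial.  The two contributions to the first order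
    term are (1 - 1/N) m_s / 2, from the motion of the centering, and -(2 (|a| - 1) + N - 1) m_s / (2 N),
    from the Laplacian; their parts
    of size m_s cancel, and -(|a| - 1) m_s / N is left. *)
Lemma moment_ode a (s : R) : 0 < s ->
  is_derive s 1 (mono_moment a) (- decay_rate a * mono_moment a s
    - shift_m s N / N%:R * ((deg a)%:R - 1) * (a ord0)%:R * mono_moment (dec ord0 a) s
    + \sum_i (2^-1 * (1 - (if i == ord0 then shift_m s N ^+ 2 / N%:R else 0))
        * ((a i)%:R * ((a i)%:R - 1))) * mono_moment (dec i (dec i a)) s).
Proof.
move=> s0.
have h := @weak_heat R N c r r_gt0 sigma sigmaP (north_pole t N) K KP (shifted_mono a) (shifted_mono_dt a)
  (fun s _ => @C2_centered_mono R N k c emb a (mean_shift s))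
  (fun s x _ => is_derive_shifted_mono a s x) (fun s x _ => @continuous_shifted_mono a s x)
  (fun s x _ => @continuous_shifted_mono_dt a s x) s s0.
apply: (is_derive_eq h).
set m := shift_m s N.
pose w i := 2^-1 * (1 - (if i == ord0 then m ^+ 2 / N%:R else 0)) * ((a i)%:R * ((a i)%:R - 1)).
pose u := - decay_rate a.
pose v := - (m / N%:R * ((deg a)%:R - 1) * (a ord0)%:R).
transitivity (\int[sigma]_(x in S) (u * (shifted_mono a s x * K s x) +
   (v * (shifted_mono (dec ord0 a) s x * K s x)
   + \sum_i w i * (shifted_mono (dec i (dec i a)) s x * K s x)))).
  apply: eq_Rintegral => x; rewrite inE => xS.
  rewrite /shifted_mono_dt {2}/shifted_mono rot_laplacian_centered_mono//; last exact: emb_inj.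
  rewrite sum_mean_shift.
  have -> : \sum_i \sum_j mean_shift s i * mean_shift s j *
      ((a i)%:R * ((dec i a j)%:R * centered_mono c emb (dec j (dec i a)) (mean_shift s) x)) =
     m ^+ 2 * ((a ord0)%:R * ((a ord0)%:R - 1)) * shifted_mono (dec ord0 (dec ord0 a)) s x.
    transitivity (\sum_i mean_shift s i * \sum_j mean_shift s j *
      ((a i)%:R * ((dec i a j)%:R * shifted_mono (dec j (dec i a)) s x))).
      apply: eq_bigr => i _; rewrite mulr_sumr; apply: eq_bigr => j _.
      by rewrite -[LHS]mulrA.
    rewrite sum_mean_shift sum_mean_shift -/m.
    have -> : (dec ord0 a ord0) = (a ord0).-1 by rewrite /dec eqxx subn1.
    case: (a ord0) => [|n]; first by rewrite !mul0r !mulr0 mul0r.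
    by rewrite -natr1 addrK; ring.
  have -> : \sum_i w i * (shifted_mono (dec i (dec i a)) s x * K s x) =
    (2^-1 * (\sum_i (a i)%:R * ((a i)%:R - 1) * shifted_mono (dec i (dec i a)) s x)
     - 2^-1 * (m ^+ 2 / N%:R) * ((a ord0)%:R * ((a ord0)%:R - 1) * shifted_mono (dec ord0 (dec ord0 a)) s x)) * K s x.
    transitivity (\sum_i (2^-1 * ((a i)%:R * ((a i)%:R - 1) * shifted_mono (dec i (dec i a)) s x)
       - (if i == ord0 then 2^-1 * (m ^+ 2 / N%:R) * ((a i)%:R * ((a i)%:R - 1) * shifted_mono (dec i (dec i a)) s x) else 0)) * K s x).
      by apply: eq_bigr => i _; rewrite /w; case: ifP => _; ring.
    rewrite -mulr_suml sumrB -mulr_sumr -big_mkcond/= big_pred1_eq//.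
  rewrite r2 -/m /u /v /decay_rate.
  set L := \sum_i _ * centered_mono _ _ _ _ _.
  rewrite /shifted_mono.
  move: (centered_mono c emb a _ x) (centered_mono c emb (dec ord0 a) _ x) (centered_mono c emb (dec ord0 (dec ord0 a)) _ x) => A B C.
  move: L (K s x) (deg a)%:R (a ord0)%:R => L Kx d a0.
  have n0 := lt0r_neq0 N_gt0.
  by field.
have iZ (q : R) a' : sigma.-integrable (S : set (borel_rV R N)) (EFin \o (fun x => q * (shifted_mono a' s x * K s x))).
  exact: (@integrableZl _ _ _ sigma _ mS q _ (integrable_shifted_monoK a' s0)).
have iS : sigma.-integrable (S : set (borel_rV R N)) (EFin \o (fun x => \sum_i w i * (shifted_mono (dec i (dec i a)) s x * K s x))).
  by apply: integrable_Rsum => // i; exact: iZ.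
have iD : sigma.-integrable (S : set (borel_rV R N)) (EFin \o (fun x => v * (shifted_mono (dec ord0 a) s x * K s x) + \sum_i w i * (shifted_mono (dec i (dec i a)) s x * K s x))).
  exact: (@integrableD _ _ _ sigma _ mS _ _ (iZ v _) iS).
rewrite (@RintegralD _ _ _ sigma _ _ _ mS (iZ u a) iD).
rewrite (@RintegralD _ _ _ sigma _ _ _ mS (iZ v _) iS).
rewrite (@RintegralZl _ _ _ sigma _ _ u mS (integrable_shifted_monoK a s0)).
rewrite (@RintegralZl _ _ _ sigma _ _ v mS (integrable_shifted_monoK (dec ord0 a) s0)).
rewrite Rintegral_sum//.
rewrite addrA mulNr; congr (_ + _).
  by rewrite /v mulNr.
apply: eq_bigr => i _.
by rewrite (@RintegralZl _ _ _ sigma _ _ (w i) mS (integrable_shifted_monoK _ s0)).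
Qed.

End shifted_moments.

(** * The moments at time zero *)

Section initial_moments.
Variables (R : realType) (t : R) (k' N : nat).
Local Notation k := k'.+1.
Hypothesis kN : (k < N)%N.
Local Notation c := (shifted_center t N).
Local Notation r := (Num.sqrt N%:R : R).
Local Notation S := (sphere c r).
Variable sigma : probability (borel_rV R N) R.
Variable K : R -> 'rV[R]_N -> R.
Hypothesis KP : fundamental_solution c r sigma (north_pole t N) K.

Definition lower_first (j : nat) (a : 'I_k -> nat) : 'I_k -> nat :=
  fun i => if i == ord0 then (a i - j)%N else a i.

(** A function of x that depends on s cannot be fed to the initial condition of the heat kernel.
    The binomial formula rewrites the moving monomial as a combination of fixed ones, with coefficients that
    are continuous in s. *)
Lemma shifted_mono_expand a (s : R) x : shifted_mono t kN a s x =
  \sum_(j < (a ord0).+1) ('C(a ord0, j))%:R * (shift_m 0 N - shift_m s N) ^+ j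
    * shifted_mono t kN (lower_first j a) 0 x.
Proof.
rewrite /shifted_mono /centered_mono /mono (bigD1 ord0)//=.
set P := \prod_(i < _ | _) _.
rewrite (_ : (x - c) 0 (emb kN ord0) - mean_shift N s ord0 =
  ((x - c) 0 (emb kN ord0) - shift_m 0 N) + (shift_m 0 N - shift_m s N)); last first.
  by rewrite /mean_shift eqxx; ring.
rewrite exprDn mulr_suml; apply: eq_bigr => j _.
rewrite [in RHS](bigD1 ord0)//= /lower_first eqxx /mean_shift eqxx.
rewrite [X in _ = _ * (_ * X)](_ : _ = P); last first.
  by apply: eq_bigr => i /negbTE i0; rewrite /mean_shift i0.
by rewrite -mulr_natl; ring.
Qed.

Lemma shifted_mono_at_pole a : shifted_mono t kN a 0 (north_pole t N) = (deg a == 0%N)%:R.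
Proof.
have z0 i : (north_pole t N - c) 0 (emb kN i) - mean_shift N 0 i = 0 :> R.
  rewrite !mxE /mean_shift /shift_m !mul0r expR0 mulr1.
  rewrite (_ : (val (emb kN i) == 0%N) = (i == ord0))//.
  by case: (i == ord0); ring.
rewrite /shifted_mono /centered_mono /mono.
under eq_bigr do rewrite z0.
have [da|da] := eqVneq (deg a) 0%N.
  by apply: big1 => i _; rewrite (deg_eq0 da) expr0.
have [i ai] : exists i, a i != 0%N.
  apply/existsP; apply: contraNT da; rewrite negb_exists => /forallP h.
  by rewrite /deg sum_nat_eq0; apply/forallP => i; have := h i; rewrite negbK.
by rewrite (bigD1 i)//= expr0n (negbTE ai) mul0r.
Qed.

Let r_gt0 : 0 < r.
Proof. by rewrite sqrtr_gt0 ltr0n; apply: leq_trans kN. Qed.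

Let mS : measurable (S : set (borel_rV R N)).
Proof. exact: measurable_sphere. Qed.

Let int_fixed (phi : 'rV[R]_N -> R) (s : R) : 0 < s -> (forall x, {for x, continuous phi}) ->
  sigma.-integrable (S : set (borel_rV R N)) (EFin \o (fun x => phi x * K s x)).
Proof.
move=> s0 cphi; apply: (@eq_integrable _ _ _ sigma _ mS (EFin \o (fun x => phi x * (K s \o retract c r) x))).
  by move=> x; rewrite inE => xS /=; rewrite retract_id.
apply: integrable_on_sphere => // x xS; apply: continuousM_fun.
  exact: cphi.
apply: (@continuous_slice R N (fun s => K s \o retract c r)).
exact: (continuous_heat_kernel r_gt0 KP s0 xS).
Qed.

Lemma integral_at_time0 (phi : 'rV[R]_N -> R) : (forall x, {for x, continuous phi}) ->
  \int[sigma]_(x in S) (phi x * K s x) @[s --> 0^'+] --> phi (north_pole t N).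
Proof.
move=> cphi; case: KP => _ _ init.
have := init phi => /(_ _) h; apply: fine_cvg; apply: h.
by apply: continuous_in_subspaceT => x _; exact: cphi.
Qed.

(** Expand in fixed monomials.  At s = 0 only the term without a power of m_0 - m_s survives, and its
    integral tends to its value at the pole. *)
Lemma moment_init a : mono_moment t kN sigma K a s @[s --> 0^'+] --> ((deg a == 0%N)%:R : R).
Proof.
pose B j s := \int[sigma]_(x in S) (shifted_mono t kN (lower_first j a) 0 x * K s x).
pose C (s : R) j := ('C(a ord0, j))%:R * (shift_m 0 N - shift_m s N) ^+ j.
have cS b s x : {for x, continuous (shifted_mono t kN b s)} by exact: continuous_centered_mono.
have E (s : R) : 0 < s -> mono_moment t kN sigma K a s = \sum_(j < (a ord0).+1) C s j * B j s.
  move=> s0; rewrite /mono_moment /moment.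
  transitivity (\int[sigma]_(x in S) (\sum_(j < (a ord0).+1) (C s j * (shifted_mono t kN (lower_first j a) 0 x * K s x)))).
    apply: eq_Rintegral => x _; rewrite shifted_mono_expand mulr_suml.
    by apply: eq_bigr => j _; rewrite mulrA.
  have iB j : sigma.-integrable (S : set (borel_rV R N)) (EFin \o (fun x => shifted_mono t kN (lower_first j a) 0 x * K s x)).
    by apply: int_fixed.
  rewrite Rintegral_sum//; last first.
    by move=> j; exact: (@integrableZl _ _ _ sigma _ mS (C s j) _ (iB j)).
  by apply: eq_bigr => j _; rewrite (@RintegralZl _ _ _ sigma _ _ (C s j) mS (iB j)).
(* Coefficients and integrals of fixed monomials converge separately. *)
have lim : \sum_(j < (a ord0).+1) C s j * B j s @[s --> 0^'+] -->
   \sum_(j < (a ord0).+1) C 0 j * shifted_mono t kN (lower_first j a) 0 (north_pole t N).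
  apply: cvg_big => [|j _]; first exact: add_continuous.
  apply: cvgM; last exact: integral_at_time0.
  have cC : {for 0, continuous (C ^~ j)}.
    apply: continuousM_fun; first exact: cst_continuous.
    apply: (@continuous_comp _ _ _ (fun s => shift_m 0 N - shift_m s N) (fun x => x ^+ j)).
      by apply: continuousB_fun; [exact: cst_continuous|exact: continuous_shift_m].
    exact: exprn_continuous.
  exact: cvg_at_right_filter cC.
apply: cvg_trans; last first.
  rewrite (_ : _%:R = \sum_(j < (a ord0).+1) C 0 j * shifted_mono t kN (lower_first j a) 0 (north_pole t N)); first exact: lim.
  rewrite big_ord_recl big1 ?addr0; last first.
    by move=> j _; rewrite /C subrr exprS mul0r mulr0 mul0r.
  rewrite /C bin0 expr0 !mul1r shifted_mono_at_pole; congr (_ == _)%:R; congr deg.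
  by apply/funext => i; rewrite /lower_first subn0; case: ifP.
apply: near_eq_cvg; near=> s; apply/esym/E; near: s; exact: nbhs_right_gt.
Unshelve. all: by end_near. Qed.

End initial_moments.

(** * Integration against a measure with a density *)

Section density.
Context d (T : measurableType d) (R : realType).
Variables (nu : {finite_measure set T -> \bar R}) (mu : {sigma_finite_measure set T -> \bar R}).
Variables (D : set T) (w : T -> \bar R).
Hypothesis mD : measurable D.
Hypothesis mw : measurable_fun D w.
Hypothesis nuE : forall A, measurable A -> nu A = (\int[mu]_(x in A `&` D) w x)%E.

(** Domination provides a Radon-Nikodym derivative of nu.  It agrees with w almost everywhere on D,
    which reduces both change of variables formulas below to those for the derivative. *)
Lemma density_dominated : nu `<< mu.
Proof.
apply/null_content_dominatesP => A mA muA0; rewrite nuE//.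
apply: null_set_integral; first exact: measurableI.
- by apply: measurable_funS mw => //; exact: subIsetr.
- by apply: (subset_measure0 _ _ _ muA0) => //; exact: measurableI.
Qed.

Let g := Radon_Nikodym_SigmaFinite.f nu mu.

Let ig : mu.-integrable D g.
Proof.
apply: (integrableS measurableT) => //.
exact: Radon_Nikodym_SigmaFinite.f_integrable density_dominated.
Qed.

Let gw : ae_eq mu D g w.
Proof.
apply: integral_ae_eq => // A AD mA.
rewrite -(Radon_Nikodym_SigmaFinite.f_integral density_dominated)// nuE//.
by rewrite setIidl.
Qed.

Lemma ge0_integral_density (h : T -> \bar R) : (forall x, (0 <= h x)%E) -> measurable_fun D h ->
  (\int[nu]_(x in D) h x = \int[mu]_(x in D) (h x * w x))%E.
Proof.
move=> h0 mh; rewrite -(Radon_Nikodym_SigmaFinite.change_of_variables density_dominated)//.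
apply: ae_eq_integral => //.
- by apply: emeasurable_funM => //; exact: measurable_int ig.
- exact: emeasurable_funM.
- exact: ae_eqe_mul2l.
Qed.

Lemma integral_density (h : T -> \bar R) : nu.-integrable D h ->
  (\int[nu]_(x in D) h x = \int[mu]_(x in D) (h x * w x))%E.
Proof.
move=> ih; have mh := measurable_int _ ih.
rewrite -(Radon_Nikodym_change_of_variables density_dominated)//.
apply: ae_eq_integral => //.
- apply: emeasurable_funM => //; apply: measurable_int.
  apply: (integrableS measurableT) => //.
  by apply: Radon_Nikodym_integrable; exact: density_dominated.
- exact: emeasurable_funM.
- apply: ae_eqe_mul2l; apply: ae_eq_trans gw.
  by apply: ae_eq_sym; apply: ae_eq_Radon_Nikodym_SigmaFinite => //; exact: density_dominated.
Qed.

End density.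

(** * Integrals of polynomials are combinations of moments *)

Definition exponents k (m : mpoly.multinom k) : 'I_k -> nat := mpoly.fun_of_multinom m.

Lemma meval_mono (R : realType) k (f : mpoly.mpoly k R) (v : 'I_k -> R) :
  mpoly.meval v f =
  \sum_(m <- mpoly.msupp f) mpoly.mcoeff m f * mono (exponents m) v.
Proof. exact: mpoly.mevalE. Qed.

Section polynomial_integral.
Variables (R : realType) (t : R) (k' N : nat).
Local Notation k := k'.+1.
Hypothesis t_gt0 : 0 < t.
Hypothesis kN : (k < N)%N.
Local Notation c := (shifted_center t N).
Local Notation r := (Num.sqrt N%:R : R).
Local Notation S := (sphere c r).
Variable sigma : probability (borel_rV R N) R.
Variable K : R -> 'rV[R]_N -> R.
Hypothesis KP : fundamental_solution c r sigma (north_pole t N) K.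
Variable rho : probability (borel_rV R N) R.
Hypothesis rhoE : forall A : set (borel_rV R N), measurable A ->
  rho A = (\int[sigma]_(x in A `&` S) (K t x)%:E)%E.

Let r_gt0 : 0 < r.
Proof. by rewrite sqrtr_gt0 ltr0n; apply: leq_trans kN. Qed.

Let mS : measurable (S : set (borel_rV R N)).
Proof. exact: measurable_sphere. Qed.

(** At the time s = t the translation of the first coordinate by m_t compensates the shift of the
    center. *)
Lemma shifted_mono_coordinate a (x : 'rV[R]_N) :
  shifted_mono t kN a t x = mono a (fun i : 'I_k => coordinate x i).
Proof.
rewrite /shifted_mono /centered_mono; congr mono; apply/funext => i.
have iN : (i < N)%N by apply: ltn_trans kN.
rewrite /coordinate insubT; rewrite !mxE /mean_shift.
rewrite (_ : (val (emb kN i) == 0%N) = (i == ord0))//.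
rewrite (_ : Sub (val i) iN = emb kN i); last by apply/val_inj.
by case: (i == ord0); ring.
Qed.

(** With the density K t of rho, every monomial of f contributes a moment at time t. *)
Lemma integral_poly_moments (f : mpoly.mpoly k R) :
  (\int[rho]_(x in shifted_sphere t N)
    (mpoly.meval (fun i : 'I_k => coordinate x i) f)%:E)%E =
  (\sum_(m <- mpoly.msupp f) mpoly.mcoeff m f * mono_moment t kN sigma K (exponents m) t)%:E.
Proof.
pose g (x : borel_rV R N) : R := \sum_(m <- mpoly.msupp f) mpoly.mcoeff m f * shifted_mono t kN (exponents m) t x.
have gE x : mpoly.meval (fun i : 'I_k => coordinate x i) f = g x.
  by rewrite meval_mono /g; apply: eq_bigr => m _; rewrite shifted_mono_coordinate.
have cg x : {for x, continuous (g : 'rV[R]_N -> R)}.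
  apply: continuous_sum_fun => m; apply: continuousM_fun; first exact: cst_continuous.
  exact: continuous_centered_mono.
have cK x : S x -> {for x, continuous (K t \o retract c r)}.
  move=> xS; apply: (@continuous_slice R N (fun s => K s \o retract c r)).
  exact: (continuous_heat_kernel r_gt0 KP t_gt0 xS).
have mK : measurable_fun (S : set (borel_rV R N)) (fun x : borel_rV R N => (K t x)%:E).
  apply/measurable_EFinP.
  apply: (@eq_measurable_fun _ _ _ _ _ ((K t \o retract c r) : borel_rV R N -> R)).
    by move=> x; rewrite inE => xS /=; rewrite retract_id.
  exact: measurable_on_sphere.
have ig : rho.-integrable (S : set (borel_rV R N)) (EFin \o g).
  by apply: integrable_on_sphere => // x _; exact: cg.
transitivity (\int[rho]_(x in S) (g x)%:E)%E.
  by apply: eq_integral => x _; rewrite gE.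
rewrite (integral_density mS mK rhoE ig).
have imK m : sigma.-integrable (S : set (borel_rV R N)) (EFin \o (fun x => shifted_mono t kN (exponents m) t x * K t x)).
  apply: (@eq_integrable _ _ _ sigma _ mS (EFin \o (fun x => shifted_mono t kN (exponents m) t x * (K t \o retract c r) x))).
    by move=> x; rewrite inE => xS /=; rewrite retract_id.
  apply: integrable_on_sphere => // x xS; apply: continuousM_fun; last exact: cK.
  exact: continuous_centered_mono.
have iZ m : sigma.-integrable (S : set (borel_rV R N)) (EFin \o (fun x => mpoly.mcoeff m f * (shifted_mono t kN (exponents m) t x * K t x))).
  exact: (@integrableZl _ _ _ sigma _ mS _ _ (imK m)).
transitivity (\int[sigma]_(x in S) (\sum_(m <- mpoly.msupp f) mpoly.mcoeff m f * (shifted_mono t kN (exponents m) t x * K t x))%:E)%E.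
  apply: eq_integral => x _; rewrite /= -EFinM mulr_suml; congr EFin.
  by apply: eq_bigr => m _; rewrite mulrA.
have iT := @integrable_Rsum _ _ _ sigma _ mS _ (mpoly.msupp f) _ iZ.
rewrite -[LHS]fineK; last exact: integrable_fin_num iT.
congr EFin; rewrite -[LHS]/(Rintegral _ _ _) Rintegral_sum//.
apply: eq_bigr => m _.
by rewrite (@RintegralZl _ _ _ sigma _ _ _ mS (imK m)).
Qed.

End polynomial_integral.

(** * Gaussian moments and linear comparison *)

Section moment_recursion.
Variable R : realType.

(** The moments of the centered normal distribution with variance v, given by the recursion of
    integration by parts. *)
Fixpoint gauss_moment (n : nat) (v : R) {struct n} : R :=
  match n with
  | 0%N => 1
  | 1%N => 0
  | (n'.+1 as n1).+1 => n1%:R * v * gauss_moment n' v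
  end.

Lemma gauss_momentSS n v : gauss_moment n.+2 v = n.+1%:R * v * gauss_moment n v.
Proof. by []. Qed.

Lemma nat_ind2 (P : nat -> Prop) : P 0%N -> P 1%N -> (forall n, P n -> P n.+2) -> forall n, P n.
Proof.
move=> P0 P1 PS n; suff : P n /\ P n.+1 by case.
by elim: n => // n [h1 h2]; split => //; exact: PS.
Qed.

(** The recursion in a form that also covers n = 0 and n = 1, where n.-2 is truncated. *)
Lemma gauss_moment_mul n v : n%:R * gauss_moment n v = v * (n%:R * (n%:R - 1) * gauss_moment n.-2 v).
Proof.
case: n => [|[|n]]; first by rewrite !mul0r mulr0.
  by rewrite subrr mulr0 mul0r !mulr0.
rewrite gauss_momentSS/= -[n.+2%:R]natr1 addrK; ring.
Qed.

(** The heat equation of the normal distributions: d/dv E[X^n] = E[(X^n)''] / 2. *)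
Lemma is_derive_gauss_moment n (v : R) :
  is_derive v 1 (gauss_moment n) (2^-1 * (n%:R * (n%:R - 1)) * gauss_moment n.-2 v).
Proof.
elim/nat_ind2: n v => [|| n IH] v.
- by rewrite mul0r mulr0 mul0r; exact: is_derive_cst.
- by rewrite subrr !mulr0 mul0r; exact: is_derive_cst.
have h1 : is_derive v 1 (fun v : R => n.+1%:R * v) (n.+1%:R).
  have h0 := is_deriveZ (n.+1%:R : R) (is_derive_id v 1).
  by apply: (is_derive_eq h0); rewrite /GRing.scale/= mulr1.
have h := is_deriveM h1 (IH v).
apply: (is_derive_eq h); rewrite /GRing.scale/=.
have := gauss_moment_mul n v; set x := gauss_moment n.-2 v => e.
transitivity (n.+1%:R * gauss_moment n v + 2^-1 * n.+1%:R * (v * (n%:R * (n%:R - 1) * x))); first by ring.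
by rewrite -e -[n.+2%:R]natr1 -[n.+1%:R]natr1; field.
Qed.

Lemma gauss_moment_at0 n : gauss_moment n 0 = (n == 0%N)%:R.
Proof. by case: n => [|[|n]] //; rewrite gauss_momentSS mulr0 mul0r. Qed.

End moment_recursion.

Section limit_moments.
Variables (R : realType) (k' : nat).
Local Notation k := k'.+1.
Implicit Types (a : 'I_k -> nat) (s : R).

Definition limit_var (i : 'I_k) s : R := if i == ord0 then var_first s else var_other s.

(** The diffusion coefficient of the i-th coordinate in the limit: the coefficient
    1 - m_s^2 / N of the first one tends to 1 - exp(-s). *)
Definition limit_diffusion (i : 'I_k) s : R := if i == ord0 then 1 - expR (- s) else 1.

Definition limit_moment a s : R := \prod_i gauss_moment (a i) (limit_var i s).

(** The variances relax at unit rate towards the diffusion coefficients; this is where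
    1 - exp(-s) - s exp(-s) comes from. *)
Lemma is_derive_limit_var i (s : R) : is_derive s 1 (limit_var i) (limit_diffusion i s - limit_var i s).
Proof.
have h1 : is_derive s 1 (fun s : R => expR (- s)) (- expR (- s)).
  have h0 := is_derive1_comp (is_derive_expR (- s)) (is_deriveN (is_derive_id s 1)).
  by apply: (is_derive_eq h0); rewrite mulrN1.
have h2 : is_derive s 1 (fun s : R => 1 - expR (- s)) (expR (- s)).
  have h0 := is_deriveB (is_derive_cst (1 : R) s 1) h1.
  by apply: (is_derive_eq h0); rewrite sub0r opprK.
rewrite /limit_var /limit_diffusion /var_first /var_other; case: (i == ord0); last first.
  by apply: (is_derive_eq h2); ring.
have h3 := is_deriveB h2 (is_deriveM (is_derive_id s 1) h1).
by apply: (is_derive_eq h3); rewrite /GRing.scale/=; ring.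
Qed.

Lemma limit_moment_dec a i s : \prod_(j | j != i) gauss_moment (a j) (limit_var j s) *
   ((a i)%:R * ((a i)%:R - 1) * gauss_moment (a i).-2 (limit_var i s))
  = (a i)%:R * ((a i)%:R - 1) * limit_moment (dec i (dec i a)) s.
Proof.
rewrite /limit_moment [in RHS](bigD1 i)//= /dec eqxx !subn1.
rewrite (eq_bigr (fun j => gauss_moment (a j - (j == i) - (j == i))%N (limit_var j s))); first by ring.
by move=> j /negbTE ->; rewrite !subn0.
Qed.

Lemma limit_moment_mul a i s :
  (a i)%:R * limit_moment a s = limit_var i s * ((a i)%:R * ((a i)%:R - 1) * limit_moment (dec i (dec i a)) s).
Proof.
rewrite -limit_moment_dec mulrCA -gauss_moment_mul /limit_moment (bigD1 i)//=; ring.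
Qed.

(** The limit of the differential equations of the moments: decay at rate |a|/2, no term of degree
    |a| - 1, and the diffusion terms. *)
Lemma is_derive_limit_moment a (s : R) : is_derive s 1 (limit_moment a)
  (- ((deg a)%:R / 2) * limit_moment a s
   + \sum_i 2^-1 * limit_diffusion i s * ((a i)%:R * ((a i)%:R - 1)) * limit_moment (dec i (dec i a)) s).
Proof.
have h i : is_derive s 1 (fun s => gauss_moment (a i) (limit_var i s))
    (2^-1 * ((a i)%:R * ((a i)%:R - 1)) * gauss_moment (a i).-2 (limit_var i s) * (limit_diffusion i s - limit_var i s)).
  exact: (is_derive1_comp (is_derive_gauss_moment (a i) (limit_var i s)) (is_derive_limit_var i s)).
apply: (is_derive_eq (is_derive_prod h)).
rewrite /deg natr_sum mulr_suml -sumrN mulr_suml -big_split/=.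
apply: eq_bigr => i _.
transitivity (2^-1 * (limit_diffusion i s - limit_var i s) * ((a i)%:R * ((a i)%:R - 1) * limit_moment (dec i (dec i a)) s)).
  rewrite -limit_moment_dec; ring.
rewrite mulrBr mulrBl -[X in _ - X]mulrA -limit_moment_mul; ring.
Qed.

Lemma continuous_limit_moment a : continuous (limit_moment a).
Proof.
move=> s; apply: differentiable_continuous; apply/derivable1_diffP.
by have [] := is_derive_limit_moment a s.
Qed.

Lemma limit_moment_at0 a : limit_moment a 0 = (deg a == 0%N)%:R.
Proof.
have v0 i : limit_var i 0 = 0 :> R.
  by rewrite /limit_var /var_first /var_other oppr0 expR0 mul0r subr0 subrr if_same.
rewrite /limit_moment; under eq_bigr do rewrite v0 gauss_moment_at0.
have [da|da] := eqVneq (deg a) 0%N.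
  by apply: big1 => i _; rewrite (deg_eq0 da) eqxx.
have [i ai] : exists i, a i != 0%N.
  apply/existsP; apply: contraNT da; rewrite negb_exists => /forallP h.
  by rewrite /deg sum_nat_eq0; apply/forallP => i; have := h i; rewrite negbK.
by rewrite (bigD1 i)//= (negbTE ai) mul0r.
Qed.

End limit_moments.

Section comparison.
Variable R : realType.

(** With l >= 0, the function exp(l s) (D s - e s) is nonincreasing and tends to 0 at 0. *)
Lemma linear_comparison (D E : R -> R) (l e t : R) :
  0 <= l -> 0 <= e -> (forall s : R, 0 < s -> s <= t -> is_derive s 1 D (- l * D s + E s)) ->
  (forall s : R, 0 < s -> s <= t -> E s <= e) -> D s @[s --> 0^'+] --> (0 : R) ->
  forall s : R, 0 < s -> s <= t -> D s <= e * s.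
Proof.
move=> l0 e0 dD hE D0 s s0 st.
pose h (x : R) := expR (l * x) * (D x - e * x).
have dexp (x : R) : is_derive x 1 (fun x : R => expR (l * x)) (l * expR (l * x)).
  have h1 := is_deriveZ l (is_derive_id x 1).
  have h2 : is_derive x 1 (fun x : R => l * x) l.
    by apply: (is_derive_eq h1); rewrite /GRing.scale/= mulr1.
  by apply: (is_derive_eq (is_derive1_comp (is_derive_expR _) h2)); rewrite mulrC.
have dh (x : R) : 0 < x -> x <= t -> is_derive x 1 h (expR (l * x) * (E x - e - l * e * x)).
  move=> x0 xt; have h1 := is_deriveZ e (is_derive_id x 1).
  have h2 := is_deriveM (dexp x) (is_deriveB (dD x x0 xt) h1).
  apply: (is_derive_eq h2); rewrite /GRing.scale/= !fctE.
  rewrite (_ : (e \*: id) x = e * x)//; ring.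
have cexp : {for 0, continuous (fun x : R => expR (l * x))}.
  by apply: differentiable_continuous; apply/derivable1_diffP; have [] := dexp 0.
have h0 : h x @[x --> 0^'+] --> (0 : R).
  rewrite [X in _ --> X](_ : _ = expR (l * 0) * (0 - e * 0)); last by rewrite !mulr0 subr0 mulr0.
  apply: cvgM; first exact: cvg_at_right_filter cexp.
  apply: cvgB => //; apply: cvgM; first exact: cvg_cst.
  by apply: cvg_at_right_filter; exact: cvg_id.
have hs : h s <= 0.
  rewrite -(cvg_lim _ h0)//; apply: limr_ge; first by apply/cvg_ex; exists 0.
  near=> x.
  have x0 : 0 < x by near: x; exact: nbhs_right_gt.
  have xs : x < s by near: x; exact: nbhs_right_lt.
  apply: (@ler0_derive1_le_cc _ h x s).
  - move=> y; rewrite in_itv/= => /andP[xy ys].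
    by have [] := dh y (lt_trans x0 xy) (le_trans (ltW ys) st).
  - move=> y; rewrite in_itv/= => /andP[xy ys].
    rewrite derive1E; have [_ ->] := dh y (lt_trans x0 xy) (le_trans (ltW ys) st).
    rewrite pmulr_rle0 ?expR_gt0//.
    have := hE y (lt_trans x0 xy) (le_trans (ltW ys) st).
    have : 0 <= l * e * y by rewrite !mulr_ge0// ltW// (lt_trans x0 xy).
    lra.
  - apply: derivable_within_continuous => y; rewrite in_itv/= => /andP[xy ys].
    by have [] := dh y (lt_le_trans x0 xy) (le_trans ys st).
  - by rewrite in_itv/= lexx ltW.
  - by rewrite in_itv/= lexx ltW.
  - exact: ltW.
by move: hs; rewrite /h pmulr_rle0 ?expR_gt0// subr_le0.
Unshelve. all: by end_near. Qed.

Lemma linear_comparison_norm (D E : R -> R) (l e t : R) :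
  0 <= l -> 0 <= e -> (forall s : R, 0 < s -> s <= t -> is_derive s 1 D (- l * D s + E s)) ->
  (forall s : R, 0 < s -> s <= t -> `|E s| <= e) -> D s @[s --> 0^'+] --> (0 : R) ->
  forall s : R, 0 < s -> s <= t -> `|D s| <= e * s.
Proof.
move=> l0 e0 dD hE D0 s s0 st; rewrite ler_norml; apply/andP; split; last first.
  apply: (linear_comparison l0 e0 dD _ D0) => // x x0 xt.
  exact: le_trans (ler_norm _) (hE x x0 xt).
rewrite lerNl; apply: (@linear_comparison (fun x => - D x) (fun x => - E x) l e t) => //.
- move=> x x0 xt; apply: (is_derive_eq (is_deriveN (dD x x0 xt))); ring.
- by move=> x x0 xt; apply: le_trans (hE x x0 xt); rewrite -normrN ler_norm.
- by rewrite -[X in _ --> X]oppr0; apply: cvgN.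
Qed.

End comparison.

(** * Uniform convergence on bounded time intervals *)

Section uniform_convergence.
Variables (R : realType) (t : R).

(** Uniform convergence on ]0, t].  Time 0 is excluded because the moments are only controlled for
    positive times. *)
Definition unif_cvg (f : nat -> R -> R) (g : R -> R) := forall e : R, 0 < e ->
  \forall n \near \oo, forall s : R, 0 < s -> s <= t -> `|f n s - g s| <= e.

Definition bounded_upto (g : R -> R) := exists2 B : R, 0 <= B & forall s, 0 < s -> s <= t -> `|g s| <= B.

Lemma continuous_bounded_upto g : continuous g -> bounded_upto g.
Proof.
move=> cg.
have cw : {within `[0, t], continuous g} by exact: continuous_subspaceT.
have /compact_bounded[M [_ hM]] := continuous_compact cw (@segment_compact R 0 t).
exists (`|M| + 1); first by rewrite addr_ge0.
move=> s s0 st; apply: (hM (`|M| + 1)); last first.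
  by exists s => //; rewrite /= in_itv/= (ltW s0).
by rewrite ltr_pwDr// ler_norm.
Qed.

Lemma unif_cvg_cst g : unif_cvg (fun=> g) g.
Proof. by move=> e e0; near=> n => s _ _; rewrite subrr normr0 ltW.
Unshelve. all: by end_near. Qed.

Lemma unif_cvg_ext f g f' g' : (forall n s, f n s = f' n s) -> (forall s, g s = g' s) ->
  unif_cvg f g -> unif_cvg f' g'.
Proof.
move=> ff gg u e e0; have := u e e0; apply: filterS => n h s s0 st.
by rewrite -ff -gg; exact: h.
Qed.

Lemma unif_cvgD f g f' g' : unif_cvg f g -> unif_cvg f' g' ->
  unif_cvg (fun n s => f n s + f' n s) (fun s => g s + g' s).
Proof.
move=> u u' e e0; have e20 : 0 < e / 2 by rewrite divr_gt0.
have := u' _ e20; have := u _ e20; apply: filterS2 => n h h' s s0 st.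
rewrite (_ : _ - _ = (f n s - g s) + (f' n s - g' s)); last by ring.
by rewrite (le_trans (ler_normD _ _))// [leRHS]splitr lerD ?h ?h'.
Qed.

Lemma unif_cvgM f g f' g' : bounded_upto g -> bounded_upto g' -> unif_cvg f g -> unif_cvg f' g' ->
  unif_cvg (fun n s => f n s * f' n s) (fun s => g s * g' s).
Proof.
move=> [B B0 hB] [B' B'0 hB'] u u' e e0.
have d0 : 0 < Num.min 1 (e / (B + B' + 1)).
  by rewrite lt_min ltr01 divr_gt0// ltr_wpDl// addr_ge0.
set d := Num.min _ _ in d0.
have d1 : d <= 1 by rewrite /d ge_min lexx.
have de : d * (B + B' + 1) <= e.
  by rewrite -ler_pdivlMr ?ltr_wpDl ?addr_ge0// /d ge_min lexx orbT.
have := u' _ d0; have := u _ d0; apply: filterS2 => n h h' s s0 st.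
rewrite (_ : _ - _ = (f n s - g s) * (f' n s - g' s) + (f n s - g s) * g' s + g s * (f' n s - g' s)); last by ring.
have a1 := h s s0 st; have a2 := h' s s0 st; have b1 := hB s s0 st; have b2 := hB' s s0 st.
apply: le_trans de; rewrite (le_trans (ler_normD _ _))//.
rewrite (_ : d * _ = (d * 1 + d * B') + B * d); last by ring.
apply: lerD; last by rewrite normrM; apply: ler_pM.
rewrite (le_trans (ler_normD _ _))//; apply: lerD; rewrite normrM; apply: ler_pM => //.
exact: le_trans d1.
Qed.

Lemma unif_cvg_sum (I : Type) (l : seq I) (f : I -> nat -> R -> R) (g : I -> R -> R) :
  (forall i, unif_cvg (f i) (g i)) ->
  unif_cvg (fun n s => \sum_(i <- l) f i n s) (fun s => \sum_(i <- l) g i s).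
Proof.
move=> u; elim: l => [|i l IH].
  by apply: (unif_cvg_ext _ _ (unif_cvg_cst (fun=> 0))) => [n s|s]; rewrite big_nil.
by apply: (unif_cvg_ext _ _ (unif_cvgD (u i) IH)) => [n s|s]; rewrite big_cons.
Qed.

Lemma unif_cvgN f g : unif_cvg f g -> unif_cvg (fun n s => - f n s) (fun s => - g s).
Proof.
move=> u e e0; have := u _ e0; apply: filterS => n h s s0 st.
by rewrite -opprD normrN; exact: h.
Qed.

Lemma unif_cvg_const (u : nat -> R) (l : R) : u @ \oo --> l -> unif_cvg (fun n _ => u n) (fun=> l).
Proof.
move=> /cvgrPdist_le ul e e0; have := ul _ e0; apply: filterS => n h s _ _.
by rewrite distrC.
Qed.

End uniform_convergence.

Lemma cvg_invn (R : realType) : (n%:R : R)^-1 @[n --> \oo] --> (0 : R).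
Proof.
have n0 : \forall n \near \oo, 0 < n%:R :> R.
  by near=> n; rewrite ltr0n; near: n; exact: nbhs_infty_gt.
exact: (gtr0_cvgV0 n0).2 cvgr_idn.
Unshelve. all: by end_near. Qed.

Section shift_asymptotics.
Variables (R : realType) (t : R).

(** The correction 1/N in the definition of shift_m only contributes the factor exp(s/N). *)
Lemma sqr_shift_m (N : nat) (s : R) : (0 < N)%N ->
  shift_m s N ^+ 2 / N%:R = expR (- s) * expR (s / N%:R).
Proof.
move=> N0; have n0 : N%:R != 0 :> R by rewrite pnatr_eq0 -lt0n.
rewrite /shift_m exprMn sqr_sqrtr// -expRM_natl -expRD mulrAC divff// mul1r.
congr expR; field; exact: n0.
Qed.

Lemma unif_cvg_sqr_shift_m : unif_cvg t (fun N s => shift_m s N ^+ 2 / N%:R) (fun s => expR (- s)).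
Proof.
move=> e e0.
have lim : expR (t / n%:R) @[n --> \oo] --> (1 : R).
  rewrite -[X in _ --> X]expR0; apply: continuous_cvg; first exact: continuous_expR.
  rewrite [X in _ --> X](_ : _ = t * 0); last by rewrite mulr0.
  by apply: cvgM; [exact: cvg_cst|exact: cvg_invn].
have /cvgrPdist_le/(_ _ e0) := lim.
apply: filter_app; near=> n => h s s0 st.
have n0 : (0 < n)%N by near: n; exact: nbhs_infty_gt.
have n0R : 0 < n%:R :> R by rewrite ltr0n.
rewrite sqr_shift_m// -[X in _ - X]mulr1 -mulrBr normrM.
rewrite ger0_norm ?expR_ge0// -[leRHS]mul1r ler_pM ?expR_ge0//.
  by rewrite -expR0 ler_expR oppr_le0 ltW.
apply: le_trans h; rewrite [leRHS]distrC.
have e1 : 1 <= expR (s / n%:R) by rewrite -expR0 ler_expR divr_ge0// ltW.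
have e2 : expR (s / n%:R) <= expR (t / n%:R) by rewrite ler_expR ler_pM2r ?invr_gt0.
by rewrite !ger0_norm ?subr_ge0 ?lerB// (le_trans e1).
Unshelve. all: by end_near. Qed.

Lemma unif_cvg_shift_m_div : unif_cvg t (fun N s => shift_m s N / N%:R) (fun=> 0).
Proof.
move=> e e0.
have lim : (n%:R : R)^-1 @[n --> \oo] --> (0 : R).
  exact: cvg_invn.
have e20 : 0 < e ^+ 2 by rewrite exprn_gt0.
have /cvgrPdist_le/(_ _ e20) := lim.
apply: filter_app; near=> n => h s s0 st.
have n0 : (0 < n)%N by near: n; exact: nbhs_infty_gt.
have n0R : 0 < n%:R :> R by rewrite ltr0n.
rewrite subr0 -(ler_pXn2r (n := 2)) ?nnegrE ?(ltW e0)// real_normK ?num_real//.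
apply: le_trans h; rewrite sub0r normrN ger0_norm ?invr_ge0 ?(ltW n0R)//.
rewrite (_ : _ ^+ 2 = (shift_m s n ^+ 2 / n%:R) * n%:R^-1); last by field; rewrite gt_eqF.
rewrite sqr_shift_m// -[leRHS]mul1r ler_pM2r ?invr_gt0// -expRD -[leRHS]expR0 ler_expR.
rewrite addrC subr_le0 ler_pdivrMr// ler_peMr ?(ltW s0)// ler1n//.
Unshelve. all: by end_near. Qed.

End shift_asymptotics.

(** * Convergence of the moments *)

Section moment_limit.
Variables (R : realType) (t : R) (k' : nat).
Local Notation k := k'.+1.
Variable mom : nat -> ('I_k -> nat) -> R -> R.
Hypothesis mom_ode : forall N, (k < N)%N -> forall a (s : R), 0 < s ->
  is_derive s 1 (mom N a) (- decay_rate R N a * mom N a s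
    - shift_m s N / N%:R * ((deg a)%:R - 1) * (a ord0)%:R * mom N (dec ord0 a) s
    + \sum_i (2^-1 * (1 - (if i == ord0 then shift_m s N ^+ 2 / N%:R else 0))
        * ((a i)%:R * ((a i)%:R - 1))) * mom N (dec i (dec i a)) s).
Hypothesis mom_init : forall N, (k < N)%N -> forall a,
  mom N a s @[s --> 0^'+] --> ((deg a == 0%N)%:R : R).

Lemma deg_dec_lt (a : 'I_k -> nat) i : (0 < a i)%N -> (deg (dec i a) < deg a)%N.
Proof. by move=> /deg_dec ->. Qed.

Lemma bounded_const (c : R) : bounded_upto t (fun=> c).
Proof. by exists `|c|. Qed.

Lemma cvg_decay_rate (a : 'I_k -> nat) : decay_rate R N a @[N --> \oo] --> ((deg a)%:R / 2 : R).
Proof.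
pose d : R := (deg a)%:R.
have h : d / 2 * (1 + (d - 2) * (N%:R)^-1) @[N --> \oo] --> (d / 2 * (1 + (d - 2) * 0) : R).
  apply: cvgM; first exact: cvg_cst.
  apply: cvgD; first exact: cvg_cst.
  by apply: cvgM; [exact: cvg_cst|exact: cvg_invn].
rewrite mulr0 addr0 mulr1 in h; apply: cvg_trans h; apply: near_eq_cvg.
near=> n; have n0 : n%:R != 0 :> R.
  by rewrite pnatr_eq0 -lt0n; near: n; exact: nbhs_infty_gt.
by rewrite /decay_rate -/d; field.
Unshelve. all: by end_near. Qed.

Lemma bounded_limit_diffusion (i : 'I_k) : bounded_upto t (limit_diffusion i : R -> R).
Proof.
apply: continuous_bounded_upto; rewrite /limit_diffusion; case: (i == ord0); last exact: cst_continuous.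
move=> s; have c1 : {for s, continuous (fun s : R => expR (- s))}.
  apply: (@continuous_comp _ _ _ -%R expR); last exact: continuous_expR.
  exact: oppr_continuous.
have c2 : {for s, continuous (fun _ : R => 1 : R)} by exact: cst_continuous.
exact: (continuousB_fun c2 c1).
Qed.

(** Induction on the degree: the difference of M_a and its limit solves a linear equation with
    decay, whose forcing term tends to 0 uniformly because the lower moments and the coefficients converge
    uniformly, and it starts at 0. *)
Lemma moments_limit a : unif_cvg t (fun N => mom N a) (limit_moment a).
Proof.
have [n] := ubnP (deg a); elim: n a => // n IH a; rewrite ltnS => an.
have bG (b : 'I_k -> nat) : bounded_upto t (limit_moment b).
  by apply: continuous_bounded_upto; exact: continuous_limit_moment.
pose w N i (s : R) : R := 2^-1 * (1 - (if i == ord0 then shift_m s N ^+ 2 / N%:R else 0)) * ((a i)%:R * ((a i)%:R - 1)).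
pose A N (s : R) : R := shift_m s N / N%:R * ((deg a)%:R - 1) * (a ord0)%:R * mom N (dec ord0 a) s.
(* The forcing term in the equation of M_a minus its limit: the error in the decay rate times the
   limit, the first order term, and the difference of the diffusion terms. *)
pose E N (s : R) : R := (decay_rate R N a + - ((deg a)%:R / 2)) * - limit_moment a s + - A N s
  + ((\sum_i w N i s * mom N (dec i (dec i a)) s)
     - \sum_i 2^-1 * limit_diffusion i s * ((a i)%:R * ((a i)%:R - 1)) * limit_moment (dec i (dec i a)) s).
have uA : unif_cvg t A (fun=> 0).
  have [a0|a0] := posnP (a ord0).
    by apply: (unif_cvg_ext _ _ (unif_cvg_cst t (fun=> 0))) => // N s; rewrite /A a0 mulr0 mul0r.
  have u1 : unif_cvg t (fun N s => mom N (dec ord0 a) s) (limit_moment (dec ord0 a)).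
    by apply: IH; apply: leq_trans an; exact: deg_dec_lt.
  have u2 := unif_cvgM (bounded_const 0) (bounded_const (((deg a)%:R - 1) * (a ord0)%:R)) (@unif_cvg_shift_m_div R t) (unif_cvg_cst t (fun=> ((deg a)%:R - 1) * (a ord0)%:R)).
  have b2 : bounded_upto t (fun=> 0 * (((deg a)%:R - 1) * (a ord0)%:R)) by exact: bounded_const.
  apply: (unif_cvg_ext _ _ (unif_cvgM b2 (bG _) u2 u1)) => [N s|s].
    by rewrite /A !mulrA.
  by rewrite !mul0r.
have uW i : unif_cvg t (fun N s => w N i s * mom N (dec i (dec i a)) s)
   (fun s => 2^-1 * limit_diffusion i s * ((a i)%:R * ((a i)%:R - 1)) * limit_moment (dec i (dec i a)) s).
  (* If a i <= 1 the coefficient is 0, whatever the moment of the truncated index; otherwise the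
     degree drops by two. *)
  have [c0|ai] := leqP (a i) 1.
    have z : (a i)%:R * ((a i)%:R - 1) = 0 :> R.
      by move: c0; case: (a i) => [|[|//]] _; rewrite ?mul0r// subrr mulr0.
    by apply: (unif_cvg_ext _ _ (unif_cvg_cst t (fun=> 0))) => [N s|s]; rewrite /w z mulr0 mul0r.
  have u1 : unif_cvg t (fun N s => mom N (dec i (dec i a)) s) (limit_moment (dec i (dec i a))).
    apply: IH; apply: leq_trans an; apply: ltn_trans (deg_dec_lt (ltnW ai)).
    by apply: deg_dec_lt; rewrite /dec eqxx subn_gt0.
  have uL : unif_cvg t (fun N s => 1 + - (if i == ord0 then shift_m s N ^+ 2 / N%:R else 0)) (limit_diffusion i).
    rewrite /limit_diffusion; case: (i == ord0).
      exact: (unif_cvgD (unif_cvg_cst t (fun=> 1)) (unif_cvgN (@unif_cvg_sqr_shift_m R t))).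
    by apply: (unif_cvg_ext _ _ (unif_cvg_cst t (fun=> 1))) => // N s; rewrite oppr0 addr0.
  pose q : R := 2^-1 * ((a i)%:R * ((a i)%:R - 1)).
  have u2 := unif_cvgM (bounded_const q) (bounded_limit_diffusion i) (unif_cvg_cst t (fun=> q)) uL.
  have b2 : bounded_upto t (fun s => q * limit_diffusion i s).
    have [B B0 hB] := bounded_limit_diffusion i; exists (`|q| * B); first exact: mulr_ge0.
    by move=> s s0 st; rewrite normrM ler_wpM2l// hB.
  apply: (unif_cvg_ext _ _ (unif_cvgM b2 (bG _) u2 u1)) => [N s|s]; rewrite /q /w; ring.
have uE : unif_cvg t E (fun=> 0).
  have u1 := unif_cvgD (unif_cvg_const t (@cvg_decay_rate a)) (unif_cvg_cst t (fun=> - ((deg a)%:R / 2))).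
  have bNG : bounded_upto t (fun s => - limit_moment a s).
    by have [B B0 hB] := bG a; exists B => // s s0 st; rewrite normrN; exact: hB.
  have bz : bounded_upto t (fun=> (deg a)%:R / 2 + - ((deg a)%:R / 2)) by exact: bounded_const.
  have u2 := unif_cvgM bz bNG u1 (unif_cvg_cst t (fun s => - limit_moment a s)).
  have u3 := unif_cvg_sum (index_enum 'I_k) uW.
  have u4 := unif_cvgD u3 (unif_cvg_cst t (fun s => - \sum_i 2^-1 * limit_diffusion i s * ((a i)%:R * ((a i)%:R - 1)) * limit_moment (dec i (dec i a)) s)).
  apply: (unif_cvg_ext _ _ (unif_cvgD (unif_cvgD u2 (unif_cvgN uA)) u4)) => [N s|s]; first by [].
  by rewrite /= !subrr mul0r oppr0 !addr0.
move=> e e0.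
have t1 : 0 < `|t| + 1 by rewrite ltr_wpDl.
have e1 : 0 < e / (`|t| + 1) by rewrite divr_gt0.
have := uE _ e1; apply: filter_app; near=> N => hE s s0 st.
have kN : (k < N)%N by near: N; exact: nbhs_infty_gt.
have N0 : 0 < N%:R :> R by rewrite ltr0n (leq_trans _ kN).
have N1 : 2 <= N%:R :> R by rewrite ler_nat (leq_trans _ kN).
have l0 : 0 <= decay_rate R N a.
  rewrite /decay_rate divr_ge0 ?mulr_ge0//; have : 0 <= (deg a)%:R :> R by []; lra.
have dD (x : R) : 0 < x -> x <= t ->
   is_derive x 1 (fun s => mom N a s - limit_moment a s) (- decay_rate R N a * (mom N a x - limit_moment a x) + E N x).
  move=> x0 xt; apply: (is_derive_eq (is_deriveB (mom_ode kN a x0) (is_derive_limit_moment a x))).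
  rewrite /E /A /w.
  move: (\sum_i _ * mom _ _ _) (\sum_i _ * limit_moment _ _) => X Y.
  ring.
have D0 : mom N a s - limit_moment a s @[s --> 0^'+] --> (0 : R).
  have h := cvg_at_right_filter (@continuous_limit_moment R k' a (0 : R)).
  rewrite limit_moment_at0 in h; rewrite -[X in _ --> X](subrr ((deg a == 0%N)%:R : R)).
  by apply: cvgB => //; by apply: mom_init.
have := @linear_comparison_norm R (fun s => mom N a s - limit_moment a s) (E N) (decay_rate R N a) (e / (`|t| + 1)) t l0 (ltW e1) dD _ D0 s s0 st.
move=> /(_ _) h; apply: le_trans (h _) _.
  by move=> x x0 xt; have := hE x x0 xt; rewrite subr0.
rewrite mulrAC ler_pdivrMr// ler_wpM2l ?(ltW e0)//.
by rewrite (le_trans st)// (le_trans (ler_norm t))// lerDl.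
Unshelve. all: by end_near. Qed.

End moment_limit.

(** * Moments of the normal density *)

Section gauss_one.
Variables (R : realType).
Notation mu := (@lebesgue_measure R).

(** The fundamental theorem of calculus on [-n, n], and dominated convergence. *)
Lemma integral_derivative0 (F f : R -> R) :
  (forall x : R, is_derive x 1 F (f x)) -> continuous f ->
  mu.-integrable setT (EFin \o f) ->
  F n%:R @[n --> \oo] --> (0 : R) -> F (- n%:R) @[n --> \oo] --> (0 : R) ->
  \int[mu]_x f x = 0.
Proof.
move=> dF cf intf F0 F0'.
have mf : measurable_fun setT f by exact: continuous_measurable_fun.
have dF1 : derive1 F = f.
  by apply/funext => x; rewrite derive1E; have [_ ->] := dF x.
have cF : continuous F.
  move=> x; apply: differentiable_continuous; apply/derivable1_diffP.
  by have [] := dF x.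
pose fn (n : nat) : R -> \bar R := (EFin \o f) \_ `[- n%:R, n%:R].
have e1 n : (0 < n)%N -> (\int[mu]_x fn n x = (F n%:R - F (- n%:R))%:E)%E.
  move=> n0; rewrite -integral_mkcond EFinB.
  apply: continuous_FTC2.
  - by rewrite (@lt_trans _ _ 0)// ?oppr_lt0 ltr0n.
  - exact: continuous_subspaceT.
  - split.
    + by move=> x _; have [] := dF x.
    + by apply: cvg_at_right_filter; exact: cF.
    + by apply: cvg_at_left_filter; exact: cF.
  - by move=> x _; rewrite dF1.
have c1 n : measurable_fun setT (fn n).
  apply: (measurable_restrictT _ _).1; first exact: measurable_itv.
  by apply/measurable_EFinP; exact: measurable_funTS.
have c2 : measurable_fun setT (EFin \o f) by exact/measurable_EFinP.
have c3 : {ae mu, forall x, setT x -> fn ^~ x @ \oo --> (EFin \o f) x}.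
  apply: aeW => x _; apply: cvg_near_cst; near=> n.
  rewrite /fn patchE mem_set//= in_itv/= -ler_norml.
  by near: n; exact: nbhs_infty_ger.
have c4 : mu.-integrable setT (abse \o (EFin \o f)) by exact: integrable_abse.
have c5 : {ae mu, forall x n, setT x -> (`|fn n x| <= (abse \o (EFin \o f)) x)%E}.
  apply: aeW => x n _; rewrite /fn patchE; case: ifP => _ //=.
  by rewrite lee_fin normr0.
have [_ _ h] := @dominated_convergence _ _ _ mu setT measurableT fn (EFin \o f) (abse \o (EFin \o f)) c1 c2 c3 c4 c5.
have lim1 : (\int[mu]_x fn n x)%E @[n --> \oo] --> (0%:E : \bar R).
  have h2 : ((F n%:R - F (- n%:R))%:E : \bar R) @[n --> \oo] --> (0%:E : \bar R).
    apply: cvg_EFin; first by near=> n.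
    rewrite -[X in _ --> X](subrr (0 : R)).
    exact: (cvgB F0 F0').
  apply: cvg_trans h2; apply: near_eq_cvg; near=> n; apply/esym/e1.
  by near: n; exact: nbhs_infty_gt.
rewrite /Rintegral -[RHS]/(fine (0%:E : \bar R)); congr fine.
exact: (cvg_unique _ h lim1).
Unshelve. all: by end_near. Qed.

Definition centered_pdf (v x : R) : R := (Num.sqrt (2 * pi * v))^-1 * expR (- (x ^+ 2 / (2 * v))).

Lemma centered_pdfE (v : R) : 0 < v -> centered_pdf v = normal_pdf 0 (Num.sqrt v).
Proof.
move=> v0; rewrite normal_pdfE ?gt_eqF ?sqrtr_gt0//; apply/funext => x.
rewrite /centered_pdf /normal_peak /normal_fun subr0 sqr_sqrtr ?(ltW v0)//.
congr (_^-1 * expR _); last by rewrite -mulNr -[in RHS]mulr_natl.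
by congr Num.sqrt; rewrite -mulr_natl; ring.
Qed.

Lemma centered_pdf_ge0 v x : 0 <= centered_pdf v x.
Proof. by rewrite mulr_ge0 ?invr_ge0 ?expR_ge0. Qed.

Lemma continuous_centered_pdf v : 0 < v -> continuous (centered_pdf v).
Proof. by move=> v0; rewrite centered_pdfE//; apply: continuous_normal_pdf; rewrite gt_eqF// sqrtr_gt0. Qed.

Lemma integrable_centered_pdf v : 0 < v -> mu.-integrable setT (EFin \o centered_pdf v).
Proof. by move=> v0; rewrite centered_pdfE//; exact: integrable_normal_pdf. Qed.

Lemma integral_centered_pdf v : 0 < v -> \int[mu]_x centered_pdf v x = 1.
Proof. by move=> v0; rewrite centered_pdfE// /Rintegral integral_normal_pdf. Qed.

Lemma exprn_le_expR (m : nat) (y : R) : 0 <= y -> y ^+ m <= m%:R ^+ m * expR y.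
Proof.
move=> y0; case: m => [|m].
  by rewrite !expr0 mul1r -expR0 ler_expR.
have m0 : 0 < m.+1%:R :> R by rewrite ltr0n.
have -> : y = m.+1%:R * (y / m.+1%:R) by rewrite mulrC divfK// gt_eqF.
rewrite exprMn ler_pM2l ?exprn_gt0// expRM_natl ler_pXn2r ?nnegrE ?expR_ge0//.
  by apply: le_trans (expR_ge1Dx _); rewrite lerDr.
by rewrite divr_ge0.
Qed.

(** Half of the Gaussian decay absorbs any power of |x|, leaving the density with twice the
    variance, whose integrability is known. *)
Lemma centered_pdf_bound (v : R) m : 0 < v -> exists2 C : R, 0 <= C & forall x, `|x| ^+ m * centered_pdf v x <= C * centered_pdf (2 * v) x.
Proof.
move=> v0.
pose c := (1 + (4 * v) ^+ m * m%:R ^+ m).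
have c0 : 0 <= c by rewrite addr_ge0// mulr_ge0// exprn_ge0// mulr_ge0// ltW.
have s0 : 0 < Num.sqrt (2 * pi * v) by rewrite sqrtr_gt0 !mulr_gt0// pi_gt0.
have s1 : 0 < Num.sqrt (2 * pi * (2 * v)) by rewrite sqrtr_gt0 !mulr_gt0// pi_gt0.
exists (c * (Num.sqrt (2 * pi * (2 * v)) / Num.sqrt (2 * pi * v))).
  by rewrite mulr_ge0// divr_ge0// ltW.
move=> x; pose y := x ^+ 2 / (4 * v).
have v40 : 0 < 4 * v by rewrite mulr_gt0.
have y0 : 0 <= y by rewrite divr_ge0 ?sqr_ge0// ltW.
rewrite /centered_pdf.
rewrite (_ : x ^+ 2 / (2 * v) = y + y); last by rewrite /y; field; rewrite gt_eqF.
rewrite (_ : x ^+ 2 / (2 * (2 * v)) = y); last by rewrite /y; congr (_ / _); ring.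
rewrite [leRHS](_ : _ = (Num.sqrt (2 * pi * v))^-1 * (c * expR (- y))); last first.
  by field; rewrite !gt_eqF.
rewrite mulrCA ler_pM2l ?invr_gt0// opprD expRD mulrA ler_pM2r ?expR_gt0//.
rewrite expRN ler_pdivrMr ?expR_gt0//.
have e1 : 1 <= expR y by rewrite -expR0 ler_expR.
have h : `|x| ^+ m <= 1 + (x ^+ 2) ^+ m.
  have q : `|x| ^+ m <= 1 + (`|x| ^+ m) ^+ 2 by set a := _ ^+ m; nra.
  by apply: (le_trans q); rewrite -exprM mulnC exprM real_normK ?num_real.
apply: (le_trans h); rewrite /c mulrDl mul1r lerD//.
rewrite (_ : x ^+ 2 = (4 * v) * y); last by rewrite /y mulrC divfK// gt_eqF.
by rewrite exprMn -mulrA ler_pM2l ?exprn_gt0// exprn_le_expR.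
Qed.

Lemma measurable_exprM_centered_pdf (v : R) m : 0 < v -> measurable_fun setT (fun x : R => x ^+ m * centered_pdf v x).
Proof.
move=> v0; apply: measurable_funM; first exact: measurable_funX.
exact: continuous_measurable_fun (continuous_centered_pdf v0).
Qed.

Lemma integrable_gauss_moment (v : R) m : 0 < v -> mu.-integrable setT (EFin \o (fun x : R => x ^+ m * centered_pdf v x)).
Proof.
move=> v0; have [C C0 hC] := centered_pdf_bound m v0.
have v20 : 0 < 2 * v by rewrite mulr_gt0.
apply: (@le_integrable _ _ _ mu _ measurableT _ (EFin \o (fun x => C * centered_pdf (2 * v) x))).
- by apply/measurable_EFinP; exact: measurable_exprM_centered_pdf.
- move=> x _ /=; rewrite lee_fin normrM normrX [in leLHS](ger0_norm (centered_pdf_ge0 _ _)).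
  by apply: (le_trans (hC x)); rewrite ler_norm.
- exact: (@integrableZl _ _ _ mu _ measurableT C _ (integrable_centered_pdf v20)).
Qed.

Lemma is_derive_centered_pdf (v : R) (x : R) : 0 < v -> is_derive x 1 (centered_pdf v) (- (x / v) * centered_pdf v x).
Proof.
move=> v0.
have h1 : is_derive x 1 (fun x : R => - (x ^+ 2 / (2 * v))) (- (x / v)).
  rewrite (_ : (fun x => _) = (fun x : R => (- (2 * v)^-1) *: (x * x))); last first.
    by apply/funext => z; rewrite /GRing.scale/= expr2 mulNr mulrC.
  have h := is_deriveZ (- (2 * v)^-1) (is_deriveM (is_derive_id x 1) (is_derive_id x 1)).
  apply: (is_derive_eq h); rewrite /GRing.scale/=; field; exact: lt0r_neq0.
have h2 := is_derive1_comp (is_derive_expR _) h1.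
have h3 := is_deriveZ ((Num.sqrt (2 * pi * v))^-1) h2.
by apply: (is_derive_eq h3); rewrite /GRing.scale/= /centered_pdf; ring.
Qed.

Lemma gauss_moment_boundary (v : R) m (u : nat -> R) : 0 < v -> (forall n, `|u n| = n%:R) ->
  (u n) ^+ m * centered_pdf v (u n) @[n --> \oo] --> (0 : R).
Proof.
move=> v0 un; have [C C0 hC] := centered_pdf_bound m.+1 v0.
have v20 : 0 < 2 * v by rewrite mulr_gt0.
pose P := (Num.sqrt (2 * pi * (2 * v)))^-1.
have gP x : centered_pdf (2 * v) x <= P.
  rewrite /centered_pdf ler_piMr ?invr_ge0// -[leRHS]expR0 ler_expR oppr_le0.
  by rewrite divr_ge0 ?sqr_ge0// ltW// mulr_gt0.
have lim : (C * P) * (n%:R)^-1 @[n --> \oo] --> (0 : R).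
  rewrite [X in _ --> X](_ : _ = (C * P) * 0); last by rewrite mulr0.
  by apply: cvgM; [exact: cvg_cst|exact: cvg_invn].
apply: norm_cvg0; apply: (@squeeze_cvgr _ _ _ _ (cst 0) (fun n => (C * P) * (n%:R)^-1)) => //; last exact: cvg_cst.
near=> n; rewrite normr_ge0/=.
have n0 : 0 < n%:R :> R by rewrite ltr0n; near: n; exact: nbhs_infty_gt.
rewrite ler_pdivlMr// normrM normrX un [`|centered_pdf _ _|]ger0_norm ?centered_pdf_ge0//.
rewrite mulrAC -exprSr -(un n); apply: (le_trans (hC _)).
by rewrite ler_wpM2l.
Unshelve. all: by end_near. Qed.

(** The derivative of x^n centered_pdf has integral zero; this is the recursion that defines gauss_moment. *)
Lemma integral_gauss_moment (v : R) m : 0 < v -> \int[mu]_x (x ^+ m * centered_pdf v x) = gauss_moment m v.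
Proof.
move=> v0.
pose F m x := x ^+ m * centered_pdf v x.
have dFm (n : nat) (x : R) : is_derive x 1 (F n) (n%:R * F n.-1 x - v^-1 * F n.+1 x).
  have hx : is_derive x 1 (fun x : R => x ^+ n) (n%:R * x ^+ n.-1).
    have h := @is_deriveX _ _ (id : R -> R) n x 1 1 (is_derive_id x 1).
    rewrite (_ : (fun x => _) = (id : R -> R) ^+ n); last by apply/funext => z; rewrite exprfctE.
    by apply: (is_derive_eq h); rewrite /GRing.scale/= mulr1.
  have h := is_deriveM hx (is_derive_centered_pdf x v0).
  apply: (is_derive_eq h); rewrite /GRing.scale/= /F exprS; field; exact: lt0r_neq0.
have cF n : continuous (F n).
  move=> x; apply: differentiable_continuous; apply/derivable1_diffP.
  by have [] := dFm n x.
have iF n : mu.-integrable setT (EFin \o F n) by exact: integrable_gauss_moment.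
have iZ a n : mu.-integrable setT (EFin \o (fun x => a * F n x)).
  exact: (@integrableZl _ _ _ mu _ measurableT a _ (iF n)).
have rec n : n%:R * \int[mu]_x F n.-1 x = v^-1 * \int[mu]_x F n.+1 x.
  apply/eqP; rewrite -subr_eq0 -RintegralZl// -RintegralZl//; apply/eqP.
  rewrite -RintegralB//.
  apply: (integral_derivative0 (dFm n)).
  - move=> x; have cZ a l : {for x, continuous (fun x => a * F l x)}.
      by apply: continuousM_fun; [exact: cst_continuous|exact: cF].
    exact: (continuousB_fun (cZ n%:R n.-1) (cZ v^-1 n.+1)).
  - exact: (@integrableB _ _ _ mu _ measurableT _ _ (iZ n%:R n.-1) (iZ v^-1 n.+1)).
  - by apply: gauss_moment_boundary => // n'; rewrite ger0_norm.
  - by apply: gauss_moment_boundary => // n'; rewrite normrN ger0_norm.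
elim/nat_ind2: m => [||n IH].
- rewrite -[RHS](integral_centered_pdf v0); apply: eq_Rintegral => x _; exact: mul1r.
- have := rec 0%N; rewrite mul0r => /esym/eqP; rewrite mulf_eq0 invr_eq0 gt_eqF//= => /eqP.
  by [].
- rewrite gauss_momentSS -IH; have := rec n.+1; rewrite /= => e.
  rewrite mulrAC e mulrC mulrA mulfV ?mul1r//; exact: lt0r_neq0.
Qed.

End gauss_one.

(** * Integrals of product functions over tuples *)

Section tuple_integral.
Variable R : realType.
Notation leb := (@lebesgue_measure R).

(** The inverse of snoc_front, through which the product structure is seen on tuples. *)
Definition unsnoc k (x : k.+1.-tuple R) : k.-tuple R * measurableTypeR R :=
  ([tuple of behead x], tnth x ord0).

Lemma measurable_unsnoc k : measurable_fun setT (@unsnoc k).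
Proof.
apply: measurable_fun_pair; first exact: measurable_behead.
exact: (@measurable_tnth _ _ _ (ord0 : 'I_k.+1)).
Qed.

Lemma snocK k : cancel (@snoc_front R k) (@unsnoc k).
Proof.
move=> [x y]; rewrite /unsnoc /snoc_front; congr pair; first exact/val_inj.
Qed.

(** Fubini's theorem and the Radon-Nikodym theorem ask for a sigma-finite measure; boxes of finite
    measure are pulled back from the product by unsnoc. *)
Lemma lebesgue_tuple_sigma_finite k : exists S : {sigma_finite_measure set (k.-tuple R) -> \bar R},
  (S : set (k.-tuple R) -> \bar R) = lebesgue_tuple R k.
Proof.
elim: k => [|k [S SE]].
  by exists (\d_[tuple] : {measure set (0.-tuple R) -> \bar R}).
have sf : sigma_finite setT (lebesgue_tuple R k.+1).
  have /sigma_finiteP[F [FT ndF Ffin]] := sigma_finiteT S.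
  have /sigma_finiteP[G [GT ndG Gfin]] := sigma_finiteT leb.
  exists (fun n => @unsnoc k @^-1` (F n `*` G n)).
    apply/seteqP; split => // x _.
    have : setT (unsnoc x).1 by []. rewrite FT => -[n _ Fn].
    have : setT (unsnoc x).2 by []. rewrite GT => -[m _ Gm].
    exists (maxn n m) => //; split.
      by move: Fn; exact/subsetPset/ndF/leq_maxl.
    by move: Gm; exact/subsetPset/ndG/leq_maxr.
  move=> n; have [mF Fn] := Ffin n; have [mG Gn] := Gfin n; split.
    by rewrite -[X in measurable X]setTI; apply: measurable_unsnoc => //; exact: measurableX.
  rewrite (_ : lebesgue_tuple R k.+1 _ = (S \x leb)%E (F n `*` G n)).
    by rewrite product_measure1E// lte_mul_pinfty// ge0_fin_numE.
  rewrite /= /pushforward -comp_preimage (_ : _ \o _ = id) ?preimage_id.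
    by rewrite -SE.
  by apply/funext => z; exact: snocK.
pose mix := Measure_isSigmaFinite.Build _ _ _ (lebesgue_tuple R k.+1) sf.
pose S' : {sigma_finite_measure set (k.+1.-tuple R) -> \bar R} := HB.pack (Measure.sort (lebesgue_tuple R k.+1)) mix.
by exists S'.
Qed.

Lemma measurable_tuple_prod k (h : 'I_k -> R -> R) : (forall i, measurable_fun setT (h i)) ->
  measurable_fun setT (fun x : k.-tuple R => \prod_i h i (tnth x i)).
Proof.
move=> mh; apply: measurable_prod => i _.
apply: (measurableT_comp (mh i)); exact: measurable_tnth.
Qed.

(** Fubini's theorem, one coordinate at a time. *)
Lemma integral_tuple_prod k (h : 'I_k -> R -> R) :
  (forall i, leb.-integrable setT (EFin \o h i)) ->
  (lebesgue_tuple R k).-integrable setT (EFin \o (fun x => \prod_i h i (tnth x i))) /\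
  \int[lebesgue_tuple R k]_x (\prod_i h i (tnth x i)) = \prod_i \int[leb]_x h i x.
Proof.
elim: k h => [|k IH] h ih.
  have m0 : measurable_fun setT (EFin \o (fun x : 0.-tuple R => \prod_i h i (tnth x i))).
    by apply/measurable_EFinP; apply: measurable_tuple_prod => -[].
  split.
    apply/integrableP; split => //.
    rewrite integral_dirac//; last exact: measurableT_comp.
    by rewrite diracT mul1e /= big_ord0 normr1 ltry.
  by rewrite /Rintegral integral_dirac// diracT mul1e /= !big_ord0.
have mh i : measurable_fun setT (h i) by apply/measurable_EFinP; exact: measurable_int (ih i).
have [iP IE] := IH (fun i => h (lift ord0 i)) (fun i => ih (lift ord0 i)).
pose P (y : k.-tuple R) : R := \prod_i h (lift ord0 i) (tnth y i).
have [S SE] := lebesgue_tuple_sigma_finite k.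
have iP' : S.-integrable setT (EFin \o P).
  move: iP => /integrableP[mP lP]; apply/integrableP; split => //.
  by rewrite SE.
have mP : measurable_fun setT P by exact: (@measurable_tuple_prod k (fun i => h (lift ord0 i)) (fun i => mh (lift ord0 i))).
(* The integrand read on the product space, the new coordinate being the second one. *)
pose f (z : k.-tuple R * measurableTypeR R) : \bar R := (P z.1 * h ord0 z.2)%:E.
have mf : measurable_fun setT f.
  apply/measurable_EFinP; apply: measurable_funM.
    exact: (measurableT_comp mP measurable_fst).
  exact: (measurableT_comp (mh ord0) measurable_snd).
have if_ : (S \x leb)%E.-integrable setT f.
  apply/integrable12ltyP => //.
  have h0 := ih ord0.
  have [_ l0] := integrableP _ _ _ h0.
  have [_ lP] := integrableP _ _ _ iP'.
  rewrite (eq_integral (fun x => (\int[leb]_y `|(h ord0 y)%:E|) * `|(P x)%:E|)%E); last first.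
    move=> x _; rewrite muleC -ge0_integralZl//.
      by apply: eq_integral => y _; rewrite /f/= normrM.
    by apply: measurableT_comp => //; apply/measurable_EFinP; exact: mh.
  rewrite ge0_integralZl//.
  - apply: lte_mul_pinfty => //; first exact: integral_ge0.
    by rewrite ge0_fin_numE//; exact: integral_ge0.
  - by apply: measurableT_comp => //; exact/measurable_EFinP.
  - exact: integral_ge0.
have mQ : measurable_fun setT (EFin \o (fun x : k.+1.-tuple R => \prod_i h i (tnth x i))).
  by apply/measurable_EFinP; exact: measurable_tuple_prod.
have fE : (EFin \o (fun x : k.+1.-tuple R => \prod_i h i (tnth x i))) \o (@snoc_front R k) = f.
  apply/funext => -[y x]; rewrite /f /= big_ord_recl mulrC; congr (_ * _)%:E.
  by apply: eq_bigr => i _; rewrite /snoc_front tnthS.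
have eM : (lebesgue_tuple R k.+1 : set _ -> \bar R) = pushforward (S \x leb)%E (@snoc_front R k).
  by rewrite SE.
pose Q := EFin \o (fun x : k.+1.-tuple R => \prod_i h i (tnth x i)).
have iQ0 : (S \x leb)%E.-integrable (@snoc_front R k @^-1` setT) (Q \o (@snoc_front R k)).
  by rewrite preimage_setT fE.
have mQ' : measurable_fun setT Q := mQ.
have iQ := integrable_pushforward (@measurable_snoc_front R k) mQ' iQ0 measurableT.
have eI := integral_pushforward (@measurable_snoc_front R k) mQ' iQ0 measurableT.
have eI2 : (\int[lebesgue_tuple R k.+1]_x Q x = \int[(S \x leb)%E]_z f z)%E.
  etransitivity; first exact: (congr1 (fun m => integral m setT Q) eM).
  by rewrite eI preimage_setT fE.
split.
  move/integrableP: iQ => [_ lQ]; apply/integrableP; split => //.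
  move: lQ; congr (_ < _)%E.
  exact: (congr1 (fun m => integral m setT (fun x => `|Q x|%E)) (esym eM)).
rewrite /Rintegral -/Q eI2 -(integral12_prod_meas1 if_).
have IE' : (\int[S]_x (P x)%:E = (\prod_(i < k) \int[leb]_x h (lift ord0 i) x)%:E)%E.
  rewrite -IE /Rintegral SE fineK//.
  exact: integrable_fin_num iP.
have I0 : (\int[leb]_x (h ord0 x)%:E = (\int[leb]_x h ord0 x)%:E)%E.
  by rewrite /Rintegral fineK//; exact: integrable_fin_num (ih ord0).
transitivity (fine (\int[S]_x ((\int[leb]_x h ord0 x)%:E * (P x)%:E))%E).
  congr fine; apply: eq_integral => y _; rewrite /fubini_F /f/=.
  under eq_integral do rewrite EFinM.
  rewrite integralZl//; last exact: ih.
  by rewrite I0 muleC.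
rewrite integralZl// IE' /= big_ord_recl//.
Qed.

End tuple_integral.

(** * Polynomial integrals of the limiting Gaussian measure *)

Section gaussian_integral.
Variables (R : realType) (t : R) (k' : nat).
Local Notation k := k'.+1.
Hypothesis t_gt0 : 0 < t.
Notation leb := (@lebesgue_measure R).

Lemma limit_var_gt0 (i : 'I_k) : 0 < limit_var i t.
Proof.
rewrite /limit_var /var_first /var_other; case: (i == ord0); last first.
  by rewrite subr_gt0 -[X in _ < X]expR0 ltr_expR oppr_lt0.
rewrite expRN (_ : _ - _ = (expR t - 1 - t) / expR t); last first.
  by field; rewrite gt_eqF ?expR_gt0.
rewrite divr_gt0 ?expR_gt0//.
by have := expR_gt1Dx (lt0r_neq0 t_gt0); lra.
Qed.

Lemma invr_sqrtM (a b : R) : 0 < a -> 0 < b ->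
  (Num.sqrt (a * b))^-1 = a `^ (- 2^-1) * b `^ (- 2^-1).
Proof.
move=> a0 b0.
by rewrite -powR12_sqrt ?mulr_ge0 ?ltW// -powRN powRM ?ltW.
Qed.

(** The density is a product of one-dimensional normal densities: the normalizing constant
    distributes the powers of 2 pi and of the variances over the k factors. *)
Lemma gauss_densityE (x : k.-tuple R) :
  gauss_density t x = \prod_i centered_pdf (limit_var i t) (tnth x i).
Proof.
have V0 := limit_var_gt0 ord0.
have W0 : 0 < var_other t by rewrite /var_other subr_gt0 -[X in _ < X]expR0 ltr_expR oppr_lt0.
have p0 : 0 < 2 * pi :> R by rewrite mulr_gt0 ?pi_gt0.
rewrite /centered_pdf big_split/= /gauss_density; congr (_ * _).
  rewrite big_ord_recl (eq_bigr (fun=> (Num.sqrt (2 * pi * var_other t))^-1))//.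
  rewrite prodr_const card_ord /gauss_const !invr_sqrtM// exprMn.
  rewrite -!powR_mulrn ?powR_ge0// -!powRrM mulrACA -powRD; last first.
    by rewrite (gt_eqF p0) implybT.
  rewrite -mulrA; congr (_ `^ _ * (_ * _ `^ _)).
    by rewrite -natr1; field.
  by rewrite -natr1; field.
rewrite -expR_sum; congr expR.
rewrite big_ord_recl /limit_var eqxx (tnth_nth 0)/= big_add1/= big_mkord; congr (_ + _).
rewrite mulr_suml -sumrN; apply: eq_bigr => i _.
by rewrite (tnth_nth 0).
Qed.

Lemma mono_gauss_density (a : 'I_k -> nat) (x : k.-tuple R) :
  mono a (tnth x) * gauss_density t x =
  \prod_i (tnth x i ^+ a i * centered_pdf (limit_var i t) (tnth x i)).
Proof. by rewrite gauss_densityE /mono -big_split. Qed.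

Lemma integral_mono_gauss (a : 'I_k -> nat) :
  (lebesgue_tuple R k).-integrable setT
    (EFin \o (fun x => mono a (tnth x) * gauss_density t x)) /\
  \int[lebesgue_tuple R k]_x (mono a (tnth x) * gauss_density t x) = limit_moment a t.
Proof.
pose h i (y : R) := y ^+ a i * centered_pdf (limit_var i t) y.
have hi i : leb.-integrable setT (EFin \o h i).
  by apply: integrable_gauss_moment; exact: limit_var_gt0.
have [i1 i2] := integral_tuple_prod hi.
rewrite (_ : (fun x => _) = (fun x : k.-tuple R => \prod_i h i (tnth x i))); last first.
  by apply/funext => x; rewrite mono_gauss_density.
split => //; rewrite i2 /limit_moment; apply: eq_bigr => i _.
by rewrite integral_gauss_moment//; exact: limit_var_gt0.
Qed.

Lemma integral_meval_gauss (f : mpoly.mpoly k R) :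
  (lebesgue_tuple R k).-integrable setT
    (EFin \o (fun x => mpoly.meval (tnth x) f * gauss_density t x)) /\
  (\int[lebesgue_tuple R k]_x (mpoly.meval (tnth x) f * gauss_density t x)%:E =
   (\sum_(m <- mpoly.msupp f) mpoly.mcoeff m f * limit_moment (exponents m) t)%:E)%E.
Proof.
have im m : (lebesgue_tuple R k).-integrable setT (EFin \o (fun x => mpoly.mcoeff m f *
    (mono (exponents m) (tnth x) * gauss_density t x))).
  have [i1 _] := integral_mono_gauss (exponents m).
  exact: (@integrableZl _ _ _ (lebesgue_tuple R k) _ measurableT _ _ i1).
have iT := @integrable_Rsum _ _ _ (lebesgue_tuple R k) _ measurableT _ (mpoly.msupp f) _ im.
pose F (x : k.-tuple R) := mpoly.meval (tnth x) f * gauss_density t x.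
have fE : F = (fun x : k.-tuple R => \sum_(m <- mpoly.msupp f) mpoly.mcoeff m f *
    (mono (exponents m) (tnth x) * gauss_density t x)).
  apply/funext => x; rewrite /F meval_mono mulr_suml.
  by apply: eq_bigr => m _; exact: esym (mulrA _ _ _).
have iF : (lebesgue_tuple R k).-integrable setT (EFin \o F) by rewrite fE.
split; first exact: iF.
transitivity ((\int[lebesgue_tuple R k]_x F x)%:E).
  by rewrite /Rintegral fineK//; exact: integrable_fin_num iF.
rewrite fE Rintegral_sum//; congr EFin; apply: eq_bigr => m _.
have [i1 i2] := integral_mono_gauss (exponents m).
by rewrite (@RintegralZl _ _ _ (lebesgue_tuple R k) _ _ _ measurableT i1) i2.
Qed.

End gaussian_integral.

(** * Marginals of the infinite Gaussian measure *)

Section infinite_gaussian_integral.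
Variables (R : realType) (t : R) (k' : nat).
Local Notation k := k'.+1.
Hypothesis t_gt0 : 0 < t.

Definition first_coords (x : Rinfty R) : k.-tuple R := [tuple x i | i < k].

Lemma measurable_first_coords : measurable_fun setT first_coords.
Proof.
apply/measurable_fun_tnthP => i _ B mB; rewrite setTI.
apply: sub_gen_smallest; exists (val i), B; split => //.
by apply/seteqP; split => x; rewrite /preimage/= /first_coords tnth_mktuple.
Qed.

Lemma measurable_meval_tuple (f : mpoly.mpoly k R) :
  measurable_fun setT (fun x : k.-tuple R => mpoly.meval (tnth x) f).
Proof.
rewrite (_ : (fun x => _) = (fun x : k.-tuple R =>
    \sum_(m <- mpoly.msupp f) mpoly.mcoeff m f * mono (exponents m) (tnth x))); last first.
  by apply/funext => x; rewrite meval_mono.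
apply: measurable_sum => m; apply: measurable_funM; first exact: measurable_cst.
apply: (@measurable_tuple_prod _ _ (fun i (y : R) => y ^+ exponents m i)) => i.
exact: measurable_funX.
Qed.

Lemma measurable_gauss_density : measurable_fun setT (@gauss_density R t k).
Proof.
rewrite (_ : @gauss_density R t k = (fun x : k.-tuple R => \prod_i centered_pdf (limit_var i t) (tnth x i))); last first.
  by apply/funext => x; rewrite gauss_densityE.
apply: (@measurable_tuple_prod _ _ (fun i => centered_pdf (limit_var i t))) => i.
by apply: continuous_measurable_fun; apply: continuous_centered_pdf; exact: limit_var_gt0.
Qed.

(** A polynomial in the first coordinates is integrated against their joint distribution, which has
    a density with respect to Lebesgue measure.  Its integrability is inherited from
    integral_meval_gauss. *)
Lemma integral_infinite_gaussian (u : probability (Rinfty R) R) (f : mpoly.mpoly k R) :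
  infinite_gaussian t u ->
  (\int[u]_x (mpoly.meval (fun i : 'I_k => x i) f)%:E =
   \int[lebesgue_tuple R k]_x (mpoly.meval (tnth x) f * gauss_density t x)%:E)%E.
Proof.
move=> uP; have [S SE] := lebesgue_tuple_sigma_finite R k.
have mF := measurable_first_coords.
pose mixM := isMeasurableFun.Build _ _ _ _ first_coords mF.
pose F : {mfun Rinfty R >-> k.-tuple R} := HB.pack first_coords mixM.
pose nu : probability (k.-tuple R) R := distribution u F.
have mf := measurable_meval_tuple f.
have mg : measurable_fun setT (fun x : k.-tuple R => (gauss_density t x)%:E).
  by apply/measurable_EFinP; exact: measurable_gauss_density.
pose h (x : k.-tuple R) : \bar R := (mpoly.meval (tnth x) f)%:E.
have g0 (x : k.-tuple R) : 0 <= gauss_density t x.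
  by rewrite gauss_densityE//; apply: prodr_ge0 => i _; exact: centered_pdf_ge0.
have nuE A : measurable A -> nu A = (\int[S]_(x in A `&` setT) (gauss_density t x)%:E)%E.
  by move=> mA; rewrite setIT SE; exact: uP.
have mh : measurable_fun setT h by exact/measurable_EFinP.
have ih : nu.-integrable setT h.
  apply/integrableP; split => //.
  rewrite (ge0_integral_density measurableT mg nuE)//; last exact: measurableT_comp.
  have [/integrableP[_ +] _] := integral_meval_gauss t_gt0 f.
  rewrite -SE; congr (_ < _)%E; apply: eq_integral => x _.
  by rewrite /h /= normrM EFinM (ger0_norm (g0 x)).
transitivity (\int[nu]_x h x)%E.
  rewrite integral_distribution//.
    apply: eq_integral => x _; rewrite /h /=; congr (mpoly.meval _ f)%:E.
    by apply/funext => i; rewrite tnth_mktuple.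
  move/integrableP: ih => [_ ih]; apply/integrableP; split.
    exact: measurableT_comp.
  by rewrite ge0_integral_distribution in ih => //; exact: measurableT_comp.
have e := integral_density measurableT mg nuE ih.
apply: (etrans e); rewrite SE.
by apply: eq_integral => x _; rewrite /h EFinM.
Qed.

End infinite_gaussian_integral.

(** * The limit theorem *)

Section polynomial_limit.
Variables (R : realType) (t : R) (k' : nat).
Local Notation k := k'.+1.
Hypothesis t_gt0 : 0 < t.
Variable rho : forall N : nat, probability (borel_rV R N) R.
Hypothesis rhoP : forall N : nat, (k < N)%N -> shifted_heat_kernel_measure t (rho N).

(** The measures sigma and the heat kernels are only known to exist, for each N separately; choosing
    them yields a single sequence of moment functions to which moments_limit applies. *)
Lemma integral_poly_limit (f : mpoly.mpoly k R) :
  ((\int[rho N]_(x in shifted_sphere t N)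
    (mpoly.meval (fun i : 'I_k => coordinate x i) f)%:E)%E @[N --> \oo] -->
  (\sum_(m <- mpoly.msupp f) mpoly.mcoeff m f * limit_moment (exponents m) t)%:E)%E.
Proof.
pose moments_of N (m : ('I_k -> nat) -> R -> R) := (k < N)%N ->
  [/\ forall a (s : R), 0 < s ->
        is_derive s 1 (m a) (- decay_rate R N a * m a s
          - shift_m s N / N%:R * ((deg a)%:R - 1) * (a ord0)%:R * m (dec ord0 a) s
          + \sum_i (2^-1 * (1 - (if i == ord0 then shift_m s N ^+ 2 / N%:R else 0))
              * ((a i)%:R * ((a i)%:R - 1))) * m (dec i (dec i a)) s),
      forall a, m a s @[s --> 0^'+] --> ((deg a == 0%N)%:R : R)
    & (\int[rho N]_(x in shifted_sphere t N)
        (mpoly.meval (fun i : 'I_k => coordinate x i) f)%:E)%E =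
      (\sum_(m' <- mpoly.msupp f) mpoly.mcoeff m' f * m (exponents m') t)%:E].
have ex N : exists m, moments_of N m.
  have [kN|nkN] := boolP (k < N)%N; last by exists (fun _ _ => 0) => kN; rewrite kN in nkN.
  have [sigma [K [sigmaP KP rhoE]]] := rhoP kN.
  exists (mono_moment t kN sigma K) => _; split.
  - by move=> a s s0; exact: moment_ode.
  - by move=> a; exact: moment_init.
  - exact: (integral_poly_moments t_gt0 kN KP rhoE).
have [mom momP] := boolp.choice ex.
have lim a : mom N a t @[N --> \oo] --> limit_moment a t.
  have ode N kN := let: And3 h _ _ := momP N kN in h.
  have init N kN := let: And3 _ h _ := momP N kN in h.
  apply/cvgrPdist_le => e e0.
  have := moments_limit t ode init a e0; apply: filterS => N h.
  by rewrite distrC; exact: h (lexx t).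
apply: (@cvg_trans _ (((\sum_(m <- mpoly.msupp f) mpoly.mcoeff m f * mom N (exponents m) t)%:E)%E @[N --> \oo])).
  apply: near_eq_cvg; near=> N; have kN : (k < N)%N by near: N; exact: nbhs_infty_gt.
  by have [_ _ ->] := momP N kN.
apply: cvg_EFin; first exact: nearW.
apply: cvg_big => [|m _]; first exact: add_continuous.
by apply: cvgM; [exact: cvg_cst|exact: lim].
Unshelve. all: by end_near. Qed.

End polynomial_limit.

Theorem theorem1p2 (R : realType) (t : R) (k : nat) (f : mpoly.mpoly k R)
    (rho : forall N : nat, probability (borel_rV R N) R)
    (t_gt0 : 0 < t) (k_gt0 : (0 < k)%N)
    (rhoP : forall N : nat, (k < N)%N ->
      shifted_heat_kernel_measure t (rho N)) :
  let I (N : nat) := (\int[rho N]_(x in shifted_sphere t N)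
    (mpoly.meval (fun i : 'I_k => coordinate x i) f)%:E)%E in
  I @ \oo --> (\int[lebesgue_tuple R k]_x
    (mpoly.meval (tnth x) f * gauss_density t x)%:E)%E /\
  forall u : probability (Rinfty R) R, infinite_gaussian t u ->
    I @ \oo --> (\int[u]_x (mpoly.meval (fun i : 'I_k => x i) f)%:E)%E.
Proof.
case: k f k_gt0 rhoP => // k' f _ rhoP I.
have lim : I @ \oo --> (\int[lebesgue_tuple R k'.+1]_x
    (mpoly.meval (tnth x) f * gauss_density t x)%:E)%E.
  have [_ ->] := integral_meval_gauss t_gt0 f.
  exact: integral_poly_limit.
by split => // u uP; rewrite (integral_infinite_gaussian t_gt0).
Qed.
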